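(* Let $j$ be a joint invariant of total degree $d$ for the diagonal action of $\mathrm{SL}(W)$ on $\mathrm{Sym}^8(W^* )\oplus\mathrm{Sym}^4(W^* )\oplus\mathrm{Sym}^0(W^* )$. Then there is an element $P\in K[\mathrm{Sym}^4(V^* )]^{\mathrm{SL}(V)}$, homogeneous of degree $9d$ in the coefficients of the quartic form (that is, a polynomial in the Dixmier--Ohno invariants that is homogeneous of degree $9d$), such that $$ j\circ \ell^* = \frac{P}{u^{2d}} \quad\text{as functions on } Z. $$ Moreover, one has an equality of functions on $Y$ $$ \frac{j\,\ell^*\,T}{(b_0\,\ell^*\,T)^d} = \frac{5^d\,P}{I_9^{\,d}}, $$ meaning: for every $F\in Y$ with $I_9(F)\neq 0$ and every $T\in\mathrm{GL}(V)$ such that $\rho(F).T$ is a non-zero scalar multiple of $v_2^2-v_1v_3$, one has $b_0(\ell^*(F.T))\ne 0$ and $j(\ell^*(F.T))/b_0(\ell^*(F.T))^d = 5^d P(F)/I_9(F)^d$.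
   Context: $K$ is an algebraically closed field of characteristic $0$. $V$ is a $3$-dimensional $K$-vector space with basis $v_1,v_2,v_3$ and dual basis $x_1,x_2,x_3$ of $V^*$; $W$ is $2$-dimensional with dual coordinates $z_1,z_2$. $\mathrm{Sym}^n(V^* )$ is the space of degree $n$ forms in $x_1,x_2,x_3$, $\mathrm{Sym}^r(V)$ that of degree $r$ forms in $v_1,v_2,v_3$. $K[U]$ denotes the ring of polynomial functions on a vector space (or regular functions on a variety) $U$. Actions: $\mathrm{GL}(V)$ acts on the right on $\mathrm{Sym}^n(V^* )$ by $F.T=F\circ T$ (substitute $x\mapsto [T]x$ with $x$ a column), and on $\mathrm{Sym}^r(V)$ by $\gamma.T=T^{-1}.\gamma$, where the left action is the natural one induced from $V$. $\mathrm{SL}(W)$ acts on binary forms on the right by substitution: $T=\begin{pmatrix}a&b\\c&d\end{pmatrix}$ sends $z_1\mapsto az_1+bz_2$, $z_2\mapsto cz_1+dz_2$. A contravariant of ternary quartics of degree $d$ and order $r$ is an $\mathrm{SL}(V)$-equivariant homogeneous polynomial map $\mathrm{Sym}^4(V^* )\to\mathrm{Sym}^r(V)$ of degree $d$. Let $\psi$ be Salmon's contravariant of degree 3 and order 6: up to a fixed non-zero constant (immaterial here), $\psi(F)=v_3^{-6}(q_0q_2q_4+2q_1q_2q_3-q_0q_3^2-q_1^2q_4-q_2^3)$, where $v_3^4F(s,t,-(v_1s+v_2t)/v_3)=q_0s^4+4q_1s^3t+6q_2s^2t^2+4q_3st^3+q_4t^4$. Let $\rho(F)=\frac1{144}F(\partial_{v_1},\partial_{v_2},\partial_{v_3})\,\psi(F)$;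 this is the (up to scalar unique non-zero) contravariant of degree 4 and order 2. For a quadratic form $Q$ let $H(Q)$ be one half of its matrix of second partial derivatives; for matrices put $\langle A,B\rangle=\sum_{i,j}a_{ij}b_{ij}$. Let $\mathcal T(F)=\frac1{12}\,\rho(F)(\partial_{x_1},\partial_{x_2},\partial_{x_3})F$ (a quadratic form in the $x_i$), $I_9(F)=\langle H(\mathcal T(F)),H(\rho(F))\rangle$ and $I_{12}(F)=\det H(\rho(F))$; these are $\mathrm{SL}(V)$-invariants of degree 9 and 12. By a theorem of Ohno, $K[\mathrm{Sym}^4(V^* )]^{\mathrm{SL}(V)}$ is generated by 13 homogeneous invariants, the Dixmier--Ohno invariants; so a ''polynomial in the Dixmier--Ohno invariants of homogeneous degree $m$'' is the same as a homogeneous element of degree $m$ of this ring. $Y=\{F\in\mathrm{Sym}^4(V^* ): I_{12}(F)\ne0\}$ and $Z=\{F\in\mathrm{Sym}^4(V^* ):\rho(F)=u(F)\,(v_2^2-v_1v_3)\text{ for some }u(F)\in K^*\}\subset Y$; $u$ is thus a nowhere vanishing regular function on $Z$. $\ell^*:\mathrm{Sym}^4(V^* )\to\mathrm{Sym}^8(W^* )\oplus\mathrm{Sym}^4(W^* )\oplus\mathrm{Sym}^0(W^* )$ is the linear isomorphism given by $x_1^4\mapsto(z_1^8,0,0)$; $x_1^3x_2\mapsto(2z_1^7z_2,0,0)$; $x_1^3x_3\mapsto(z_1^6z_2^2,-\frac3{14}z_1^4,0)$; $x_1^2x_2^2\mapsto(4z_1^6z_2^2,\frac17z_1^4,0)$;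 $x_1^2x_2x_3\mapsto(2z_1^5z_2^3,-\frac27z_1^3z_2,0)$; $x_1^2x_3^2\mapsto(z_1^4z_2^4,-\frac27z_1^2z_2^2,\frac1{30})$; $x_1x_2^3\mapsto(8z_1^5z_2^3,\frac67z_1^3z_2,0)$; $x_1x_2^2x_3\mapsto(4z_1^4z_2^4,-\frac17z_1^2z_2^2,-\frac1{30})$; $x_1x_2x_3^2\mapsto(2z_1^3z_2^5,-\frac27z_1z_2^3,0)$; $x_1x_3^3\mapsto(z_1^2z_2^6,-\frac3{14}z_2^4,0)$; $x_2^4\mapsto(16z_1^4z_2^4,\frac{24}7z_1^2z_2^2,\frac15)$; $x_2^3x_3\mapsto(8z_1^3z_2^5,\frac67z_1z_2^3,0)$; $x_2^2x_3^2\mapsto(4z_1^2z_2^6,\frac17z_2^4,0)$; $x_2x_3^3\mapsto(2z_1z_2^7,0,0)$; $x_3^4\mapsto(z_2^8,0,0)$. A joint invariant is an $\mathrm{SL}(W)$-invariant polynomial function on $\mathrm{Sym}^8(W^* )\oplus\mathrm{Sym}^4(W^* )\oplus\mathrm{Sym}^0(W^* )$, homogeneous in the coefficients of each component; its total degree is the sum of its degrees in the three components. $b_0$ denotes the joint invariant of degree 1 given by projection to $\mathrm{Sym}^0(W^* )=K$. *)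

(* Defs.v *)
From HB Require Import structures.
From mathcomp Require Import all_boot all_order all_fingroup all_algebra.
From mathcomp Require Import mpoly.

Set Implicit Arguments.
Unset Strict Implicit.
Unset Printing Implicit Defensive.

Import GRing.Theory.
Local Open Scope ring_scope.

(* Forms of degree d in n variables over K are the elements of the library's  *)
(* vector space dhomog n K d.  The indices 0, 1, 2 : 'I_3 stand for 1, 2, 3.  *)

Notation quartic K := (dhomog 3 K 4).

Notation joint K := (dhomog 2 K 8 * dhomog 2 K 4 * dhomog 2 K 0)%type.

Section PolynomialFunctions.

Variables (K : fieldType) (U : vectType K).

(* Neither notion depends on the basis in which the coordinates are taken.    *)
Definition polyfun (f : U -> K) : Prop :=
  exists p : {mpoly K[\dim {: U}]},
    forall v, f v = p.@[fun i => coord (vbasis {: U}) i v].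

Definition homog_polyfun (e : nat) (f : U -> K) : Prop :=
  exists2 p : {mpoly K[\dim {: U}]}, p \is e.-homog &
    forall v, f v = p.@[fun i => coord (vbasis {: U}) i v].

End PolynomialFunctions.

Section Actions.

Variables (K : fieldType) (n : nat).

(* Polynomials in the dual coordinates: F o T, i.e. x |-> [T] x.              *)
Definition substmx (T : 'M[K]_n) (F : {mpoly K[n]}) : {mpoly K[n]} :=
  F \mPo [tuple \sum_(j < n) T i j *: 'X_j | i < n].

Lemma substmx_homog d (T : 'M[K]_n) (F : {mpoly K[n]}) :
  F \is d.-homog -> substmx T F \is d.-homog.
Proof.
move=> /dhomogP hF; rewrite /substmx comp_mpolyE big_seq.
apply: rpred_sum => m /hF hm; apply: dhomogZ.
have -> : d = (\sum_(i < n) m i)%N by rewrite -hm -mdegE.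
elim/big_ind2: _ => [|p1 e1 p2 e2 h1 h2|i _]; first exact: dhomog1.
  exact: dhomogM.
rewrite tnth_mktuple; have := @dhomogMn _ _ mdeg 1 _ (m i); rewrite mul1n; apply.
by apply: rpred_sum => j _; apply: dhomogZ; rewrite dhomogX /= mdeg1.
Qed.

Definition form_act d (F : dhomog n K d) (T : 'M[K]_n) : dhomog n K d :=
  DHomog (substmx_homog T (dhomog_is_dhomog F)).

(* Polynomials in the basis vectors: the left action is induced by            *)
(* T.v_j = \sum_i T_ij v_i, and the right action of T is that of T^-1.        *)
Definition vec_lact (T : 'M[K]_n) (g : {mpoly K[n]}) : {mpoly K[n]} :=
  g \mPo [tuple \sum_(i < n) T i j *: 'X_i | j < n].

Definition vec_act (g : {mpoly K[n]}) (T : 'M[K]_n) : {mpoly K[n]} :=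
  vec_lact (invmx T) g.

(* G(d/dx_1, ..., d/dx_n) F                                                   *)
Definition diffop (G F : {mpoly K[n]}) : {mpoly K[n]} :=
  \sum_(m <- msupp G) G@_m *: F^`M[m].

(* Meant for Q quadratic: the second derivatives are then constants.          *)
Definition half_hessian (Q : {mpoly K[n]}) : 'M[K]_n :=
  \matrix_(i, j) (2%:R^-1 * (Q^`M(i)^`M(j))@_0%MM).

Definition mx_pairing (A B : 'M[K]_n) : K := \sum_i \sum_j A i j * B i j.

End Actions.

Section TernaryQuartics.

Variable K : fieldType.
Implicit Types F : {mpoly K[3]}.

Let v1 : {mpoly K[3]} := 'X_0.
Let v2 : {mpoly K[3]} := 'X_1.
Let v3 : {mpoly K[3]} := 'X_2.
Let s : {mpoly {mpoly K[3]}[2]} := 'X_0.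
Let t : {mpoly {mpoly K[3]}[2]} := 'X_1.

(* For F quartic, v_3^4 F(s, t, -(v_1 s + v_2 t) / v_3), with denominators    *)
(* cleared: F(v_3 s, v_3 t, -(v_1 s + v_2 t)), in K[v_1, v_2, v_3][s, t].     *)
Definition salmon_restr F : {mpoly {mpoly K[3]}[2]} :=
  mmap (fun c : K => c%:MP%:MP)
       (tnth [tuple v3 *: s; v3 *: t; - (v1 *: s + v2 *: t)]) F.

Definition salmon_q F (i : nat) : {mpoly K[3]} :=
  ('C(4, i)%:R : K)^-1 *: (salmon_restr F)@_[multinom [tuple (4 - i)%N; i]].

Definition salmon_num F : {mpoly K[3]} :=
  let q := salmon_q F in
  q 0%N * q 2%N * q 4%N + 2%:R * (q 1%N * q 2%N * q 3%N) - q 0%N * q 3%N ^+ 2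
    - q 1%N ^+ 2 * q 4%N - q 2%N ^+ 3.

(* Exact division by v_3^6, done on each monomial: when F is a quartic form,  *)
(* v_3^6 divides every monomial of salmon_num F.                              *)
Definition psi F : {mpoly K[3]} :=
  \sum_(m <- msupp (salmon_num F))
     (salmon_num F)@_m *: 'X_[m - U_((2 : 'I_3)) *+ 6].

Definition rho F : {mpoly K[3]} := 144%:R^-1 *: diffop F (psi F).

Definition calT F : {mpoly K[3]} := 12%:R^-1 *: diffop (rho F) F.

Definition I9 F : K := mx_pairing (half_hessian (calT F)) (half_hessian (rho F)).

Definition I12 F : K := \det (half_hessian (rho F)).

Definition conic : {mpoly K[3]} := v2 ^+ 2 - v1 * v3.

(* F belongs to Z, with u(F) = u (which F determines).                        *)
Definition onZ F (u : K) : Prop := u != 0 /\ rho F = u *: conic.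

Definition SL_invariant (f : quartic K -> K) : Prop :=
  forall (T : 'M[K]_3) (F : quartic K), \det T = 1 -> f (form_act F T) = f F.

End TernaryQuartics.

Section JointInvariants.

Variable K : fieldType.

Lemma zmon_homog (a b : nat) :
  ('X_[K, [multinom [tuple a; b]]] : {mpoly K[2]}) \is (a + b).-homog.
Proof. by rewrite dhomogX /= mdegE !big_ord_recl big_ord0 addn0. Qed.

(* z_1^a z_2^b *)
Definition z (a b : nat) : dhomog 2 K (a + b) := DHomog (zmon_homog a b).

(* The coefficient of x_1^a x_2^b x_3^c in F.                                 *)
Definition xcoef (F : quartic K) (a b c : nat) : K :=
  (F : {mpoly K[3]})@_[multinom [tuple a; b; c]].

Let J (f : dhomog 2 K 8) (g : dhomog 2 K 4) (h : K) : joint K :=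
  (f, g, h *: z 0 0).

Definition ellstar (F : quartic K) : joint K :=
    xcoef F 4 0 0 *: J (z 8 0) 0 0
  + xcoef F 3 1 0 *: J (2%:R *: z 7 1) 0 0
  + xcoef F 3 0 1 *: J (z 6 2) (- (3%:R / 14%:R) *: z 4 0) 0
  + xcoef F 2 2 0 *: J (4%:R *: z 6 2) (7%:R^-1 *: z 4 0) 0
  + xcoef F 2 1 1 *: J (2%:R *: z 5 3) (- (2%:R / 7%:R) *: z 3 1) 0
  + xcoef F 2 0 2 *: J (z 4 4) (- (2%:R / 7%:R) *: z 2 2) 30%:R^-1
  + xcoef F 1 3 0 *: J (8%:R *: z 5 3) ((6%:R / 7%:R) *: z 3 1) 0
  + xcoef F 1 2 1 *: J (4%:R *: z 4 4) (- 7%:R^-1 *: z 2 2) (- 30%:R^-1)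
  + xcoef F 1 1 2 *: J (2%:R *: z 3 5) (- (2%:R / 7%:R) *: z 1 3) 0
  + xcoef F 1 0 3 *: J (z 2 6) (- (3%:R / 14%:R) *: z 0 4) 0
  + xcoef F 0 4 0 *: J (16%:R *: z 4 4) ((24%:R / 7%:R) *: z 2 2) 5%:R^-1
  + xcoef F 0 3 1 *: J (8%:R *: z 3 5) ((6%:R / 7%:R) *: z 1 3) 0
  + xcoef F 0 2 2 *: J (4%:R *: z 2 6) (7%:R^-1 *: z 0 4) 0
  + xcoef F 0 1 3 *: J (2%:R *: z 1 7) 0 0
  + xcoef F 0 0 4 *: J (z 0 8) 0 0.

Definition joint_act (w : joint K) (T : 'M[K]_2) : joint K :=
  (form_act w.1.1 T, form_act w.1.2 T, form_act w.2 T).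

(* Sym^0(W^* ) is identified with K through the constant coefficient.         *)
Definition b0 (w : joint K) : K := (w.2 : {mpoly K[2]})@_0%MM.

Definition joint_invariant (d : nat) (j : joint K -> K) : Prop :=
  [/\ polyfun j,
      exists d1 d2 d3 : nat,
        [/\ d = (d1 + d2 + d3)%N,
            forall g h, homog_polyfun d1 (fun f => j (f, g, h)),
            forall f h, homog_polyfun d2 (fun g => j (f, g, h)) &
            forall f g, homog_polyfun d3 (fun h => j (f, g, h))] &
      forall (T : 'M[K]_2) (w : joint K), \det T = 1 -> j (joint_act w T) = j w].

End JointInvariants.

(* Main.v *)
From HB Require Import structures.
Require Import Defs.
From mathcomp Require Import all_boot all_order all_fingroup all_algebra.
From mathcomp Require Import ssrcomplements mpoly.
From mathcomp Require Import ring zify.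

(** Why the theorem is true.  Put [h F = j (ellstar F)].  Let [nu] be the
    parametrization [(z_1^2, 2 z_1 z_2, z_2^2)] of the conic
    [x_2^2 = 4 x_1 x_3], which is dual to [v_2^2 = v_1 v_3], and let [Delta]
    be the operator [d_2^2 - d_1 d_3] attached to the latter.  The table of
    coefficients defining [ellstar] amounts to

      [ellstar F = (F o nu, Delta F o nu / 14, Delta^2 F / 120)],

    so [ellstar] is equivariant for the symmetric square from SL2 to the
    orthogonal group SO3 of the conic ([ellstar_equivariant]).  Hence for
    fixed [F] the function [T |-> h (F.T)] of a 3 x 3 matrix [T] is
    polynomial, homogeneous of degree [4 d], and unchanged when [T] is
    multiplied on the right by an element of SO3.

    By the first fundamental theorem for SO3, such a function of even degree
    is a polynomial in the entries of [T H0 T^t], where [H0] is the half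
    Hessian of the conic ([SO3_first_fundamental_theorem]).  The theorem is
    proved with coefficients in any ring containing the rationals, and used
    over the ring of polynomials in the coefficients of [F]; this gives a
    polynomial [Phi (F, S)] with [h (F.T) = Phi (F, T H0 T^t)].  Then

      [P F = Phi (F, H (rho F))]

    is the required invariant ([gram_factorization]).  Indeed every symmetric
    matrix has the form [T H0 T^t] ([conic_congruence]), so [P F] is
    [h (F.T)] for any [T] with [T H0 T^t = H (rho F)].  Choosing [T] suitably
    yields all the properties of [P]: replacing [T] by [a^2 T] follows the
    scaling of [F] by [a], since [rho] has degree 4, and gives the degree
    [9 d]; replacing [T] by [det(g)^3 g^-1 T] follows the action of [g], and
    gives [P (F.g) = det(g)^(12 d) P F] ([invariant_polynomial]); and a scalar
    matrix [T] gives the value [u^(2 d) h F] on [Z].  The last formula of the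
    theorem reduces to this value, because [I9] is multiplied by [det^12]
    ([I9_substmx]) and equals [5 u^2 b0 (ellstar F)] on [Z] ([I9_b0_onZ]).

    The first fundamental theorem is proved with the Casimir operator of so3.
    For a polynomial [f] killed by so3, it becomes an identity between
    polarizations of [f] and Gram entries times contractions of [f], the
    latter being invariants of smaller degree ([casimir]).  On a component of
    fixed row degrees the polarizations either multiply [f] by a number or
    make its row degrees more unequal; the resulting coefficient of [f]
    vanishes only in degree 0 and for the determinant, which has odd degree.
    So [f] is reached by induction on the degree and on the inequality of the
    row degrees ([gramalg_weight]).

    The contravariance of [psi] rests on the fact that the catalecticant of a
    binary quartic has weight 6 ([cubic_on_comb]).  The numerator in the
    definition of [psi F] is the catalecticant of [F] on the plane orthogonal
    to [v], in a basis that depends on [v]; comparing it with other bases of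
    this plane shows that [v_3^6] divides it ([salmon_num_div]) and that
    [psi (F.g)] is [det(g)^6] times the transform of [psi F]
    ([psi_substmx]). *)

Set Implicit Arguments.
Unset Strict Implicit.
Unset Printing Implicit Defensive.

Import GRing.Theory.
Local Open Scope ring_scope.

(** * Substitutions and constant coefficient operators *)

(** With this principle, identities between ring morphisms or linear operators
    only have to be checked on constants and variables. *)
Lemma mpoly_alg_ind n (R : nzRingType) (P : {mpoly R[n]} -> Prop) :
  (forall c, P c%:MP) -> (forall i, P 'X_i) ->
  (forall p q, P p -> P q -> P (p + q)) ->
  (forall p q, P p -> P q -> P (p * q)) -> forall p, P p.
Proof.
move=> PC PX PD PM; have PE m : P 'X_[m].
  rewrite mpolyXE_id; elim/big_ind: _ => //; first by rewrite -mpolyC1.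
  move=> i _; elim: (m i) => [|k IH]; first by rewrite expr0 -mpolyC1.
  by rewrite exprS; apply: PM.
elim/mpolyind => [|c m p _ _ Pp]; first by rewrite -mpolyC0.
by apply: PD => //; rewrite -mul_mpolyC; apply: PM.
Qed.

Lemma mderivXU n (R : nzRingType) (i j : 'I_n) :
  ('X_i : {mpoly R[n]})^`M(j) = (i == j)%:R.
Proof.
rewrite mderivX mnm1E; case: eqP => [->|_]; last by rewrite scale0r.
rewrite scale1r -mpolyX0; congr 'X_[_]; apply/mnmP => k.
by rewrite mnmBE subnn mnm0E.
Qed.

(** The chain rule, uniform in the derivation: it serves for partial
    derivatives, for derivatives along a curve and for polarizations. *)
Lemma derivation_mmap n (R S : comNzRingType) (f : {rmorphism R -> S})
    (h : 'I_n -> S) (delta : S -> S) :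
  {morph delta : x y / x + y} ->
  (forall x y, delta (x * y) = delta x * y + x * delta y) ->
  (forall c, delta (f c) = 0) ->
  forall p, delta (mmap f h p) = \sum_i mmap f h p^`M(i) * delta (h i).
Proof.
move=> dD dM dC; elim/mpoly_alg_ind => [c|i|p q IHp IHq|p q IHp IHq].
- rewrite mmapC dC big1 // => i _; by rewrite mderivC mmap0 mul0r.
- rewrite mmapX mmap1U (bigD1 i) //= mderivXU eqxx rmorph1 mul1r.
  rewrite big1 ?addr0 // => k neq_ki.
  by rewrite mderivXU eq_sym (negPf neq_ki) mmap0 mul0r.
- rewrite mmapD dD IHp IHq -big_split; apply: eq_bigr => i _.
  by rewrite /= mderivD mmapD mulrDl.
- rewrite rmorphM dM IHp IHq mulr_suml mulr_sumr -big_split.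
  apply: eq_bigr => i _ /=; rewrite mderivM mmapD !rmorphM /=; ring.
Qed.

Lemma mderiv_comp n k (K : comNzRingType) (l : n.-tuple {mpoly K[k]})
    (p : {mpoly K[n]}) i :
  (p \mPo l)^`M(i) = \sum_j (p^`M(j) \mPo l) * (tnth l j)^`M(i).
Proof.
apply: (@derivation_mmap _ _ _ (@mpolyC k K) (tnth l) (mderiv i)).
- exact: mderivD.
- exact: mderivM.
- by move=> c; rewrite mderivC.
Qed.

Section Substitution.
Variables (K : fieldType) (n : nat).
Implicit Types (F G : {mpoly K[n]}) (A B T : 'M[K]_n).

Definition linforms T : n.-tuple {mpoly K[n]} :=
  [tuple \sum_(j < n) T i j *: 'X_j | i < n].

Lemma substmxE T F : substmx T F = F \mPo linforms T.
Proof. by []. Qed.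

Lemma substmxXU T i : substmx T 'X_i = \sum_(j < n) T i j *: 'X_j.
Proof. by rewrite substmxE comp_mpolyXU -tnth_nth tnth_mktuple. Qed.

Lemma substmxC T c : substmx T c%:MP = c%:MP.
Proof. exact: comp_mpolyC. Qed.

Lemma substmxD T F G : substmx T (F + G) = substmx T F + substmx T G.
Proof. exact: comp_mpolyD. Qed.

Lemma substmxZ T c F : substmx T (c *: F) = c *: substmx T F.
Proof. exact: comp_mpolyZ. Qed.

Lemma substmxM T F G : substmx T (F * G) = substmx T F * substmx T G.
Proof. exact: rmorphM. Qed.

Lemma substmx_sum T I (r : seq I) (P : pred I) (f : I -> {mpoly K[n]}) :
  substmx T (\sum_(i <- r | P i) f i) = \sum_(i <- r | P i) substmx T (f i).
Proof. exact: raddf_sum. Qed.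

Lemma substmx_mul A B F : substmx A (substmx B F) = substmx (B *m A) F.
Proof.
elim/mpoly_alg_ind: F => [c|i|p q IHp IHq|p q IHp IHq].
- by rewrite !substmxC.
- rewrite !substmxXU substmx_sum.
  under eq_bigr do rewrite substmxZ substmxXU scaler_sumr.
  rewrite exchange_big; apply: eq_bigr => k _ /=.
  by rewrite mxE scaler_suml; apply: eq_bigr => j _; rewrite scalerA.
- by rewrite !substmxD IHp IHq.
- by rewrite !substmxM IHp IHq.
Qed.

Lemma substmx1 F : substmx 1%:M F = F.
Proof.
rewrite -[RHS]comp_mpoly_id substmxE; congr (_ \mPo _); apply: eq_from_tnth => i.
rewrite !tnth_mktuple (bigD1 i) //= mxE eqxx scale1r big1 ?addr0 // => j nji.
by rewrite mxE eq_sym (negPf nji) scale0r.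
Qed.

Lemma vec_actE F T : vec_act F T = substmx (invmx T)^T F.
Proof.
rewrite /vec_act /vec_lact substmxE; congr (_ \mPo _); apply: eq_from_tnth => i.
by rewrite !tnth_mktuple; apply: eq_bigr => j _; rewrite [in RHS]mxE.
Qed.

Lemma mderiv_substmx T F i :
  (substmx T F)^`M(i) = \sum_k T k i *: substmx T F^`M(k).
Proof.
rewrite substmxE mderiv_comp; apply: eq_bigr => k _.
rewrite tnth_mktuple [X in _ * X]raddf_sum (bigD1 i) //= [X in _ + X]big1 => [|j nji].
  by rewrite addr0 mderivZ mderivXU eqxx -scalerAr mulr1.
by rewrite mderivZ mderivXU (negPf nji) scaler0.
Qed.

Lemma diffopwE k G F : (msize G <= k)%N ->
  diffop G F = \sum_(m : 'X_{1..n < k}) G@_m *: F^`M[m].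
Proof.
move=> lt_Gk; pose I : subFinType _ := 'X_{1..n < k}.
rewrite /diffop (big_mksub I) //=; first last.
+ by move=> x /msize_mdeg_lt /leq_trans /(_ lt_Gk) ->.
+ by rewrite msupp_uniq.
rewrite big_rmcond //= => m /memN_msupp_eq0 ->; by rewrite scale0r.
Qed.

Lemma diffopDl F G1 G2 : diffop (G1 + G2) F = diffop G1 F + diffop G2 F.
Proof.
pose k := maxn (msize G1) (msize G2).
rewrite !(@diffopwE k) ?leq_maxl ?leq_maxr //; last exact: msizeD_le.
rewrite -big_split; apply: eq_bigr => m _ /=; by rewrite mcoeffD scalerDl.
Qed.

Lemma diffopZl F c G : diffop (c *: G) F = c *: diffop G F.
Proof.
rewrite !(@diffopwE (msize G)) ?msizeZ_le // scaler_sumr.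
by apply: eq_bigr => m _; rewrite mcoeffZ scalerA.
Qed.

Lemma diffop0l F : diffop 0 F = 0.
Proof. by have := diffopZl F 0 0; rewrite !scale0r. Qed.

Lemma diffopDr G F1 F2 : diffop G (F1 + F2) = diffop G F1 + diffop G F2.
Proof.
rewrite /diffop -big_split /=; apply: eq_bigr => m _; by rewrite mderivmD scalerDr.
Qed.

Lemma diffopZr G c F : diffop G (c *: F) = c *: diffop G F.
Proof.
rewrite /diffop scaler_sumr; apply: eq_bigr => m _.
by rewrite mderivmZ !scalerA mulrC.
Qed.

Lemma diffop_monom m F : diffop 'X_[m] F = F^`M[m].
Proof. by rewrite /diffop msuppX big_seq1 mcoeffX eqxx scale1r. Qed.

Lemma diffopC c F : diffop c%:MP F = c *: F.
Proof. by rewrite -alg_mpolyC diffopZl -mpolyX0 diffop_monom mderivm0m. Qed.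

Lemma diffopX i F : diffop 'X_i F = F^`M(i).
Proof. by rewrite diffop_monom mderivmU1m. Qed.

Lemma diffop_suml I (r : seq I) (P : pred I) (f : I -> {mpoly K[n]}) F :
  diffop (\sum_(i <- r | P i) f i) F = \sum_(i <- r | P i) diffop (f i) F.
Proof.
exact: (big_morph (fun G => diffop G F) (diffopDl F) (diffop0l F)).
Qed.

Lemma diffopM G1 G2 F : diffop (G1 * G2) F = diffop G1 (diffop G2 F).
Proof.
rewrite {1}(mpolyE G1) mulr_suml diffop_suml [RHS]/diffop.
apply: eq_bigr => m1 _; rewrite -scalerAl diffopZl; congr (_ *: _).
rewrite {1}(mpolyE G2) mulr_sumr diffop_suml [diffop G2 F]/diffop raddf_sum /=.
apply: eq_bigr => m2 _; rewrite -scalerAr diffopZl mderivmZ -mpolyXD.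
by rewrite diffop_monom addmC mderivmDm.
Qed.

(** On variables this is the duality between [A] and [B]; both sides turn
    products of symbols into compositions, so the general case follows. *)
Lemma diffop_substmx A B G F : A *m B^T = 1%:M ->
  diffop (substmx A G) (substmx B F) = substmx B (diffop G F).
Proof.
move=> AB1; elim/mpoly_alg_ind: G F => [c|i|p q IHp IHq|p q IHp IHq] F.
- by rewrite substmxC !diffopC substmxZ.
- have ABik k : \sum_j A i j * B k j = (i == k)%:R.
    have /matrixP/(_ i k) := AB1; rewrite !mxE => <-.
    by apply: eq_bigr => j _; rewrite mxE.
  rewrite substmxXU diffop_suml diffopX.
  under eq_bigr do rewrite diffopZl diffopX mderiv_substmx scaler_sumr.
  rewrite exchange_big (bigD1 i) //= [X in _ + X]big1 => [|k nki].
    under eq_bigr do rewrite scalerA.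
    by rewrite -scaler_suml ABik eqxx scale1r addr0.
  under eq_bigr do rewrite scalerA.
  by rewrite -scaler_suml ABik eq_sym (negPf nki) scale0r.
- by rewrite substmxD !diffopDl IHp IHq substmxD.
- by rewrite substmxM !diffopM IHq IHp.
Qed.

End Substitution.

(** * Half Hessians *)

Section Hessian.
Variables (K : fieldType) (n : nat).
Implicit Types (F Q : {mpoly K[n]}) (T A B : 'M[K]_n).

Lemma mcoeff0_substmx T F : (substmx T F)@_0%MM = F@_0%MM.
Proof.
elim/mpoly_alg_ind: F => [c|i|p q IHp IHq|p q IHp IHq].
- by rewrite substmxC.
- rewrite substmxXU raddf_sum big1 /= => [|j _].
    by rewrite mcoeffX mnm1_eq0.
  by rewrite mcoeffZ mcoeffX mnm1_eq0 mulr0.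
- by rewrite substmxD !mcoeffD IHp IHq.
- by rewrite substmxM !rmorphM /= IHp IHq.
Qed.

Lemma half_hessian_substmx T Q :
  half_hessian (substmx T Q) = T^T *m half_hessian Q *m T.
Proof.
apply/matrixP => i j; rewrite mxE mderiv_substmx (raddf_sum (mderiv j)).
rewrite (raddf_sum (mcoeff 0%MM)) mulr_sumr /=.
rewrite -mulmxA mxE; apply: eq_bigr => k _; rewrite !mxE.
rewrite mderivZ mcoeffZ mderiv_substmx (raddf_sum (mcoeff 0%MM)) !mulr_sumr.
apply: eq_bigr => l _; rewrite !mxE /= mcoeffZ mcoeff0_substmx; ring.
Qed.

Lemma half_hessianZ c Q : half_hessian (c *: Q) = c *: half_hessian Q.
Proof. by apply/matrixP => i j; rewrite !mxE !mderivZ mcoeffZ mulrCA. Qed.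

Lemma half_hessian_sym Q : (half_hessian Q)^T = half_hessian Q.
Proof. by apply/matrixP => i j; rewrite !mxE mderiv_comm. Qed.

Lemma mx_pairingE A B : mx_pairing A B = \tr (A *m B^T).
Proof.
by apply: eq_bigr => i _; rewrite mxE; apply: eq_bigr => j _; rewrite mxE.
Qed.

Lemma mx_pairingZ a b A B : mx_pairing (a *: A) (b *: B) = a * b * mx_pairing A B.
Proof.
rewrite /mx_pairing mulr_sumr; apply: eq_bigr => i _; rewrite mulr_sumr.
by apply: eq_bigr => j _; rewrite !mxE mulrACA.
Qed.

(** The pairing is a trace, which sees the two transformations as inverse to
    each other. *)
Lemma mx_pairing_contragredient T A B : T \in unitmx ->
  mx_pairing (T^T *m A *m T) (invmx T *m B *m (invmx T)^T) = mx_pairing A B.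
Proof.
move=> uT; rewrite !mx_pairingE !trmx_mul trmxK -!mulmxA mxtrace_mulC.
by rewrite -!mulmxA mulKVmx // -trmx_mul mulmxV // trmx1 mulmx1.
Qed.

End Hessian.

(** * Polynomial functions in characteristic 0 *)

Section CharZero.
Variables (K : fieldType) (charK : [pchar K] =i pred0).

Lemma natf_eq0 k : (k%:R == 0 :> K) = (k == 0)%N.
Proof. by have /pcharf0P -> := charK. Qed.

Lemma natf_inj : injective (fun k : nat => k%:R : K).
Proof.
move=> k l /=; wlog le_kl : k l / (k <= l)%N => [IH|].
  by case: (leqP k l) => [/IH//|/ltnW le_lk] /esym /(IH _ _ le_lk).
move=> /eqP; rewrite -subr_eq0 -opprB oppr_eq0 -natrB // natf_eq0 subn_eq0.
by move=> le_lk; apply/eqP; rewrite eqn_leq le_kl.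
Qed.

Lemma poly_eq_fun (p q : {poly K}) : (forall t, p.[t] = q.[t]) -> p = q.
Proof.
move=> eqpq; apply/eqP; rewrite -subr_eq0; set r := p - q.
apply/eqP/(@roots_geq_poly_eq0 _ r [seq k%:R | k <- iota 0 (size r)]).
- by apply/allP => _ /mapP[k _ ->]; rewrite rootE hornerD hornerN eqpq subrr.
- by rewrite map_inj_uniq ?iota_uniq //; exact: natf_inj.
- by rewrite size_map size_iota.
Qed.

Lemma horner_mmap n (h : 'I_n -> {poly K}) (p : {mpoly K[n]}) t :
  (mmap polyC h p).[t] = p.@[fun i => (h i).[t]].
Proof.
elim/mpoly_alg_ind: p => [c|i|p q IHp IHq|p q IHp IHq].
- by rewrite mmapC hornerC mevalC.
- by rewrite mmapX mmap1U mevalXU.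
- by rewrite mmapD hornerD mevalD IHp IHq.
- by rewrite !rmorphM /= hornerM IHp IHq.
Qed.

(** An infinite field determines the polynomial [c] by its values, so the
    hypothesis can be differentiated formally. *)
Lemma deriv_along_curve n (h : 'I_n -> {poly K}) (c : {poly K})
    (p : {mpoly K[n]}) :
  (forall t, p.@[fun i => (h i).[t]] = c.[t]) ->
  forall t, \sum_i p^`M(i).@[fun i => (h i).[t]] * (h i)^`().[t] = c^`().[t].
Proof.
move=> pc t; have -> : c = mmap polyC h p.
  by apply: poly_eq_fun => s; rewrite horner_mmap pc.
rewrite (@derivation_mmap _ _ _ _ h (fun q => q^`())) ?raddf_sum.
- rewrite -[RHS](horner_evalE) raddf_sum; apply: eq_bigr => i _ /=.
  by rewrite horner_evalE hornerM horner_mmap.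
- exact: derivD.
- exact: derivM.
- exact: derivC.
Qed.

(** Restricting to coordinate lines shows that all derivatives of [p] vanish
    everywhere too; at the origin they are the coefficients of [p] up to
    products of factorials, which are nonzero in characteristic 0. *)
Lemma mpoly_eq0_fun n (p : {mpoly K[n]}) : (forall v, p.@[v] = 0) -> p = 0.
Proof.
move=> p0.
have deriv0 (q : {mpoly K[n]}) i :
    (forall v, q.@[v] = 0) -> forall v, q^`M(i).@[v] = 0.
  move=> q0 v; pose h j : {poly K} := (v j)%:P + (i == j)%:R *: 'X.
  have := @deriv_along_curve n h 0 q _ 0; rewrite derivC horner0 => <-.
    rewrite (bigD1 i) //= big1 => [|j nji].
      rewrite addr0 /h eqxx scale1r derivD derivC derivX add0r hornerC mulr1.
      apply: meval_eq => j; rewrite hornerD hornerC hornerZ hornerX.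
      by rewrite mulr0 addr0.
    by rewrite /h eq_sym (negPf nji) scale0r addr0 derivC horner0 mulr0.
  by move=> t; rewrite q0 horner0.
(* An iterated derivative is a composition of derivatives in single variables. *)
have derivm0 m : forall v, p^`M[m].@[v] = 0.
  rewrite (multinomUE_id m); elim/big_ind: _ (p) p0 => [q|m1 m2 IH1 IH2 q|i _ q] q0.
  - by rewrite mderivm0m.
  - by rewrite mderivmDm; apply/IH2/IH1.
  - elim: (m i) q q0 => [|k IH] q q0; first by rewrite mderivn0.
    by rewrite mderivSn; apply/IH/deriv0.
apply/mpolyP => m; rewrite mcoeff0.
have at0 (q : {mpoly K[n]}) : q@_0%MM = q.@[fun=> 0].
  elim/mpoly_alg_ind: q => [c|i|q1 q2 IH1 IH2|q1 q2 IH1 IH2].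
  - by rewrite mcoeffC eqxx mulr1 mevalC.
  - by rewrite mcoeffX mnm1_eq0 mevalXU.
  - by rewrite mcoeffD mevalD IH1 IH2.
  - by rewrite !rmorphM /= IH1 IH2.
have := derivm0 m (fun=> 0); rewrite -at0 mcoeff_mderivm addm0 => /eqP.
rewrite -mulr_natr mulf_eq0 natf_eq0 => /orP[/eqP //|].
rewrite -leqn0 leqNgt prodn_gt0 // => i.
by rewrite ffact_gt0.
Qed.

Lemma mpoly_eq_fun n (p q : {mpoly K[n]}) :
  (forall v, p.@[v] = q.@[v]) -> p = q.
Proof.
move=> eqpq; apply/eqP; rewrite -subr_eq0; apply/eqP/mpoly_eq0_fun => v.
by rewrite mevalB eqpq subrr.
Qed.

End CharZero.

Section PolyFun.
Variables (K : fieldType) (U : vectType K).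
Implicit Types f g : U -> K.

Lemma polyfun_ext f g : f =1 g -> polyfun f -> polyfun g.
Proof. by move=> eqfg [p fp]; exists p => v; rewrite -eqfg. Qed.

Lemma polyfun_const c : polyfun (fun _ : U => c).
Proof. by exists c%:MP => v; rewrite mevalC. Qed.

Lemma polyfunD f g : polyfun f -> polyfun g -> polyfun (fun v => f v + g v).
Proof. by move=> [p fp] [q gq]; exists (p + q) => v; rewrite mevalD fp gq. Qed.

Lemma polyfunM f g : polyfun f -> polyfun g -> polyfun (fun v => f v * g v).
Proof. by move=> [p fp] [q gq]; exists (p * q) => v; rewrite mevalM fp gq. Qed.

Lemma polyfun_sum I (r : seq I) (P : pred I) (f : I -> U -> K) :
  (forall i, polyfun (f i)) -> polyfun (fun v => \sum_(i <- r | P i) f i v).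
Proof.
move=> pf; elim: r => [|i r IH].
  by apply: polyfun_ext (polyfun_const 0) => v; rewrite big_nil.
case Pi: (P i).
  by apply: polyfun_ext (polyfunD (pf i) IH) => v; rewrite big_cons Pi.
by apply: polyfun_ext IH => v; rewrite big_cons Pi.
Qed.

Lemma polyfun_meval n (p : {mpoly K[n]}) (f : 'I_n -> U -> K) :
  (forall i, polyfun (f i)) -> polyfun (fun v => p.@[fun i => f i v]).
Proof.
move=> pf; elim/mpoly_alg_ind: p => [c|i|p q IHp IHq|p q IHp IHq].
- by apply: polyfun_ext (polyfun_const c) => v; rewrite mevalC.
- by apply: polyfun_ext (pf i) => v; rewrite mevalXU.
- by apply: polyfun_ext (polyfunD IHp IHq) => v; rewrite mevalD.
- by apply: polyfun_ext (polyfunM IHp IHq) => v; rewrite mevalM.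
Qed.

Lemma polyfun_linear f :
  (forall a u v, f (a *: u + v) = a * f u + f v) -> polyfun f.
Proof.
move=> linf; have f0 : f 0 = 0.
  by have := linf 1 0 0; rewrite scale1r addr0 mul1r => /eqP;
    rewrite -subr_eq0 opprD addNKr oppr_eq0 => /eqP.
exists (\sum_(i < \dim {: U}) f (vbasis {: U})`_i *: 'X_i) => v.
rewrite {1}(coord_vbasis (memvf v)) raddf_sum /=.
under [RHS]eq_bigr do rewrite mevalZ mevalXU.
elim/big_rec2: _ => // i x y _ <-; by rewrite linf mulrC.
Qed.

Definition mpolyfun n (G : U -> {mpoly K[n]}) :=
  forall m, polyfun (fun v => (G v)@_m).

Section MPolyFun.
Variable n : nat.
Implicit Types G H : U -> {mpoly K[n]}.

Lemma mpolyfun_ext G H : G =1 H -> mpolyfun G -> mpolyfun H.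
Proof. by move=> eqGH pG m; apply: polyfun_ext (pG m) => v; rewrite eqGH. Qed.

Lemma mpolyfun_const p : mpolyfun (fun _ => p : {mpoly K[n]}).
Proof. by move=> m; exact: polyfun_const. Qed.

Lemma mpolyfunD G H : mpolyfun G -> mpolyfun H -> mpolyfun (fun v => G v + H v).
Proof.
move=> pG pH m; apply: polyfun_ext (polyfunD (pG m) (pH m)) => v.
by rewrite mcoeffD.
Qed.

Lemma mpolyfunZ f G : polyfun f -> mpolyfun G -> mpolyfun (fun v => f v *: G v).
Proof.
move=> pf pG m; apply: polyfun_ext (polyfunM pf (pG m)) => v.
by rewrite mcoeffZ.
Qed.

Lemma mpolyfunN G : mpolyfun G -> mpolyfun (fun v => - G v).
Proof.
move=> pG; apply: mpolyfun_ext (mpolyfunZ (polyfun_const (-1)) pG) => v.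
by rewrite scaleN1r.
Qed.

Lemma mpolyfunM G H : mpolyfun G -> mpolyfun H -> mpolyfun (fun v => G v * H v).
Proof.
move=> pG pH m.
apply: polyfun_ext (fun v => esym (mcoeffM (G v) (H v) m)) _.
by apply: polyfun_sum => k; apply: polyfunM.
Qed.

Lemma mpolyfunX G k : mpolyfun G -> mpolyfun (fun v => G v ^+ k).
Proof.
move=> pG; elim: k => [|k IH].
  by apply: mpolyfun_ext (mpolyfun_const 1) => v; rewrite expr0.
by apply: mpolyfun_ext (mpolyfunM pG IH) => v; rewrite exprS.
Qed.

Lemma mpolyfun_sum I (r : seq I) (P : pred I) (G : I -> U -> {mpoly K[n]}) :
  (forall i, mpolyfun (G i)) -> mpolyfun (fun v => \sum_(i <- r | P i) G i v).
Proof.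
move=> pG m; apply: polyfun_ext (polyfun_sum r P (fun i => pG i m)) => v.
by rewrite raddf_sum.
Qed.

Lemma mpolyfun_prod I (r : seq I) (G : I -> U -> {mpoly K[n]}) :
  (forall i, mpolyfun (G i)) -> mpolyfun (fun v => \prod_(i <- r) G i v).
Proof.
move=> pG; elim: r => [|i r IH].
  by apply: mpolyfun_ext (mpolyfun_const 1) => v; rewrite big_nil.
by apply: mpolyfun_ext (mpolyfunM (pG i) IH) => v; rewrite big_cons.
Qed.

End MPolyFun.
End PolyFun.

(** * Polarizations and the infinitesimal column action on matrices *)

Lemma sum3 (V : nmodType) (F : 'I_3 -> V) : \sum_i F i = F 0 + F 1 + F 2.
Proof.
rewrite !big_ord_recl big_ord0 addr0 addrA.
by congr (F _ + F _ + F _); apply: val_inj.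
Qed.

Section RowAndColumnOperators.
Variable R : comUnitRingType.
Local Notation P := {mpoly R[3 * 3]}.
Implicit Types (p q : P) (N M : 'M[R]_3).

(** The ring [P] consists of the polynomials in the entries of a generic 3 x 3
    matrix [T], numbered by [mxvec_index]. *)
Definition ent (i a : 'I_3) : P := 'X_(mxvec_index i a).
Definition dent (i a : 'I_3) p : P := p^`M(mxvec_index i a).

Lemma mxvec_index_eq (i a j b : 'I_3) :
  (mxvec_index j b == mxvec_index i a) = (i == j) && (a == b).
Proof.
apply/eqP/andP => [eqx|[/eqP-> /eqP->] //].
have [g gK _] := curry_mxvec_bij 3 3.
have := gK (j, b) isT; rewrite /= eqx (gK (i, a) isT) => -[-> ->].
by rewrite !eqxx.
Qed.

Lemma dent_ent i a j b : dent i a (ent j b) = ((i == j) && (a == b))%:R.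
Proof. by rewrite /dent mderivXU mxvec_index_eq. Qed.

Lemma dentD i a p q : dent i a (p + q) = dent i a p + dent i a q.
Proof. exact: mderivD. Qed.
Lemma dentMn i a p k : dent i a (p *+ k) = dent i a p *+ k.
Proof. exact: mderivMn. Qed.
Lemma dentZ i a c p : dent i a (c *: p) = c *: dent i a p.
Proof. exact: mderivZ. Qed.
Lemma dentM i a p q : dent i a (p * q) = dent i a p * q + p * dent i a q.
Proof. exact: mderivM. Qed.
Lemma dent_sum i a I (r : seq I) (Q : pred I) (F : I -> P) :
  dent i a (\sum_(k <- r | Q k) F k) = \sum_(k <- r | Q k) dent i a (F k).
Proof. exact: raddf_sum. Qed.
Lemma dentC i a j b p : dent i a (dent j b p) = dent j b (dent i a p).
Proof. exact: mderiv_comm. Qed.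

(** The derivative in the direction where a multiple of row [i] is added to row
    [j] of [T]. *)
Definition pol i j p := \sum_a ent i a * dent j a p.
(** The ring [P] consists of the polynomials in the entries of a generic 3 x 3
    matrix [T], numbered by [mxvec_index]. *)
Definition entmx N i b : P := \sum_a N a b *: ent i a.
(** The derivative at [t = 0] along the curve [T (1 + t N)]. *)
Definition lie N p := \sum_i \sum_b entmx N i b * dent i b p.

Lemma dent_entmx i a N j b : dent i a (entmx N j b) = (i == j)%:R * (N a b)%:MP.
Proof.
rewrite /entmx dent_sum (bigD1 a) //= big1 => [|c nca].
  by rewrite addr0 dentZ dent_ent eqxx andbT -mul_mpolyC mulrC.
by rewrite dentZ dent_ent [a == c]eq_sym (negPf nca) andbF scaler0.
Qed.

Lemma pol_pol i j k l p : pol i j (pol k l p) =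
  (j == k)%:R * pol i l p
    + \sum_a \sum_c ent i a * ent k c * dent j a (dent l c p).
Proof.
rewrite /pol mulr_sumr -big_split; apply: eq_bigr => a _ /=.
rewrite dent_sum mulr_sumr.
under [LHS]eq_bigr do rewrite dentM dent_ent mulrDr mulrA mulrA.
rewrite big_split (bigD1 a) //= [X in _ + X + _]big1 => [|c nca].
  by rewrite eqxx andbT addr0 [_ * (j == k)%:R]mulrC -mulrA.
by rewrite [a == c]eq_sym (negPf nca) andbF mulr0 mul0r.
Qed.

Lemma lie_lie N M p : lie N (lie M p) = lie (N *m M) p +
  \sum_i \sum_j \sum_b \sum_c
    entmx N i b * entmx M j c * dent i b (dent j c p).
Proof.
rewrite /lie -big_split; apply: eq_bigr => i _ /=.
rewrite [X in _ = _ + X]exchange_big /=.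
under [LHS]eq_bigr => b _.
  rewrite dent_sum mulr_sumr.
  under eq_bigr => j _.
    rewrite dent_sum mulr_sumr.
    under eq_bigr do rewrite dentM mulrDr dent_entmx mulrA.
    rewrite big_split; over.
  rewrite big_split; over.
rewrite big_split; congr (_ + _); last first.
  by apply: eq_bigr => b _; apply: eq_bigr => j _; apply: eq_bigr => c _; rewrite !mulrA.
under [LHS]eq_bigr => b _.
  rewrite (bigD1 i) //= [X in _ + X]big1 => [|j nji]; last first.
    by rewrite big1 // => c _; rewrite eq_sym (negPf nji) mul0r mulr0 mul0r.
  rewrite addr0 eqxx; under eq_bigr do rewrite mul1r.
  over.
rewrite exchange_big; apply: eq_bigr => c _; rewrite -mulr_suml; congr (_ * _).
rewrite /entmx; under eq_bigr do rewrite mulr_suml.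
rewrite exchange_big; apply: eq_bigr => a _ /=; rewrite mxE scaler_suml.
by apply: eq_bigr => b _; rewrite mulrC mul_mpolyC scalerA mulrC.
Qed.

(** Row operations on [T] commute with column operations. *)
Lemma pol_lie N i j p : pol i j (lie N p) = lie N (pol i j p).
Proof.
rewrite /pol /lie.
transitivity (\sum_a entmx N i a * dent j a p +
   \sum_a \sum_k \sum_b ent i a * entmx N k b * dent j a (dent k b p)).
  under [LHS]eq_bigr => a _.
    rewrite dent_sum mulr_sumr.
    under eq_bigr => k _.
      rewrite dent_sum mulr_sumr.
      under eq_bigr do rewrite dentM mulrDr dent_entmx mulrA.
      rewrite big_split; over.
    rewrite big_split; over.
  rewrite big_split; congr (_ + _); last first.
    by apply: eq_bigr => b _; apply: eq_bigr => k _; apply: eq_bigr => c _; rewrite !mulrA.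
  under [LHS]eq_bigr => a _.
    rewrite (bigD1 j) //= [X in _ + X]big1 => [|k nkj]; last first.
      by rewrite big1 // => c _; rewrite eq_sym (negPf nkj) mul0r mulr0 mul0r.
    rewrite addr0 eqxx; under eq_bigr do rewrite mul1r.
    over.
  rewrite exchange_big; apply: eq_bigr => c _; rewrite -mulr_suml; congr (_ * _).
  by apply: eq_bigr => a _; rewrite mulrC mul_mpolyC.
symmetry.
under [LHS]eq_bigr => k _.
  under eq_bigr => b _.
    rewrite dent_sum mulr_sumr.
    under eq_bigr do rewrite dentM mulrDr dent_ent mulrA.
    rewrite big_split; over.
  rewrite big_split; over.
rewrite big_split; congr (_ + _).
  rewrite (bigD1 i) //= [X in _ + X]big1 => [|k nki]; last first.
    rewrite big1 // => b _; rewrite big1 // => c _.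
    by rewrite (negPf nki) mulr0 mul0r.
  rewrite addr0; apply: eq_bigr => a _.
  rewrite (bigD1 a) //= [X in _ + X]big1 => [|c nca].
    by rewrite !eqxx mulr1 addr0.
  by rewrite [a == c]eq_sym (negPf nca) andbF mulr0 mul0r.
under eq_bigr do rewrite exchange_big.
rewrite exchange_big; apply: eq_bigr => a _; apply: eq_bigr => k _.
apply: eq_bigr => b _ /=; by rewrite mulrA [ent i a * _]mulrC dentC.
Qed.

Lemma dent_lie N i a p :
  dent i a (lie N p) = lie N (dent i a p) + \sum_b N a b *: dent i b p.
Proof.
rewrite /lie dent_sum addrC.
under [LHS]eq_bigr => k _.
  rewrite dent_sum; under eq_bigr do rewrite dentM dent_entmx dentC.
  rewrite big_split; over.
rewrite big_split; congr (_ + _).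
rewrite (bigD1 i) //= [X in _ + X]big1 => [|k nki]; last first.
  by rewrite big1 // => b _; rewrite eq_sym (negPf nki) !mul0r.
by rewrite addr0; apply: eq_bigr => b _; rewrite eqxx mul1r mul_mpolyC.
Qed.

End RowAndColumnOperators.

(** * The Casimir identity *)

Section Casimir.
Variable R : comUnitRingType.
Local Notation P := {mpoly R[3 * 3]}.
Implicit Types (p q f : P) (N M : 'M[R]_3).

(** The images in so3 of the standard basis [e], [f], [h] of sl2 under the
    symmetric square, in the coordinates [z_1^2], [2 z_1 z_2], [z_2^2]. *)
Definition so3_e : 'M[R]_3 := delta_mx 0 1 + delta_mx 1 2 *+ 2.
Definition so3_f : 'M[R]_3 := delta_mx 1 0 *+ 2 + delta_mx 2 1.
Definition so3_h : 'M[R]_3 := so3_e *m so3_f - so3_f *m so3_e.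

(** Twice the entries of [T H0 T^t], with [H0] the half Hessian of the conic;
    doubling keeps the coefficients integral. *)
Definition gram i j : P :=
  (ent R i 1 * ent R j 1) *+ 2 - ent R i 0 * ent R j 2 - ent R i 2 * ent R j 0.

(** The contraction of the gradients in rows [i] and [j] with the dual of the
    form that defines [gram], again doubled. *)
Definition lap i j p :=
  dent i 1 (dent j 1 p)
    - (dent i 0 (dent j 2 p) + dent i 2 (dent j 0 p)) *+ 2.

Lemma entmx_so3_e i : (entmx so3_e i 0 = 0) * (entmx so3_e i 1 = ent R i 0)
  * (entmx so3_e i 2 = ent R i 1 *+ 2).
Proof.
rewrite /entmx !sum3 !mxE /= !(mul0rn, mulr0n, mulr1n, scale0r, add0r, addr0, scalerDl, scale1r).
by do !split.
Qed.

Lemma entmx_so3_f i : (entmx so3_f i 0 = ent R i 1 *+ 2) * (entmx so3_f i 1 = ent R i 2)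
  * (entmx so3_f i 2 = 0).
Proof.
rewrite /entmx !sum3 !mxE /= !(mul0rn, mulr0n, mulr1n, scale0r, add0r, addr0, scalerDl, scale1r).
by do !split.
Qed.

Lemma mulmx_so3_ef : so3_e *m so3_f = (delta_mx 0 0 + delta_mx 1 1) *+ 2.
Proof.
rewrite /so3_e /so3_f mulmxDl !mulmxDr -!scaler_nat.
rewrite -!scalemxAl -?scalemxAr !mul_delta_mx_cond /=.
by rewrite !mulr0n !mulr1n ?scaler0 !(addr0, add0r) scalerDr !scaler_nat ?mulr2n.
Qed.

Lemma mulmx_so3_fe : so3_f *m so3_e = (delta_mx 1 1 + delta_mx 2 2) *+ 2.
Proof.
rewrite /so3_e /so3_f mulmxDl !mulmxDr -!scaler_nat.
rewrite -!scalemxAl -?scalemxAr !mul_delta_mx_cond /=.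
by rewrite !mulr0n !mulr1n ?scaler0 !(addr0, add0r) scalerDr !scaler_nat ?mulr2n.
Qed.

Lemma so3_hE : so3_h = (delta_mx 0 0 - delta_mx 2 2) *+ 2.
Proof. by rewrite /so3_h mulmx_so3_ef mulmx_so3_fe -mulrnBl opprD addrA addrK. Qed.

Lemma entmx_so3_h i : (entmx so3_h i 0 = ent R i 0 *+ 2) * (entmx so3_h i 1 = 0)
  * (entmx so3_h i 2 = - ent R i 2 *+ 2).
Proof.
rewrite so3_hE /entmx !sum3 !mxE /= !(mul0rn, mulr0n, mulr1n, scale0r, add0r, oppr0, addr0,
  subr0, sub0r, scalerDl, scale1r, scaleN1r).
by do !split; rewrite mulr2n.
Qed.

Lemma lieDl N M p : lie (N + M) p = lie N p + lie M p.
Proof.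
rewrite /lie -big_split; apply: eq_bigr => i _; rewrite -big_split.
apply: eq_bigr => b _ /=; rewrite -mulrDl; congr (_ * _).
by rewrite /entmx -big_split; apply: eq_bigr => a _; rewrite mxE scalerDl.
Qed.

Lemma lieZl c N p : lie (c *: N) p = c *: lie N p.
Proof.
rewrite /lie scaler_sumr; apply: eq_bigr => i _; rewrite scaler_sumr.
apply: eq_bigr => b _ /=; rewrite scalerAl; congr (_ * _).
by rewrite /entmx scaler_sumr; apply: eq_bigr => a _; rewrite mxE scalerA.
Qed.

Lemma lieBl N M p : lie (N - M) p = lie N p - lie M p.
Proof. by rewrite lieDl -scaleN1r lieZl scaleN1r. Qed.

Lemma lieDr N p q : lie N (p + q) = lie N p + lie N q.
Proof.
rewrite /lie -big_split; apply: eq_bigr => i _; rewrite -big_split.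
by apply: eq_bigr => b _ /=; rewrite -mulrDr dentD.
Qed.

Lemma lieZr N c p : lie N (c *: p) = c *: lie N p.
Proof.
rewrite /lie scaler_sumr; apply: eq_bigr => i _; rewrite scaler_sumr.
by apply: eq_bigr => b _ /=; rewrite dentZ scalerAr.
Qed.

Lemma lie0 N : lie N (0 : P) = 0.
Proof. by have := lieZr N 0 0; rewrite !scale0r. Qed.

Lemma lieMnr N p k : lie N (p *+ k) = lie N p *+ k.
Proof. by rewrite -scaler_nat lieZr scaler_nat. Qed.

Lemma lie1 p : lie 1%:M p = \sum_i pol i i p.
Proof.
rewrite /lie; apply: eq_bigr => i _; apply: eq_bigr => a _; congr (_ * _).
rewrite /entmx (bigD1 a) //= mxE eqxx scale1r big1 ?addr0 // => b nba.
by rewrite mxE (negPf nba) scale0r.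
Qed.

Lemma lie_second N M p i j :
  \sum_b \sum_c entmx N i b * entmx M j c * dent i b (dent j c p) =
  entmx N i 0 * (entmx M j 0 * dent i 0 (dent j 0 p) + entmx M j 1 * dent i 0 (dent j 1 p)
      + entmx M j 2 * dent i 0 (dent j 2 p))
  + entmx N i 1 * (entmx M j 0 * dent i 1 (dent j 0 p) + entmx M j 1 * dent i 1 (dent j 1 p)
      + entmx M j 2 * dent i 1 (dent j 2 p))
  + entmx N i 2 * (entmx M j 0 * dent i 2 (dent j 0 p) + entmx M j 1 * dent i 2 (dent j 1 p)
      + entmx M j 2 * dent i 2 (dent j 2 p)).
Proof. by rewrite !sum3 !mulrDr !mulrA. Qed.

(** The second order part of the Casimir operator.  Up to a scalar this is the
    classical expansion of the pairing of two bivectors, [(x /\ a, y /\ b) =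
    (x, y) (a, b) - (x, b) (a, y)], for the rows [x], [y] and the gradients
    [a], [b] in them. *)
Lemma second_order_identity p i j :
  (\sum_a \sum_c ent R i a * ent R j c * dent j a (dent i c p)) *+ 4
   - (gram i j * lap i j p) *+ 2 =
  (\sum_b \sum_c entmx so3_e i b * entmx so3_f j c * dent i b (dent j c p)
  + \sum_b \sum_c entmx so3_f i b * entmx so3_e j c * dent i b (dent j c p)) *+ 2
  + \sum_b \sum_c entmx so3_h i b * entmx so3_h j c * dent i b (dent j c p).
Proof.
rewrite !lie_second /lap /gram !entmx_so3_e !entmx_so3_f !entmx_so3_h !sum3.
rewrite !(dentC j _ i).
move: (ent R i 0) (ent R i 1) (ent R i 2) (ent R j 0) (ent R j 1) (ent R j 2).
move: (dent i 0 (dent j 0 p)) (dent i 0 (dent j 1 p)) (dent i 0 (dent j 2 p)).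
move: (dent i 1 (dent j 0 p)) (dent i 1 (dent j 1 p)) (dent i 1 (dent j 2 p)).
move: (dent i 2 (dent j 0 p)) (dent i 2 (dent j 1 p)) (dent i 2 (dent j 2 p)).
move=> *; ring.
Qed.

(** The Casimir element acts on the standard representation as a scalar. *)
(** The Casimir operator annihilates [f].  Its second order part is given by the
    identity above for every pair of rows, its first order part is a
    multiple of the Euler operator by [casimir_matrix], and what is left
    does not mention so3 any more. *)
Lemma casimir_matrix : (so3_e *m so3_f + so3_f *m so3_e) *+ 2 + so3_h *m so3_h = 8%:R%:M.
Proof.
rewrite mulmx_so3_ef mulmx_so3_fe so3_hE -!mulrnDl.
apply/matrixP => i j.
rewrite -!scaler_nat -?scalemxAl -?scalemxAr mulmxBl !mulmxBr !mul_delta_mx_cond.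
rewrite !mxE.
by case: i => [[|[|[|//]]]] // ?; case: j => [[|[|[|//]]]] // ?;
   rewrite ?mulr0n ?mulr1n ?mulr0 ?mulr1 /=; ring.
Qed.

(** The Casimir operator annihilates [f].  Its second order part is given by the
    identity above for every pair of rows, its first order part is a
    multiple of the Euler operator by [casimir_matrix], and what is left
    does not mention so3 any more. *)
Lemma casimir f : lie so3_e f = 0 -> lie so3_f f = 0 ->
  (\sum_i \sum_j gram i j * lap i j f) *+ 2 + lie 1%:M f *+ 4 =
  (\sum_i \sum_j pol i j (pol j i f)) *+ 4.
Proof.
move=> ef ff.
(* [so3_h] is the commutator of [so3_e] and [so3_f]. *)
have hf : lie so3_h f = 0.
  have := lie_lie so3_e so3_f f; rewrite ff lie0 => e1.
  have := lie_lie so3_f so3_e f; rewrite ef lie0 => e2.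
  rewrite /so3_h lieBl; apply/eqP; rewrite subr_eq0; apply/eqP.
  apply: (@addIr _ (\sum_i \sum_j \sum_b \sum_c
    entmx so3_e i b * entmx so3_f j c * dent i b (dent j c f))).
  rewrite -e1 {1}e2; congr (_ + _); rewrite exchange_big; apply: eq_bigr => i _.
  apply: eq_bigr => j _; rewrite exchange_big; apply: eq_bigr => b _.
  by apply: eq_bigr => c _; rewrite [entmx so3_f _ _ * _]mulrC dentC.
have := congr2 +%R (congr2 +%R (congr1 (fun g => g *+ 2) (lie_lie so3_e so3_f f))
   (congr1 (fun g => g *+ 2) (lie_lie so3_f so3_e f))) (lie_lie so3_h so3_h f).
rewrite hf ff ef !lie0 !mul0rn !addr0.
set s1 := \sum_i _; set s2 := \sum_i _; set s3 := \sum_i _ => eq0.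
have eqs : (s1 + s2) *+ 2 + s3 =
  (\sum_i \sum_j \sum_a \sum_c ent R i a * ent R j c * dent j a (dent i c f)) *+ 4
   - (\sum_i \sum_j gram i j * lap i j f) *+ 2.
  rewrite /s1 /s2 /s3 -!sumrMnl -sumrB -!big_split -sumrMnl -big_split.
  apply: eq_bigr => i _ /=.
  rewrite -!sumrMnl -sumrB -!big_split -sumrMnl -big_split.
  by apply: eq_bigr => j _ /=; rewrite second_order_identity.
have eqm : lie (so3_e *m so3_f) f *+ 2 + lie (so3_f *m so3_e) f *+ 2 + lie (so3_h *m so3_h) f
   = lie 1%:M f *+ 8.
  rewrite -mulrnDl -lieDl -scaler_nat -lieZl scaler_nat -lieDl casimir_matrix.
  by rewrite -scalemx1 lieZl scaler_nat.
have eqD : \sum_i \sum_j pol i j (pol j i f) = lie 1%:M f *+ 3 +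
  \sum_i \sum_j \sum_a \sum_c ent R i a * ent R j c * dent j a (dent i c f).
  rewrite lie1 -sumrMnl -big_split; apply: eq_bigr => i _ /=.
  under eq_bigr do rewrite pol_pol eqxx mul1r.
  by rewrite big_split sumr_const card_ord.
rewrite eqD mulrnDl.
move: eqs eqm eq0; move: (lie (so3_e *m so3_f) f) (lie (so3_f *m so3_e) f) => a b.
move: (lie (so3_h *m so3_h) f) (lie 1%:M f) (\sum_i _) (\sum_i _) => c E S G.
move: s1 s2 s3 => s1 s2 s3 eqs eqm eq0.
have : E *+ 8 + (G *+ 4 - S *+ 2) = 0.
  by rewrite -eqs -eqm [RHS]eq0; ring.
move=> /eqP; rewrite addrA subr_eq0 => /eqP <-; ring.
Qed.
End Casimir.

(** * Row degrees and the algebra of Gram entries *)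

Section Euler.
Variables (n : nat) (R : comNzRingType) (mf : measure n).
Implicit Types p : {mpoly R[n]}.

Lemma mcoeff_pihomog d p m :
  (pihomog mf d p)@_m = if mf m == d then p@_m else 0.
Proof.
elim/mpolyind: p => [|c m' p _ _ IH].
  by rewrite pihomog0 mcoeff0 if_same.
rewrite pihomogD linearZ /= pihomogX !mcoeffD !mcoeffZ IH.
have [<-{d IH}|neq] := eqVneq (mf m') d.
  rewrite mcoeffX; have [->|] := eqVneq m' m; first by rewrite eqxx.
  by case: ifP => // _ _; rewrite mulr0 addr0.
rewrite mcoeff0 mulr0 mcoeffX; have [<-|_] := eqVneq m' m.
  by rewrite (negPf neq) addr0.
by rewrite mulr0 !add0r.
Qed.

(** The operator replaces one variable by another of the same weight, hence
    preserves weights. *)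
Lemma pihomog_shift d (k l : 'I_n) p : mf U_(k)%MM = mf U_(l)%MM ->
  'X_k * (pihomog mf d p)^`M(l) = pihomog mf d ('X_k * p^`M(l)).
Proof.
move=> eqkl; elim/mpolyind: p => [|c m p _ _ IH].
  by rewrite pihomog0 mderiv0 mulr0 pihomog0.
rewrite pihomogD !mderivD !mulrDr pihomogD IH; congr (_ + _).
rewrite linearZ /= pihomogX !mderivZ -!scalerAr linearZ /=; congr (_ *: _).
have [m0|m_gt0] := posnP (m l).
  rewrite mderivX m0 scale0r mulr0 pihomog0.
  by case: ifP => _; rewrite ?mderiv0 ?mulr0 // mderivX m0 scale0r mulr0.
have mfm : mf (U_(k) + (m - U_(l)))%MM = mf m.
  rewrite mfD eqkl -mfD addmC submK //; apply/mnm_lepP => i.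
  by rewrite mnm1E; case: eqP => // <-.
have XE : 'X_k * ('X_[m])^`M(l) = (m l)%:R *: ('X_[U_(k) + (m - U_(l))] : {mpoly R[n]}).
  by rewrite mderivX -scalerAr mpolyXD.
rewrite XE [RHS]linearZ /= pihomogX mfm; case: ifP => // _.
by rewrite mderiv0 mulr0 scaler0.
Qed.

Lemma mcoeff_euler k p m : ('X_k * p^`M(k))@_m = p@_m *+ m k.
Proof.
elim/mpolyind: p => [|c m' p _ _ IH]; first by rewrite mderiv0 mulr0 mcoeff0 mul0rn.
rewrite mderivD mulrDr !mcoeffD IH mulrnDl; congr (_ + _).
rewrite mderivZ mderivX scalerA -scalerAr !mcoeffZ -mpolyXD !mcoeffX.
have [m0|m_gt0] := posnP (m' k).
  rewrite m0 mulr0 mul0r; case: eqVneq => [<-|_]; last by rewrite mulr0 mul0rn.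
  by rewrite m0 mulr0n.
have -> : (U_(k) + (m' - U_(k)))%MM = m'.
  rewrite addmC submK //; apply/mnm_lepP => i.
  by rewrite mnm1E; case: eqP => // <-.
case: eqVneq => [<-|_]; last by rewrite !mulr0 mul0rn.
by rewrite !mulr1 mulr_natr.
Qed.

End Euler.

Section GramAlgebra.
Variable R : comUnitRingType.
Hypothesis natU : forall k, k.+1%:R \is a @GRing.unit R.
Local Notation P := {mpoly R[3 * 3]}.
Implicit Types (p q f : P) (N M : 'M[R]_3).

Lemma mulrn_eq0_unit (V : lmodType R) (v : V) k : v *+ k.+1 = 0 -> v = 0.
Proof.
by move=> /(congr1 ( *:%R k.+1%:R^-1)); rewrite -scaler_nat scalerA mulVr // scale1r scaler0.
Qed.

(** Twice the entries of [T H0 T^t], with [H0] the half Hessian of the conic;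
    doubling keeps the coefficients integral. *)
(** The enumeration by [mxvec] lets matrices of Gram entries be substituted for
    the variables of a polynomial in [3 * 3] indeterminates. *)
Definition grams : (3 * 3).-tuple P :=
  [tuple mxvec (\matrix_(i, j) gram R i j) 0 k | k < 3 * 3].

(** Twice the entries of [T H0 T^t], with [H0] the half Hessian of the conic;
    doubling keeps the coefficients integral. *)
Definition gramalg f := exists q : P, f = q \mPo grams.

Lemma gramalgC c : gramalg c%:MP.
Proof. by exists c%:MP; rewrite comp_mpolyC. Qed.

Lemma gramalgD f g : gramalg f -> gramalg g -> gramalg (f + g).
Proof. by move=> [p ->] [q ->]; exists (p + q); rewrite comp_mpolyD. Qed.

Lemma gramalgM f g : gramalg f -> gramalg g -> gramalg (f * g).
Proof. by move=> [p ->] [q ->]; exists (p * q); rewrite rmorphM. Qed.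

Lemma gramalgZ c f : gramalg f -> gramalg (c *: f).
Proof. by move=> [p ->]; exists (c *: p); rewrite comp_mpolyZ. Qed.

Lemma gramalg0 : gramalg 0.
Proof. by rewrite -mpolyC0; apply: gramalgC. Qed.

Lemma gramalgMn f k : gramalg f -> gramalg (f *+ k).
Proof. by rewrite -scaler_nat; apply: gramalgZ. Qed.

Lemma gramalgB f g : gramalg f -> gramalg g -> gramalg (f - g).
Proof. by rewrite -scaleN1r => Af Ag; apply/gramalgD/gramalgZ. Qed.

Lemma gramalg_sum I (r : seq I) (Q : pred I) (F : I -> P) :
  (forall i, gramalg (F i)) -> gramalg (\sum_(i <- r | Q i) F i).
Proof.
by move=> AF; elim/big_ind: _ => //; [exact: gramalg0 | exact: gramalgD].
Qed.

Lemma gramalg_divn f k : gramalg (f *+ k.+1) -> gramalg f.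
Proof.
move/(gramalgZ k.+1%:R^-1).
by rewrite -scaler_nat scalerA mulVr // scale1r.
Qed.

Lemma gramalg_gram i j : gramalg (gram R i j).
Proof.
exists 'X_(mxvec_index i j).
by rewrite comp_mpolyXU -tnth_nth tnth_mktuple mxvecE mxE.
Qed.

Lemma polD i j p q : pol i j (p + q) = pol i j p + pol i j q.
Proof.
by rewrite /pol -big_split; apply: eq_bigr => a _; rewrite dentD mulrDr.
Qed.

Lemma polZ i j c p : pol i j (c *: p) = c *: pol i j p.
Proof.
by rewrite /pol scaler_sumr; apply: eq_bigr => a _; rewrite dentZ scalerAr.
Qed.

Lemma polMn i j p k : pol i j (p *+ k) = pol i j p *+ k.
Proof. by rewrite -scaler_nat polZ scaler_nat. Qed.

Lemma pol0 i j : pol i j (0 : P) = 0.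
Proof. by have := polZ i j 0 0; rewrite !scale0r. Qed.

Lemma polM i j p q : pol i j (p * q) = pol i j p * q + p * pol i j q.
Proof.
rewrite /pol mulr_suml mulr_sumr -big_split; apply: eq_bigr => a _ /=.
rewrite dentM; ring.
Qed.

Lemma pol_ent i j k a : pol i j (ent R k a) = (j == k)%:R * ent R i a.
Proof.
rewrite /pol (bigD1 a) //= big1 => [|b nba]; rewrite dent_ent.
  by rewrite eqxx andbT addr0 mulrC.
by rewrite (negPf nba) andbF mulr0.
Qed.

Lemma pol_gram i j k l :
  pol i j (gram R k l) = (j == k)%:R * gram R i l + (j == l)%:R * gram R k i.
Proof.
have polN p : pol i j (- p) = - pol i j p by rewrite -scaleN1r polZ scaleN1r.
rewrite /gram ?polMn !polD !polN ?polMn !polM !pol_ent.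
case: (j == k); case: (j == l) => /=; ring.
Qed.

(** A derivation preserves a subalgebra as soon as it maps the generators into
    it. *)
Lemma gramalg_pol i j f : gramalg f -> gramalg (pol i j f).
Proof.
move=> [q ->]; rewrite /comp_mpoly.
rewrite (@derivation_mmap _ _ _ (@mpolyC _ R) (tnth grams) (pol i j)).
- apply: gramalg_sum => k; apply: gramalgM; first by exists q^`M(k).
  rewrite tnth_mktuple; case/mxvec_indexP: k => k l; rewrite mxvecE mxE pol_gram.
  by apply: gramalgD; rewrite mulr_natl; apply/gramalgMn/gramalg_gram.
- exact: polD.
- exact: polM.
- move=> c; rewrite /pol big1 // => a _.
  by rewrite /dent mderivC mulr0.
Qed.

(** The defect of commutation is the action of [N] on the form with which the
    gradients are contracted. *)
Lemma lap_lie i j N p (S := fun a c => \sum_b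
    (N a b *: dent i b (dent j c p) + N c b *: dent i a (dent j b p))) :
  lap i j (lie N p) = lie N (lap i j p) + (S 1 1 - (S 0 2 + S 2 0) *+ 2).
Proof.
have lieN q : lie N (- q) = - lie N q by rewrite -scaleN1r lieZr scaleN1r.
have dd a c : dent i a (dent j c (lie N p)) =
    lie N (dent i a (dent j c p)) + S a c.
  rewrite !dent_lie dentD dent_lie -addrA; congr (_ + _).
  rewrite /S big_split; congr (_ + _); rewrite dent_sum.
  by apply: eq_bigr => b _; rewrite dentZ.
rewrite /lap !dd lieDr lieN lieMnr lieDr.
move: (lie N _) (lie N _) (lie N _) (S 1 1) (S 0 2) (S 2 0) => *; ring.
Qed.

(** The form of the contraction is fixed by so3, so the defect in [lap_lie]
    vanishes. *)
Lemma so3_invariant_lap i j f : lie (so3_e R) f = 0 -> lie (so3_f R) f = 0 ->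
  lie (so3_e R) (lap i j f) = 0 /\ lie (so3_f R) (lap i j f) = 0.
Proof.
have lap0 : lap i j (0 : P) = 0 by rewrite /lap /dent !mderiv0 addr0 mul0rn subr0.
move=> ef ff; split.
  have := lap_lie i j (so3_e R) f; cbv zeta; rewrite ef lap0 !sum3 !mxE /=.
  rewrite !(mul0rn, mulr0n, mulr1n, scale0r, add0r, addr0, scalerDl, scale1r).
  move=> eq0; rewrite -[LHS]addr0 [RHS]eq0; congr (_ + _).
  ring.
have := lap_lie i j (so3_f R) f; cbv zeta; rewrite ff lap0 !sum3 !mxE /=.
rewrite !(mul0rn, mulr0n, mulr1n, scale0r, add0r, addr0, scalerDl, scale1r).
move=> eq0; rewrite -[LHS]addr0 [RHS]eq0; congr (_ + _).
ring.
Qed.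

Lemma lap_euler i j f :
  lap i j (lie 1%:M f) = lie 1%:M (lap i j f) + lap i j f *+ 2.
Proof.
rewrite lap_lie; cbv zeta; congr (_ + _); rewrite !sum3 !mxE /=.
rewrite !(mul0rn, mulr0n, mulr1n, scale0r, add0r, addr0, scale1r) /lap.
ring.
Qed.

Lemma lapMn i j f k : lap i j (f *+ k) = lap i j f *+ k.
Proof.
by rewrite /lap !dentMn -mulrnDl -mulrnA mulnC mulrnA -mulrnBl.
Qed.

End GramAlgebra.

(** * The first fundamental theorem for SO3 in even degree *)

Section FirstFundamentalTheorem.
Variable R : comUnitRingType.
Hypothesis natU : forall k, k.+1%:R \is a @GRing.unit R.
Local Notation P := {mpoly R[3 * 3]}.
Implicit Types (p q f : P) (N M : 'M[R]_3).

Definition so3_invariant f := lie (so3_e R) f = 0 /\ lie (so3_f R) f = 0.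

Lemma mcoeff_pol_diag i f m :
  (pol i i f)@_m = f@_m *+ (\sum_a m (mxvec_index i a)).
Proof.
rewrite /pol raddf_sum -sumrMnr; apply: eq_bigr => a _ /=.
exact: mcoeff_euler.
Qed.

Lemma dent_eq0 i a f : pol i i f = 0 -> dent i a f = 0.
Proof.
move=> f0; apply/mpolyP => m; rewrite mcoeff_deriv mcoeff0.
have := congr1 (mcoeff (m + U_(mxvec_index i a))%MM) f0.
rewrite mcoeff_pol_diag mcoeff0 (bigD1 a) //= mnmDE mnm1E eqxx addn1 addSn.
by move=> /(mulrn_eq0_unit natU (V := R^o)) ->; rewrite mul0rn.
Qed.

Lemma pol_eq0 i j f : pol j j f = 0 -> pol i j f = 0.
Proof. by move=> f0; rewrite /pol big1 // => a _; rewrite dent_eq0 ?mulr0. Qed.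

Lemma so3_invariant_pol i j f : so3_invariant f -> so3_invariant (pol i j f).
Proof. by move=> [ef ff]; split; rewrite -pol_lie ?ef ?ff pol0. Qed.

Lemma pol_commutator i j f :
  i != j -> pol i j (pol j i f) = pol j i (pol i j f) + pol i i f - pol j j f.
Proof.
move=> nij; rewrite !pol_pol !eqxx !mul1r.
rewrite [X in pol j j f + X](_ : _ =
  \sum_a \sum_c ent R i a * ent R j c * dent j a (dent i c f)).
  ring.
rewrite exchange_big; apply: eq_bigr => a _; apply: eq_bigr => c _.
by rewrite [ent R j c * _]mulrC dentC.
Qed.

(** One unit of degree moves from row [j] to row [i].  The last hypothesis keeps
    the truncated subtraction exact. *)
Lemma pol_weight i j l f c :
  i != j -> pol l l f = f *+ c -> (l == j -> 0 < c)%N ->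
  pol l l (pol i j f) = pol i j f *+ (c + (l == i) - (l == j)).
Proof.
move=> nij eig cpos.
have -> : pol l l (pol i j f) = pol i j (pol l l f)
    + (l == i)%:R * pol l j f - (j == l)%:R * pol i l f.
  rewrite !pol_pol.
  rewrite [X in _ = _ + X + _ - _](_ : _ =
    \sum_a \sum_c ent R l a * ent R i c * dent l a (dent j c f)).
    ring.
  rewrite exchange_big; apply: eq_bigr => a _; apply: eq_bigr => b _.
  by rewrite [ent R i b * _]mulrC dentC.
rewrite eig polMn [j == l]eq_sym; move: cpos.
have [->|_] := eqVneq l i; first rewrite (negPf nij) => _.
  by rewrite mul1r mul0r subr0 addn1 subn0 mulrS addrC.
have [->|_] := eqVneq l j => /=; last by rewrite !mul0r addr0 subr0 addn0 subn0.
case: c eig => [|c] eig; first by move/(_ isT).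
by rewrite mul0r mul1r addr0 mulrSr addrK addn0 subn1.
Qed.

Lemma lap_eigen i j f k :
  lie 1%:M f = f *+ (2 * k.+1) -> lie 1%:M (lap i j f) = lap i j f *+ (2 * k).
Proof.
move=> eig; have := lap_euler i j f; rewrite eig lapMn (mulnS 2 k) (addnC 2) mulrnDr.
by move/addIr.
Qed.

Section Step.
Variable k : nat.
Hypothesis theorem_in_degree_k :
  forall f, so3_invariant f -> lie 1%:M f = f *+ (2 * k) -> gramalg f.

(** Let [D_ij] stand for [pol i j], let [lam] be the row degrees, and let [S] be
    the sum of the squares of the [lam i].  The Casimir identity reads [2 c
    f = G - 2 (A_01 + A_02 + A_12)], where [G] is the sum of the products of
    Gram entries with contractions of [f], where [A_ij = D_ij D_ji f + D_ji
    D_ij f - |lam i - lam j| f], and where [c = S + sum_(i < j) |lam i - lam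
    j| - sum_i lam i].  The contractions have smaller degree.  If [lam j <=
    lam i] then [A_ij = 2 D_ji D_ij f], and [D_ij f] is an invariant of the
    same degree with a larger [S]; as [S] is at most the square of the
    degree, descending induction on [S] applies, the variable [s] bounding
    the distance to this maximum.  Finally [c = 0] forces all the [lam i] to
    be equal and at most 1, which is impossible for a positive even sum. *)
Lemma gramalg_weight s (lam : 'I_3 -> nat) f : so3_invariant f ->
  (forall i, pol i i f = f *+ lam i) -> (\sum_i lam i = 2 * k.+1)%N ->
  ((2 * k.+1) ^ 2 - \sum_i lam i ^ 2 < s)%N -> gramalg f.
Proof.
elim: s lam f => // s IHs lam f invf eig sumlam lts.
pose dist i j := (lam i - lam j + (lam j - lam i))%N.
have gramalg_pair i j : i != j ->
    gramalg (pol i j (pol j i f) + pol j i (pol i j f) - f *+ dist i j).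
  wlog le_ji : i j / (lam j <= lam i)%N => [IH nij|nij].
    have [le_ji|/ltnW le_ij] := leqP (lam j) (lam i); first exact: IH.
    by rewrite [X in X - _]addrC /dist addnC; apply: IH; rewrite // eq_sym.
  rewrite pol_commutator // !eig /dist (eqP le_ji) addn0 mulrnBr //.
  rewrite (_ : _ - _ = pol j i (pol i j f) *+ 2); last by ring.
  apply/gramalgMn/gramalg_pol.
  have [lamj0|lamj_gt0] := posnP (lam j).
    by rewrite pol_eq0 ?eig ?lamj0 //; exact: gramalg0.
  pose mu l := (lam l + (l == i) - (l == j))%N.
  have mui : mu i = (lam i).+1 by rewrite /mu eqxx (negPf nij) addn1 subn0.
  have muj : mu j = (lam j).-1.
    by rewrite /mu eqxx eq_sym (negPf nij) addn0 subn1.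
  have muo l : l != i -> l != j -> mu l = lam l.
    by move=> /negPf nli /negPf nlj; rewrite /mu nli nlj addn0 subn0.
  have split3 (g : 'I_3 -> nat) :
      (\sum_l g l = g i + (g j + \sum_(l | (l != i) && (l != j)) g l))%N.
    by rewrite (bigD1 i) //= (bigD1 j) // eq_sym.
  have summu : (\sum_l mu l = 2 * k.+1)%N.
    rewrite -sumlam !split3 mui muj (eq_bigr lam) => [|l /andP[? ?]]; last first.
      by rewrite muo.
    by move: (\sum_(_ | _) _)%N => r; lia.
  have sqmu : (\sum_l mu l ^ 2 <= (2 * k.+1) ^ 2)%N.
    by rewrite -summu !sum3; nia.
  apply: (IHs mu) => //; first exact: so3_invariant_pol.
    by move=> l; apply: pol_weight => // /eqP ->; exact: lamj_gt0.
  move: lts sqmu; rewrite !split3 mui muj.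
  rewrite (eq_bigr (fun l => mu l ^ 2)%N (F1 := fun l => lam l ^ 2)%N); last first.
    by move=> l /andP[? ?]; rewrite muo.
  move: (\sum_(_ | _) _)%N => r.
  case: (lam j) lamj_gt0 le_ji => // lj _ lt_ji /=.
  have -> : ((lam i).+1 ^ 2 = lam i ^ 2 + 2 * lam i + 1)%N by lia.
  have -> : (lj.+1 ^ 2 = lj ^ 2 + 2 * lj + 1)%N by lia.
  by move: (lam i ^ 2)%N (lj ^ 2)%N ((2 * k.+1) ^ 2)%N; lia.
have distE i j : dist i j = (lam i - lam j + (lam j - lam i))%N by [].
clearbody dist; have [ef ff] := invf.
have := casimir ef ff; rewrite lie1.
under [X in _ + X *+ 4 = _]eq_bigr do rewrite eig.
rewrite sumrMnr sumlam => cas.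
pose A i j := pol i j (pol j i f) + pol j i (pol i j f) - f *+ dist i j.
have diag i : pol i i (pol i i f) = f *+ (lam i * lam i).
  by rewrite eig polMn eig mulrnA.
pose c := (\sum_i lam i * lam i + (dist 0%R 1%R + dist 0%R 2%R + dist 1%R 2%R) - 2 * k.+1)%N.
(* [n <= n * n], strictly unless [n <= 1]; a vanishing [c] would make the sum
   of the [lam i] equal to 0 or 3. *)
have c_gt0 : (0 < c)%N.
  rewrite /c !distE sum3; move: sumlam; rewrite sum3.
  have sq n : (n <= n * n)%N /\ ((2 <= n)%N -> (n < n * n)%N) by nia.
  have [] := sq (lam 0); have [] := sq (lam 1); have [] := sq (lam 2).
  move: (lam 0%R * lam 0%R)%N (lam 1%R * lam 1%R)%N (lam 2%R * lam 2%R)%N; lia.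
have cE : (c + 2 * k.+1 =
    \sum_i lam i * lam i + (dist 0%R 1%R + dist 0%R 2%R + dist 1%R 2%R))%N.
  by rewrite /c subnK //; apply: ltnW; rewrite -subn_gt0.
clearbody c.
have sumDD : \sum_i \sum_j pol i j (pol j i f) =
    f *+ c + f *+ (2 * k.+1) + (A 0 1 + A 0 2 + A 1 2).
  have expand (w : 'I_3 -> 'I_3 -> P) : \sum_i \sum_j w i j = \sum_i w i i
      + (w 0 1 + w 1 0 + (w 0 2 + w 2 0) + (w 1 2 + w 2 1)).
    by rewrite !sum3; ring.
  rewrite expand (eq_bigr _ (fun i _ => diag i)) sumrMnr -mulrnDr cE.
  rewrite (mulrnDr f (\sum_i _)) 2!(mulrnDr f _ (dist _ _)) /A.
  move: (pol _ _ (pol 0 1 f)) (pol _ _ (pol 0 2 f)) (pol _ _ (pol 1 2 f)).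
  move: (pol _ _ (pol 1 0 f)) (pol _ _ (pol 2 0 f)) (pol _ _ (pol 2 1 f)).
  by move=> *; ring.
have fc : f *+ c *+ 4 = (\sum_i \sum_j gram R i j * lap i j f) *+ 2
    - (A 0 1 + A 0 2 + A 1 2) *+ 4.
  apply: (@addIr _ (f *+ (2 * k.+1) *+ 4)); rewrite [RHS]addrAC cas sumDD.
  move: (A 0 1 + A 0 2 + A 1 2) (f *+ c) (f *+ _) => x y w; ring.
case: c c_gt0 fc {sumDD cE} => // c _; rewrite -mulrnA => fc.
apply: (gramalg_divn natU (k := 3 + c * 4)); rewrite [_ *+ _]fc.
apply: gramalgB; last first.
  by apply/gramalgMn/gramalgD; [apply: gramalgD|]; apply: gramalg_pair.
apply/gramalgMn/gramalg_sum => i; apply: gramalg_sum => j.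
apply: gramalgM; first exact: gramalg_gram.
apply: theorem_in_degree_k; first exact: so3_invariant_lap.
apply: lap_eigen; rewrite lie1; under eq_bigr do rewrite eig.
by rewrite sumrMnr sumlam.
Qed.

End Step.

Lemma mdeg_sum_rows (m : 'X_{1..3 * 3}) :
  (\sum_i \sum_a m (mxvec_index i a) = mdeg m)%N.
Proof.
rewrite mdegE pair_big /= [RHS](reindex _ (curry_mxvec_bij 3 3)) /=.
by apply: eq_bigr => -[i a].
Qed.

Definition rowdeg (i : 'I_3) (m : 'X_{1..3 * 3}) :=
  (\sum_a m (mxvec_index i a))%N.

Lemma rowdeg0 i : rowdeg i 0%MM = 0%N.
Proof. by rewrite /rowdeg big1 // => a _; rewrite mnm0E. Qed.

Lemma rowdegD i : {morph rowdeg i : m1 m2 / (m1 + m2)%MM >-> (m1 + m2)%N}.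
Proof.
by move=> m1 m2; rewrite /rowdeg -big_split; apply: eq_bigr => a _; rewrite mnmDE.
Qed.

HB.instance Definition _ i := isMeasure.Build (3 * 3)%N (rowdeg i) (rowdeg0 i) (rowdegD i).

Lemma rowdegU i j a : rowdeg i U_(mxvec_index j a)%MM = (i == j).
Proof.
rewrite /rowdeg (bigD1 a) //= mnm1E mxvec_index_eq eqxx andbT big1 ?addn0 //.
by move=> b nba; rewrite mnm1E mxvec_index_eq (negPf nba) andbF.
Qed.

Notation rowpart i d := (pihomog (rowdeg i) d).

Lemma lie_rowpart i d N f : lie N (rowpart i d f) = rowpart i d (lie N f).
Proof.
rewrite /lie raddf_sum; apply: eq_bigr => j _; rewrite raddf_sum.
apply: eq_bigr => b _; rewrite /entmx !mulr_suml raddf_sum.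
apply: eq_bigr => a _. rewrite -!scalerAl /= linearZ /=; congr (_ *: _).
by apply: pihomog_shift; rewrite /= !rowdegU.
Qed.

Lemma pol_rowpart i d j f : pol j j (rowpart i d f) = rowpart i d (pol j j f).
Proof.
rewrite /pol raddf_sum; apply: eq_bigr => a _ /=.
exact: pihomog_shift.
Qed.

Lemma pol_rowpart_eigen i d f : pol i i (rowpart i d f) = rowpart i d f *+ d.
Proof.
apply/mpolyP => m; rewrite mcoeffMn mcoeff_pol_diag mcoeff_pihomog.
by case: eqP => [<-|_] //; rewrite !mul0rn.
Qed.

Lemma so3_invariant_rowpart i d f : so3_invariant f -> so3_invariant (rowpart i d f).
Proof. by move=> [ef ff]; split; rewrite lie_rowpart ?ef ?ff pihomog0. Qed.

(** The action of so3 preserves row degrees, so [f] may be taken homogeneous in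
    each row.  Even degree is needed: the determinant is invariant under
    SO3, and only its square is a polynomial in the Gram entries. *)
Theorem SO3_first_fundamental_theorem k f :
  so3_invariant f -> lie 1%:M f = f *+ (2 * k) -> gramalg f.
Proof.
elim: k f => [|k IHk] f invf eig.
  suff -> : f = (f@_0%MM)%:MP by exact: gramalgC.
  apply/mpolyP => m; rewrite mcoeffC; case: eqVneq => [->|m_neq0].
    by rewrite mulr1.
  rewrite mulr0; have := congr1 (mcoeff m) eig; rewrite muln0 mulr0n lie1 raddf_sum.
  under eq_bigr do rewrite /= mcoeff_pol_diag.
  rewrite mcoeff0 sumrMnr mdeg_sum_rows -mdeg_eq0 in m_neq0 *.
  case: (mdeg m) m_neq0 => // e _.
  exact: (mulrn_eq0_unit natU (V := R^o)).
have parts (g : P) i : exists b, g = \sum_(d < b) rowpart i d g.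
  exists (mmeasure (rowdeg i) g); exact/pihomog_partitionE.
have [b0 ->] := parts f 0; apply: gramalg_sum => d0.
have [b1 ->] := parts (rowpart 0 d0 f) 1; apply: gramalg_sum => d1.
have [b2 ->] := parts (rowpart 1 d1 (rowpart 0 d0 f)) 2; apply: gramalg_sum => d2.
set g := rowpart 2 _ _.
pose lam (i : 'I_3) := [:: nat_of_ord d0; nat_of_ord d1; nat_of_ord d2]`_i.
have eigg i : pol i i g = g *+ lam i.
  case: i => [[|[|[|//]]]] lt_i; rewrite /lam /=.
  - rewrite (_ : Ordinal lt_i = 0); last exact: val_inj.
    by rewrite 2!pol_rowpart pol_rowpart_eigen !raddfMn.
  - rewrite (_ : Ordinal lt_i = 1); last exact: val_inj.
    by rewrite pol_rowpart pol_rowpart_eigen raddfMn.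
  - rewrite (_ : Ordinal lt_i = 2); last exact: val_inj.
    by rewrite pol_rowpart_eigen.
have invg : so3_invariant g by do 3!apply: so3_invariant_rowpart.
have eig1 : g *+ (\sum_i lam i) = g *+ (2 * k.+1).
  have : lie 1%:M g = g *+ (2 * k.+1) by rewrite !lie_rowpart eig !raddfMn.
  by rewrite lie1 (eq_bigr _ (fun i _ => eigg i)) sumrMnr.
have [sumlam|neq] := eqVneq (\sum_i lam i)%N (2 * k.+1)%N.
  exact: (gramalg_weight IHk invg eigg sumlam (leqnn _)).
suff -> : g = 0 by exact: gramalg0.
case: (ltngtP (\sum_i lam i)%N (2 * k.+1)%N) neq => // lt_kl _.
  have : g *+ (2 * k.+1 - \sum_i lam i) = 0 by rewrite mulrnBr ?eig1 ?subrr // ltnW.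
  rewrite -(prednK (n := _ - _)) ?subn_gt0 //; exact: mulrn_eq0_unit.
have : g *+ (\sum_i lam i - 2 * k.+1) = 0 by rewrite mulrnBr ?eig1 ?subrr // ltnW.
rewrite -(prednK (n := _ - _)) ?subn_gt0 //; exact: mulrn_eq0_unit.
Qed.

End FirstFundamentalTheorem.

(** * The catalecticant of a binary quartic *)

Section QuarticValues.
Variable A : comNzRingType.
Implicit Types q : nat -> A.

Definition quartic_val q (s t : A) : A :=
  q 0%N * s ^+ 4 + 4%:R * q 1%N * (s ^+ 3 * t)
  + 6%:R * q 2%N * (s ^+ 2 * t ^+ 2) + 4%:R * q 3%N * (s * t ^+ 3)
  + q 4%N * t ^+ 4.

(** The catalecticant, the classical cubic invariant of a binary quartic: the
    determinant of the Hankel matrix of [q]. *)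
Definition binary_cubic q : A :=
  q 0%N * q 2%N * q 4%N + 2%:R * (q 1%N * q 2%N * q 3%N) - q 0%N * q 3%N ^+ 2
    - q 1%N ^+ 2 * q 4%N - q 2%N ^+ 3.

(** The coefficients after the substitution of [a s + c t] and [b s + e t], with
    the binomial factors of [quartic_val] divided out; writing them out
    avoids any division. *)
Definition quartic_subst (a b c e : A) q (k : nat) : A :=
  match k with
  | 0 => q 0%N * a ^+ 4 + 4%:R * q 1%N * a ^+ 3 * b + 6%:R * q 2%N * a ^+ 2 * b ^+ 2
    + 4%:R * q 3%N * a * b ^+ 3 + q 4%N * b ^+ 4
  | 1 => q 0%N * a ^+ 3 * c + q 1%N * (a ^+ 3 * e + 3%:R * a ^+ 2 * b * c)
    + 3%:R * q 2%N * (a ^+ 2 * b * e + a * b ^+ 2 * c)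
    + q 3%N * (3%:R * a * b ^+ 2 * e + b ^+ 3 * c) + q 4%N * b ^+ 3 * e
  | 2 => q 0%N * a ^+ 2 * c ^+ 2 + 2%:R * q 1%N * (a ^+ 2 * c * e + a * b * c ^+ 2)
    + q 2%N * (a ^+ 2 * e ^+ 2 + 4%:R * a * b * c * e + b ^+ 2 * c ^+ 2)
    + 2%:R * q 3%N * (a * b * e ^+ 2 + b ^+ 2 * c * e) + q 4%N * b ^+ 2 * e ^+ 2
  | 3 => q 0%N * a * c ^+ 3 + q 1%N * (b * c ^+ 3 + 3%:R * a * c ^+ 2 * e)
    + 3%:R * q 2%N * (b * c ^+ 2 * e + a * c * e ^+ 2)
    + q 3%N * (3%:R * b * c * e ^+ 2 + a * e ^+ 3) + q 4%N * b * e ^+ 3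
  | _ => q 0%N * c ^+ 4 + 4%:R * q 1%N * c ^+ 3 * e + 6%:R * q 2%N * c ^+ 2 * e ^+ 2
    + 4%:R * q 3%N * c * e ^+ 3 + q 4%N * e ^+ 4
  end.

Lemma binary_cubic_subst a b c e q :
  binary_cubic (quartic_subst a b c e q) = (a * e - b * c) ^+ 6 * binary_cubic q.
Proof.
rewrite /binary_cubic /=; move: (q 0%N) (q 1%N) (q 2%N) (q 3%N) (q 4%N) => *.
ring.
Qed.

Lemma quartic_val_subst a b c e q s t :
  quartic_val q (a * s + c * t) (b * s + e * t) =
  quartic_val (quartic_subst a b c e q) s t.
Proof.
rewrite /quartic_val /=; move: (q 0%N) (q 1%N) (q 2%N) (q 3%N) (q 4%N) => *.
ring.
Qed.

End QuarticValues.

Section QuarticMorphism.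
Variables (A B : comNzRingType) (f : {rmorphism A -> B}).

Lemma rmorph_quartic_val q s t :
  f (quartic_val q s t) = quartic_val (f \o q) (f s) (f t).
Proof. by rewrite /quartic_val !(rmorph_nat, rmorphXn, rmorphD, rmorphM). Qed.

Lemma rmorph_binary_cubic q : f (binary_cubic q) = binary_cubic (f \o q).
Proof.
by rewrite /binary_cubic !(rmorph_nat, rmorphXn, rmorphD, rmorphN, rmorphM).
Qed.

Lemma rmorph_quartic_subst a b c e q k :
  f (quartic_subst a b c e q k)
    = quartic_subst (f a) (f b) (f c) (f e) (f \o q) k.
Proof.
by case: k => [|[|[|[|k]]]] /=; rewrite !(rmorph_nat, rmorphXn, rmorphD, rmorphM).
Qed.

End QuarticMorphism.

Lemma eq_quartic_val (A : comNzRingType) (q1 q2 : nat -> A) s t :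
  q1 =1 q2 -> quartic_val q1 s t = quartic_val q2 s t.
Proof. by move=> eqq; rewrite /quartic_val !eqq. Qed.

Lemma eq_binary_cubic (A : comNzRingType) (q1 q2 : nat -> A) :
  (forall k, (k < 5)%N -> q1 k = q2 k) -> binary_cubic q1 = binary_cubic q2.
Proof. by move=> eqq; rewrite /binary_cubic !eqq. Qed.

Section BinaryQuartic.
Variable A : comNzRingType.
Implicit Types (p : {mpoly A[2]}) (q : nat -> A).
Local Notation s := ('X_0 : {mpoly A[2]}).
Local Notation t := ('X_1 : {mpoly A[2]}).

Lemma monomial2E a b : 'X_[[multinom [tuple a; b]]] = s ^+ a * t ^+ b.
Proof.
rewrite mpolyXE_id big_ord_recl big_ord1 !mnm_tnth /=.
by congr ('X_ _ ^+ _ * 'X_ _ ^+ _); apply: val_inj.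
Qed.

Definition quartic_of q : {mpoly A[2]} := quartic_val (@mpolyC 2 A \o q) s t.

Lemma quartic_ofE q : quartic_of q = (q 0%N)%:MP * s ^+ 4
  + (4%:R * q 1%N)%:MP * (s ^+ 3 * t) + (6%:R * q 2%N)%:MP * (s ^+ 2 * t ^+ 2)
  + (4%:R * q 3%N)%:MP * (s * t ^+ 3) + (q 4%N)%:MP * t ^+ 4.
Proof. by rewrite !mpolyCM !mpolyC_nat. Qed.

Lemma mcoeff_quartic_of q k : (k < 5)%N ->
  (quartic_of q)@_[multinom [tuple (4 - k)%N; k]] = q k *+ 'C(4, k).
Proof.
have [a4 a3] : s ^+ 4 = 'X_[[multinom [tuple 4; 0]]] /\
    s ^+ 3 * t = 'X_[[multinom [tuple 3; 1]]].
  by rewrite !monomial2E mulr1.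
have [a2 a1] : s ^+ 2 * t ^+ 2 = 'X_[[multinom [tuple 2; 2]]] /\
    s * t ^+ 3 = 'X_[[multinom [tuple 1; 3]]].
  by rewrite !monomial2E.
have a0 : t ^+ 4 = 'X_[[multinom [tuple 0; 4]]] by rewrite monomial2E mul1r.
rewrite quartic_ofE a4 a3 a2 a1 a0.
case: k => [|[|[|[|[|//]]]]] _; rewrite !mcoeffD !mcoeffCM !mcoeffX;
  rewrite -!val_eqE /= ?mulr0 ?mulr1 ?addr0 ?add0r // mulr_natl; congr (_ *+ _).
Qed.

Lemma homog4_quartic p q : p \is 4.-homog ->
  (forall k, (k < 5)%N -> p@_[multinom [tuple (4 - k)%N; k]] = q k *+ 'C(4, k)) ->
  p = quartic_of q.
Proof.
move=> p4 pq; apply/mpolyP => m.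
have q4 : quartic_of q \is 4.-homog.
  have hX (i : 'I_2) : ('X_i : {mpoly A[2]}) \is 1.-homog by rewrite dhomogX /= mdeg1.
  rewrite quartic_ofE !mul_mpolyC.
  have h4 i := @dhomogMn _ _ mdeg 1 _ 4 (hX i); have h3 i := @dhomogMn _ _ mdeg 1 _ 3 (hX i).
  have h2 i := @dhomogMn _ _ mdeg 1 _ 2 (hX i).
  do ![apply: rpredD]; apply: dhomogZ => //.
  - exact: (dhomogM (h3 0) (hX 1)).
  - exact: (dhomogM (h2 0) (h2 1)).
  - exact: (dhomogM (hX 0) (h3 1)).
have [m4|] := eqVneq (mdeg m) 4%N; last first.
  by move=> nm; rewrite (dhomog_nemf_coeff p4 nm) (dhomog_nemf_coeff q4 nm).
have mE : m = [multinom [tuple (4 - m 1%R)%N; m 1%R]].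
  move: m4; rewrite mdegE big_ord_recl big_ord1 => m4.
  have e0 : (ord0 : 'I_2) = 0 by apply: val_inj.
  have e1 : lift ord0 ord0 = 1 :> 'I_2 by apply: val_inj.
  rewrite e0 e1 in m4; apply/mnmP => i; rewrite [RHS]mnm_tnth.
  case: i => [[|[|//]]] lti.
    by rewrite (_ : Ordinal lti = 0) ?(tnth_nth 0%N) /=; [lia | exact: val_inj].
  by rewrite (_ : Ordinal lti = 1) ?(tnth_nth 0%N) /=; [|exact: val_inj].
have lt5 : (m 1%R < 5)%N by rewrite ltnS -m4 mdegE (bigD1 1) //= leq_addr.
by rewrite mE pq // mcoeff_quartic_of.
Qed.

Lemma quartic_of_subst a b c e q :
  quartic_of q \mPo [tuple a%:MP * s + c%:MP * t; b%:MP * s + e%:MP * t] =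
  quartic_of (quartic_subst a b c e q).
Proof.
rewrite /quartic_of rmorph_quartic_val /= !comp_mpolyXU /=.
rewrite (@eq_quartic_val _ _ (@mpolyC 2 A \o q)) => [|k]; last first.
  by rewrite /= comp_mpolyC.
rewrite quartic_val_subst; apply: eq_quartic_val => k /=.
by rewrite rmorph_quartic_subst.
Qed.

End BinaryQuartic.

(** * Salmon's numerator as a catalecticant *)

Lemma cancel_sixth (D : idomainType) (a c x y : D) :
  a != 0 -> a ^+ 12 * x = (a * c) ^+ 6 * y -> a ^+ 6 * x = c ^+ 6 * y.
Proof.
move=> a_neq0 eqxy; apply: (@mulfI _ (a ^+ 6)); first by rewrite expf_neq0.
by rewrite mulrA -exprD eqxy exprMn mulrA.
Qed.

Lemma mpolyX_neq0 (R : nzRingType) n (m : 'X_{1..n}) : 'X_[m] != 0 :> {mpoly R[n]}.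
Proof. by rewrite -msupp_eq0 msuppX. Qed.

Section Salmon.
Variables (K : fieldType) (charK : [pchar K] =i pred0).
Local Notation A := {mpoly K[3]}.
Local Notation B := {mpoly A[2]}.
Implicit Types (F : A) (x y : 'I_3 -> A).

Definition lineform x y (i : 'I_3) : B := (x i)%:MP * 'X_0 + (y i)%:MP * 'X_1.

(** [F] at the generic point [s x + t y] of the plane spanned by two vectors
    whose coordinates are themselves polynomials. *)
Definition restrict x y F : B :=
  mmap (@mpolyC 2 A \o @mpolyC 3 K) (lineform x y) F.

Lemma restrictC x y c : restrict x y c%:MP = c%:MP%:MP.
Proof. by rewrite /restrict mmapC. Qed.

Lemma restrictX x y i : restrict x y 'X_i = lineform x y i.
Proof. by rewrite /restrict mmapX mmap1U. Qed.

Lemma restrictD x y F G : restrict x y (F + G) = restrict x y F + restrict x y G.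
Proof. by rewrite /restrict mmapD. Qed.

Lemma restrictM x y F G : restrict x y (F * G) = restrict x y F * restrict x y G.
Proof. by rewrite /restrict rmorphM. Qed.

Lemma restrict_homog x y F d : F \is d.-homog -> restrict x y F \is d.-homog.
Proof.
move=> /dhomogP hF; rewrite /restrict /mmap big_seq.
apply: rpred_sum => m /hF hm; rewrite mul_mpolyC; apply: dhomogZ.
have -> : d = (\sum_(i < 3) m i)%N by rewrite -hm -mdegE.
rewrite /mmap1; elim/big_ind2: _ => [|p1 e1 p2 e2 h1 h2|i _]; first exact: dhomog1.
  exact: dhomogM.
have := @dhomogMn _ _ mdeg 1 (lineform x y i) (m i); rewrite mul1n; apply.
by rewrite /lineform !mul_mpolyC; apply: rpredD; apply: dhomogZ; rewrite dhomogX /= mdeg1.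
Qed.

Lemma restrict_substmx x y (T : 'M[K]_3) F :
  restrict x y (substmx T F) =
  restrict (fun i => \sum_j T i j *: x j) (fun i => \sum_j T i j *: y j) F.
Proof.
elim/mpoly_alg_ind: F => [c|i|p q IHp IHq|p q IHp IHq].
- by rewrite substmxC !restrictC.
- rewrite substmxXU restrictX /restrict raddf_sum /lineform.
  rewrite !raddf_sum !mulr_suml -big_split; apply: eq_bigr => j _ /=.
  rewrite mmapZ mmapX mmap1U /= /lineform mulrDr !mulrA -!mpolyCM.
  by rewrite !mul_mpolyC.
- by rewrite substmxD 2!restrictD IHp IHq.
- by rewrite substmxM 2!restrictM IHp IHq.
Qed.

Lemma restrict_map (f : {rmorphism A -> A}) x y F : (forall c, f c%:MP = c%:MP) ->
  map_mpoly f (restrict x y F) = restrict (f \o x) (f \o y) F.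
Proof.
move=> fC; elim/mpoly_alg_ind: F => [c|i|p q IHp IHq|p q IHp IHq].
- by rewrite !restrictC map_mpolyC /= fC.
- rewrite !restrictX /lineform rmorphD !rmorphM /=.
  by rewrite !map_mpolyX !map_mpolyC.
- by rewrite 2!restrictD -IHp -IHq; exact: rmorphD.
- by rewrite 2!restrictM -IHp -IHq; exact: rmorphM.
Qed.

(** A change of basis of the plane is a substitution in [s] and [t]. *)
Lemma restrict_comb x y (a b c e : A) F :
  restrict (fun i => a * x i + b * y i) (fun i => c * x i + e * y i) F =
  restrict x y F \mPo [tuple a%:MP * 'X_0 + c%:MP * 'X_1; b%:MP * 'X_0 + e%:MP * 'X_1].
Proof.
elim/mpoly_alg_ind: F => [d|i|p q IHp IHq|p q IHp IHq].
- by rewrite !restrictC comp_mpolyC.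
- rewrite !restrictX /lineform comp_mpolyD !rmorphM /= !comp_mpolyC !comp_mpolyXU /=.
  by rewrite !mpolyCD !mpolyCM; ring.
- by rewrite 2!restrictD IHp IHq comp_mpolyD.
- by rewrite 2!restrictM IHp IHq; exact: esym (rmorphM (comp_mpoly _) _ _).
Qed.

Definition binom_coef (p : B) (k : nat) : A :=
  ('C(4, k)%:R : K)^-1 *: p@_[multinom [tuple (4 - k)%N; k]].

Lemma binom_coefK p k : (k < 5)%N ->
  p@_[multinom [tuple (4 - k)%N; k]] = binom_coef p k *+ 'C(4, k).
Proof.
move=> lt_k5; rewrite /binom_coef -scaler_nat scalerA mulfV ?scale1r //.
by rewrite (natf_eq0 charK) -lt0n bin_gt0.
Qed.

Lemma binom_coef_quartic_of q k : (k < 5)%N -> binom_coef (quartic_of q) k = q k.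
Proof.
move=> lt_k5; rewrite /binom_coef mcoeff_quartic_of // -scaler_nat scalerA.
by rewrite mulVf ?scale1r // (natf_eq0 charK) -lt0n bin_gt0.
Qed.

Definition cubic_on x y F : A := binary_cubic (binom_coef (restrict x y F)).

(** The catalecticant has weight 6. *)
Lemma cubic_on_comb x y a b c e F : F \is 4.-homog ->
  cubic_on (fun i => a * x i + b * y i) (fun i => c * x i + e * y i) F =
  (a * e - b * c) ^+ 6 * cubic_on x y F.
Proof.
move=> F4; rewrite /cubic_on restrict_comb.
rewrite {1}(homog4_quartic (restrict_homog x y F4) (@binom_coefK _)).
rewrite quartic_of_subst -binary_cubic_subst.
by apply: eq_binary_cubic => k lt_k5; rewrite binom_coef_quartic_of.
Qed.

Lemma eq_restrict x1 y1 x2 y2 F :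
  x1 =1 x2 -> y1 =1 y2 -> restrict x1 y1 F = restrict x2 y2 F.
Proof.
move=> eqx eqy; rewrite /restrict /mmap; apply: eq_bigr => m _.
have eqh : lineform x1 y1 =1 lineform x2 y2 by move=> i; rewrite /lineform eqx eqy.
by rewrite (mmap1_eq m eqh).
Qed.

Lemma cubic_on_scale x y a F : F \is 4.-homog ->
  cubic_on (fun i => a * x i) (fun i => a * y i) F = a ^+ 12 * cubic_on x y F.
Proof.
move=> F4; have := cubic_on_comb x y a 0 0 a F4.
rewrite mulr0 subr0 -expr2 -exprM => <-; rewrite /cubic_on.
rewrite (@eq_restrict _ _ (fun i => a * x i + 0 * y i)
  (fun i => 0 * x i + a * y i)) // => i; ring.
Qed.

Lemma cubic_on_map (f : {rmorphism A -> A}) x y F : (forall c, f c%:MP = c%:MP) ->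
  f (cubic_on x y F) = cubic_on (f \o x) (f \o y) F.
Proof.
move=> fC; rewrite /cubic_on -restrict_map // rmorph_binary_cubic.
apply: eq_binary_cubic => k _; rewrite /binom_coef /= mcoeff_map_mpoly.
by rewrite -!mul_mpolyC rmorphM /= fC.
Qed.

(** For [w] the generic vector [v], this vector and the next one form the basis
    of the plane orthogonal to [v] that is implicit in the definition of
    [salmon_restr]. *)
Definition plane_fst (w : 'I_3 -> A) (i : 'I_3) : A := [:: w 2; 0; - w 0]`_i.
Definition plane_snd (w : 'I_3 -> A) (i : 'I_3) : A := [:: 0; w 2; - w 1]`_i.

Lemma salmon_restrE F : salmon_restr F =
  restrict (plane_fst (fun i => 'X_i)) (plane_snd (fun i => 'X_i)) F.
Proof.
rewrite /salmon_restr /restrict /mmap; apply: eq_bigr => m _; congr (_ * _).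
apply: mmap1_eq => i; rewrite /lineform /plane_fst /plane_snd (tnth_nth 0) -!mul_mpolyC.
case: i => [[|[|[|//]]]] ? /=.
- by rewrite mpolyC0 mul0r addr0.
- by rewrite mpolyC0 mul0r add0r.
- by rewrite !mpolyCN !mulNr opprD.
Qed.

Lemma salmon_numE F : salmon_num F =
  cubic_on (plane_fst (fun i => 'X_i)) (plane_snd (fun i => 'X_i)) F.
Proof.
by rewrite /salmon_num /cubic_on /binary_cubic /salmon_q /binom_coef salmon_restrE.
Qed.

Lemma mcoeff_mulXn (i : 'I_3) k (p : A) (m : 'X_{1..3}) :
  (m i < k)%N -> ('X_i ^+ k * p)@_m = 0.
Proof.
move=> lt_mi; rewrite mulrC mpolyXn; apply/memN_msupp_eq0.
rewrite (perm_mem (msuppMX _ _)); apply/mapP => -[m' _ eqm].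
by move: lt_mi; rewrite eqm mnmDE mulmnE mnm1E eqxx mul1n ltnNge leq_addr.
Qed.

(** The plane orthogonal to [v] also contains [(-v_2, v_1, 0)] and [(-v_3, 0,
    v_1)], where [v_1] plays the role of [v_3].  Comparing the two
    catalecticants gives [v_1^6 N = v_3^6 N'] with [N] the numerator, and
    [v_1], [v_3] are distinct variables. *)
Lemma salmon_num_div F (m : 'X_{1..3}) : F \is 4.-homog ->
  (m 2%R < 6)%N -> (salmon_num F)@_m = 0.
Proof.
move=> F4 lt_m2; pose v (i : 'I_3) : A := 'X_i.
pose e' (i : 'I_3) : A := [:: - v 1; v 0; 0]`_i.
pose f' (i : 'I_3) : A := [:: - v 2; 0; v 0]`_i.
have scale_N := cubic_on_scale (plane_fst v) (plane_snd v) (v 0) F4.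
have comb_N := cubic_on_comb e' f' 0 (- v 0) (v 2) (- v 1) F4.
have same_forms : restrict (fun i => v 0 * plane_fst v i) (fun i => v 0 * plane_snd v i) F
    = restrict (fun i => 0 * e' i + - v 0 * f' i) (fun i => v 2 * e' i + - v 1 * f' i) F.
  apply: eq_restrict => -[[|[|[|//]]]] lti; rewrite /plane_fst /plane_snd /e' /f' /=;
    move: (v 0) (v 1) (v 2) => *; ring.
have detE : 0 * - v 1 - (- v 0) * v 2 = v 0 * v 2.
  by move: (v 0) (v 1) (v 2) => *; ring.
have scaled : v 0 ^+ 12 * salmon_num F = (v 0 * v 2) ^+ 6 * cubic_on e' f' F.
  rewrite detE in comb_N; rewrite salmon_numE; apply: (etrans (esym scale_N)).
  by apply: etrans comb_N; rewrite /cubic_on same_forms.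
have eqN := cancel_sixth (mpolyX_neq0 _ _) scaled.
have : (v 0 ^+ 6 * salmon_num F)@_(U_(0%R) *+ 6 + m)%MM = 0.
  rewrite eqN; apply: (@mcoeff_mulXn 2 6).
  by rewrite mnmDE mulmnE mnm1E.
rewrite [v 0 ^+ 6]mpolyXn [_ * salmon_num F]mulrC.
by rewrite mcoeffMX.
Qed.

Lemma psiP F : F \is 4.-homog -> 'X_2 ^+ 6 * psi F = salmon_num F.
Proof.
move=> F4; rewrite /psi mulr_sumr [RHS]mpolyE big_seq [RHS]big_seq; apply: eq_bigr => m mN.
rewrite -scalerAr mpolyXn -mpolyXD addmC submK //.
apply/mnm_lepP => i; rewrite mulmnE mnm1E; case: eqP => // <-; rewrite mul1n.
rewrite leqNgt; apply/negP => /(salmon_num_div F4) N0.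
by move: mN; rewrite mcoeff_msupp N0 eqxx.
Qed.

Lemma psi_at (w : 'I_3 -> A) (f : {rmorphism A -> A}) F :
  F \is 4.-homog -> (forall c, f c%:MP = c%:MP) -> (forall i, f 'X_i = w i) ->
  cubic_on (plane_fst w) (plane_snd w) F = w 2 ^+ 6 * f (psi F).
Proof.
move=> F4 fC fX.
have <- : f (salmon_num F) = w 2 ^+ 6 * f (psi F).
  rewrite -(psiP F4) (rmorphM f) (rmorphXn f); congr (_ ^+ _ * _); exact: fX.
rewrite salmon_numE (cubic_on_map _ _ _ fC) /cubic_on.
rewrite (@eq_restrict (plane_fst w) (plane_snd w)
   (f \o plane_fst (fun i => 'X_i)) (f \o plane_snd (fun i => 'X_i))) //.
  by case=> [[|[|[|//]]]] ?; rewrite /plane_fst /= ?rmorphN ?rmorph0 ?fX.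
by case=> [[|[|[|//]]]] ?; rewrite /plane_snd /= ?rmorphN ?rmorph0 ?fX.
Qed.

(** In a plane orthogonal to [w] the vector [w 2 * x] has coordinates [x 0] and
    [x 1] in the basis of [plane_fst] and [plane_snd], so [cubic_on_comb]
    compares the catalecticants of the two bases. *)
Lemma cubic_on_plane (w x y : 'I_3 -> A) (f : {rmorphism A -> A}) F :
  F \is 4.-homog -> (forall c, f c%:MP = c%:MP) -> (forall i, f 'X_i = w i) ->
  w 2 != 0 -> x 0 * w 0 + x 1 * w 1 + x 2 * w 2 = 0 ->
  y 0 * w 0 + y 1 * w 1 + y 2 * w 2 = 0 ->
  w 2 ^+ 6 * cubic_on x y F = (x 0 * y 1 - x 1 * y 0) ^+ 6 * f (psi F).
Proof.
move=> F4 fC fX w2 xw yw.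
have scale_xy := cubic_on_scale x y (w 2) F4.
have comb_xy := cubic_on_comb (plane_fst w) (plane_snd w) (x 0) (x 1) (y 0) (y 1) F4.
rewrite (psi_at F4 fC fX) in comb_xy.
have same_forms : restrict (fun i => w 2 * x i) (fun i => w 2 * y i) F
    = restrict (fun i => x 0 * plane_fst w i + x 1 * plane_snd w i)
        (fun i => y 0 * plane_fst w i + y 1 * plane_snd w i) F.
  have x2 : w 2 * x 2 = - (x 0 * w 0 + x 1 * w 1).
    by rewrite mulrC; apply/eqP; rewrite -addr_eq0 addrC xw.
  have y2 : w 2 * y 2 = - (y 0 * w 0 + y 1 * w 1).
    by rewrite mulrC; apply/eqP; rewrite -addr_eq0 addrC yw.
  apply: eq_restrict => -[[|[|[|//]]]] lti; rewrite /plane_fst /plane_snd /=.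
  - by rewrite (_ : Ordinal lti = 0); [ring | exact: val_inj].
  - by rewrite (_ : Ordinal lti = 1); [ring | exact: val_inj].
  - by rewrite (_ : Ordinal lti = 2) ?x2; [ring | exact: val_inj].
  - by rewrite (_ : Ordinal lti = 0); [ring | exact: val_inj].
  - by rewrite (_ : Ordinal lti = 1); [ring | exact: val_inj].
  - by rewrite (_ : Ordinal lti = 2) ?y2; [ring | exact: val_inj].
have w6 : w 2 ^+ 6 != 0 by rewrite expf_neq0.
apply: (mulfI w6); rewrite mulrA -exprD [RHS]mulrCA -comb_xy -scale_xy.
by rewrite /cubic_on same_forms.
Qed.

End Salmon.

(** * Contravariance of psi and rho, weight of I9 *)

Lemma det_mx22 (R : comNzRingType) (M : 'M[R]_2) :
  \det M = M 0 0 * M 1 1 - M 0 1 * M 1 0.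
Proof.
rewrite (expand_det_row _ 0) big_ord_recl big_ord1 /cofactor !det_mx11 !mxE.
rewrite expr0 expr1 !mul1r mulN1r mulrN.
by congr (M _ _ * M _ _ - M _ _ * M _ _); apply: val_inj.
Qed.

Lemma cofactor_last (R : comNzRingType) (g : 'M[R]_3) :
  [/\ cofactor g 2 0 = g 0 1 * g 1 2 - g 0 2 * g 1 1,
      cofactor g 2 1 = g 0 2 * g 1 0 - g 0 0 * g 1 2 &
      cofactor g 2 2 = g 0 0 * g 1 1 - g 0 1 * g 1 0].
Proof.
have minor k : \det (row' 2 (col' k g)) =
    g 0 (lift k 0) * g 1 (lift k 1) - g 0 (lift k 1) * g 1 (lift k 0).
  rewrite det_mx22 !mxE; congr (g _ _ * g _ _ - g _ _ * g _ _); exact: val_inj.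
have lifts : [/\ lift 0 0 = 1 :> 'I_3, lift 0 1 = 2 :> 'I_3, lift 1 0 = 0 :> 'I_3,
   lift 1 1 = 2 :> 'I_3 & (lift 2 0 = 0 :> 'I_3) * (lift 2 1 = 1 :> 'I_3)].
  by split; [..|split]; apply: val_inj.
case: lifts => l1 l2 l3 l4 [l5 l6].
by rewrite /cofactor !minor l1 l2 l3 l4 l5 l6; split; rewrite ?expr0 //=; ring.
Qed.

Section SalmonContravariance.
Variables (K : fieldType) (charK : [pchar K] =i pred0).
Local Notation A := {mpoly K[3]}.
Variable g : 'M[K]_3.
Hypothesis ug : g \in unitmx.
Implicit Types (F : A).

Let sigma := comp_mpoly (linforms (invmx g)^T).
Let w (i : 'I_3) : A := \sum_j invmx g j i *: 'X_j.

Lemma sigmaX i : sigma 'X_i = w i.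
Proof.
rewrite /sigma comp_mpolyXU -tnth_nth tnth_mktuple; apply: eq_bigr => j _.
by rewrite mxE.
Qed.

(** Here [w] is the image of the generic vector under the inverse transpose of
    [g]. *)
Lemma transported_orthogonal (e : 'I_3 -> A) : \sum_i e i * 'X_i = 0 ->
  \sum_i (\sum_j g i j *: e j) * w i = 0.
Proof.
move=> e_ortho; under eq_bigr do rewrite mulr_suml.
rewrite exchange_big -[RHS]e_ortho; apply: eq_bigr => j _ /=.
have gw : \sum_i g i j *: w i = 'X_j.
  rewrite /w; under eq_bigr do rewrite scaler_sumr.
  rewrite exchange_big /= (bigD1 j) //= [X in _ + X]big1 => [|k nkj].
    under eq_bigr do rewrite scalerA mulrC.
    rewrite -scaler_suml; have /matrixP/(_ j j) := mulVmx ug.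
    by rewrite !mxE eqxx => ->; rewrite scale1r addr0.
  under eq_bigr do rewrite scalerA mulrC.
  rewrite -scaler_suml; have /matrixP/(_ k j) := mulVmx ug.
  by rewrite !mxE (negPf nkj) => ->; rewrite scale0r.
rewrite -gw mulr_sumr; apply: eq_bigr => i _.
by rewrite -scalerAl scalerAr.
Qed.

Lemma det_scale_w : \det g *: w 2 = cofactor g 2 0 *: 'X_0
  + cofactor g 2 1 *: 'X_1 + cofactor g 2 2 *: 'X_2.
Proof.
rewrite /w sum3 !scalerDr !scalerA.
have adjE k : \det g * invmx g k 2 = cofactor g 2 k.
  rewrite /invmx ug !mxE mulrA divff ?mul1r //.
  by move: ug; rewrite unitmxE unitfE.
by rewrite !adjE.
Qed.

Lemma w2_neq0 : w 2 != 0.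
Proof.
apply/eqP => w0.
have : substmx g^T (substmx (invmx g)^T 'X_2) = 'X_2.
  by rewrite substmx_mul -trmx_mul mulmxV // trmx1 substmx1.
rewrite [substmx (invmx g)^T _](sigmaX 2) w0 substmxE comp_mpoly0 => /esym/eqP.
exact/negP/mpolyX_neq0.
Qed.

(** Restricting [F.g] to Salmon's basis of the plane orthogonal to [v] is
    restricting [F] to the images of this basis by [g].  They span the plane
    orthogonal to [w], and their Jacobian in the sense of [cubic_on_plane]
    is [v_3 det(g) w_3]: the factors [v_3] and [w_3] cancel the denominators
    of both [psi], leaving [det(g)^6]. *)
Lemma psi_substmx F : F \is 4.-homog ->
  psi (substmx g F) = (\det g) ^+ 6 *: substmx (invmx g)^T (psi F).
Proof.
move=> F4; pose e := plane_fst (fun i => 'X_i : A).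
pose f := plane_snd (fun i => 'X_i : A).
pose x i := \sum_j g i j *: e j; pose y i := \sum_j g i j *: f j.
have ortho (z : 'I_3 -> A) : \sum_i z i * 'X_i = 0 ->
    (\sum_j g 0 j *: z j) * w 0 + (\sum_j g 1 j *: z j) * w 1
    + (\sum_j g 2 j *: z j) * w 2 = 0.
  by move/transported_orthogonal; rewrite sum3.
have xw := @ortho e; have yw := @ortho f.
have e0 : \sum_i e i * 'X_i = 0.
  by rewrite sum3 /e /plane_fst /=; ring.
have f0 : \sum_i f i * 'X_i = 0.
  by rewrite sum3 /f /plane_snd /=; ring.
have sC c : sigma c%:MP = c%:MP by exact: comp_mpolyC.
have key := @cubic_on_plane K charK w x y _ F F4 sC sigmaX w2_neq0 (xw e0) (yw f0).
have F'4 := substmx_homog g F4.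
have N' : 'X_2 ^+ 6 * psi (substmx g F) = cubic_on x y F.
  by rewrite (psiP charK F'4) salmon_numE /cubic_on restrict_substmx.
have minorE : x 0 * y 1 - x 1 * y 0 = 'X_2 * (\det g *: w 2).
  have [c0 c1 c2] := cofactor_last g.
  rewrite det_scale_w c0 c1 c2 /x /y !sum3 /e /f /plane_fst /plane_snd /=.
  rewrite -!mul_mpolyC !mpolyCB !mpolyCM.
  move: ('X_0) ('X_1) ('X_2) (g 0 0)%:MP (g 0 1)%:MP (g 0 2)%:MP
    (g 1 0)%:MP (g 1 1)%:MP (g 1 2)%:MP => *.
  ring.
rewrite -/x -/y -N' minorE in key.
have w6 : (w 2) ^+ 6 != 0 by rewrite expf_neq0 ?w2_neq0.
have X6 : ('X_2 : A) ^+ 6 != 0 by rewrite expf_neq0 ?mpolyX_neq0.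
apply: (mulfI X6); apply: (mulfI w6); rewrite key.
rewrite exprMn exprZn -!scalerAr -!scalerAl; congr (_ *: _).
by rewrite -mulrA mulrCA.
Qed.

End SalmonContravariance.

Section Covariants.
Variables (K : fieldType) (charK : [pchar K] =i pred0).
Variables (g : 'M[K]_3) (F : {mpoly K[3]}).
Hypotheses (ug : g \in unitmx) (F4 : F \is 4.-homog).

Lemma rho_substmx :
  rho (substmx g F) = (\det g) ^+ 6 *: substmx (invmx g)^T (rho F).
Proof.
rewrite /rho psi_substmx // diffopZr diffop_substmx; last first.
  by rewrite trmxK mulmxV.
by rewrite substmxZ !scalerA mulrC.
Qed.

Lemma calT_substmx : calT (substmx g F) = (\det g) ^+ 6 *: substmx g (calT F).
Proof.
rewrite /calT rho_substmx diffopZl diffop_substmx; last first.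
  by rewrite -trmx_mul mulmxV // trmx1.
by rewrite substmxZ !scalerA mulrC.
Qed.

Lemma half_hessian_rho_substmx : half_hessian (rho (substmx g F)) =
  (\det g) ^+ 6 *: (invmx g *m half_hessian (rho F) *m (invmx g)^T).
Proof. by rewrite rho_substmx half_hessianZ half_hessian_substmx trmxK. Qed.

Lemma half_hessian_calT_substmx : half_hessian (calT (substmx g F)) =
  (\det g) ^+ 6 *: (g^T *m half_hessian (calT F) *m g).
Proof. by rewrite calT_substmx half_hessianZ half_hessian_substmx. Qed.

(** [calT F] and [rho F] transform contragrediently, each with a factor
    [det(g)^6]. *)
Lemma I9_substmx : I9 (substmx g F) = (\det g) ^+ 12 * I9 F.
Proof.
apply: etrans (congr2 _ half_hessian_calT_substmx half_hessian_rho_substmx) _.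
by rewrite mx_pairingZ -exprD mx_pairing_contragredient.
Qed.

End Covariants.

(** * The second order operator of the conic *)

Section ConicOperator.
Variables (K : fieldType) (charK : [pchar K] =i pred0).
Implicit Types F G : {mpoly K[3]}.

Definition conic_op F := diffop (conic K) F.

Lemma conic_opE F : conic_op F = F^`M(1)^`M(1) - F^`M(0)^`M(2).
Proof.
rewrite /conic_op /conic -scaleN1r diffopDl diffopZl expr2 !diffopM !diffopX.
by rewrite scaleN1r mderiv_comm.
Qed.

Lemma half_hessian_conic i j : half_hessian (conic K) i j =
  ((1 == i) * (1 == j))%:R
    - 2%:R^-1 * ((0 == i) * (2 == j) + (2 == i) * (0 == j))%:R.
Proof.
have two_neq0 : (2%:R : K) != 0 by rewrite (natf_eq0 charK).
have d k : (conic K)^`M(k) =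
    ('X_1 *+ (1 == k)) *+ 2 - ('X_2 *+ (0 == k) + 'X_0 *+ (2 == k)).
  rewrite /conic mderivB expr2 !mderivM !mderivXU.
  by rewrite !mulr_natl !mulr_natr -mulr2n.
rewrite mxE d !(mderivB, mderivD) !mderivMn !mderivXU !(mcoeffB, mcoeffD).
rewrite !mcoeffMn !mcoeff1 eqxx natrD !natrM.
move: (1 == i) (0 == i) (2 == i) (1 == j) (0 == j) (2 == j) => [] [] [] [] [] [];
  rewrite /= ?mulr0n ?mulr1n; by field.
Qed.

Lemma mx_pairing_conic G :
  mx_pairing (half_hessian G) (half_hessian (conic K)) = 2%:R^-1 * (conic_op G)@_0%MM.
Proof.
have two_neq0 : (2%:R : K) != 0 by rewrite (natf_eq0 charK).
rewrite conic_opE mcoeffB /mx_pairing sum3 !sum3 !half_hessian_conic /= !mxE.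
rewrite [G^`M(2)^`M(0)]mderiv_comm.
by field.
Qed.

(** Pairing with the half Hessian of the conic is, up to the factor 2, applying
    the operator of the conic. *)
Lemma I9_onZ F u : rho F = u *: conic K ->
  I9 F = u ^+ 2 * (24%:R^-1 * (conic_op (conic_op F))@_0%MM).
Proof.
move=> rhoF; rewrite /I9 /calT rhoF diffopZl scalerA !half_hessianZ mx_pairingZ.
rewrite mx_pairing_conic -/(conic_op F).
have n0 k : (k.+1%:R : K) != 0 by rewrite (natf_eq0 charK).
by field; rewrite !n0.
Qed.

End ConicOperator.

Section Expansion.
Variable K : fieldType.
Implicit Types F G : {mpoly K[3]}.

Lemma mpoly_sum_seq n (R : nzRingType) (p : {mpoly R[n]}) (S : seq 'X_{1..n}) :
  uniq S -> {subset msupp p <= S} -> p = \sum_(m <- S) p@_m *: 'X_[m].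
Proof.
move=> uS subS; apply/mpolyP => k; rewrite raddf_sum /=.
have [kS|kNS] := boolP (k \in S).
  rewrite (bigD1_seq k) //= mcoeffZ mcoeffX eqxx mulr1 big1 ?addr0 // => m nmk.
  by rewrite mcoeffZ mcoeffX (negPf nmk) mulr0.
rewrite big_seq big1 => [|m mS].
  by apply/memN_msupp_eq0; apply: contra kNS; exact: subS.
rewrite mcoeffZ mcoeffX; case: eqP => [mk|_]; last by rewrite mulr0.
by rewrite -mk mS in kNS.
Qed.

Definition mon (a b c : nat) : 'X_{1..3} := [multinom [tuple a; b; c]].

(** The order is that of the terms of [ellstar]. *)
Definition quartic_monomials : seq 'X_{1..3} :=
  [:: mon 4 0 0; mon 3 1 0; mon 3 0 1; mon 2 2 0; mon 2 1 1; mon 2 0 2;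
      mon 1 3 0; mon 1 2 1; mon 1 1 2; mon 1 0 3; mon 0 4 0; mon 0 3 1;
      mon 0 2 2; mon 0 1 3; mon 0 0 4].

Lemma mem_quartic_monomials m : mdeg m = 4%N -> m \in quartic_monomials.
Proof.
have -> : m = mon (m 0) (m 1) (m 2).
  apply/mnmP => i; rewrite [RHS]mnm_tnth (tnth_nth 0%N).
  by case: i => [[|[|[|//]]]] lti /=; congr (m _); apply: val_inj.
move: (m 0) (m 1) (m 2) => a b c.
rewrite mdegE sum3 !mnm_tnth !(tnth_nth 0%N) /= => abc.
have [le_ab ->] : (a + b <= 4)%N /\ c = (4 - a - b)%N.
  by have : (a + b + c = 4)%N := abc; lia.
by case: a b le_ab {abc} => [|[|[|[|[|a]]]]] [|[|[|[|[|b]]]]].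
Qed.

Lemma quartic_expand F : F \is 4.-homog ->
  F = \sum_(m <- quartic_monomials) F@_m *: 'X_[m].
Proof.
move=> /dhomogP F4; apply: mpoly_sum_seq => // m /F4; exact: mem_quartic_monomials.
Qed.

End Expansion.

(** * The map ellstar through the dual conic *)

Lemma prod3 (R : comNzRingType) (F : 'I_3 -> R) : \prod_i F i = F 0 * F 1 * F 2.
Proof.
rewrite !big_ord_recl big_ord0 mulr1 mulrA.
by congr (F _ * F _ * F _); apply: val_inj.
Qed.

Section Veronese.
Variables (K : fieldType) (charK : [pchar K] =i pred0).
Implicit Types F G : {mpoly K[3]}.

(** This parametrizes the conic [x_2^2 = 4 x_1 x_3], dual to [v_2^2 = v_1 v_3]. *)
Definition veronese : 3.-tuple {mpoly K[2]} :=
  [tuple 'X_0 ^+ 2; 2%:R *: ('X_0 * 'X_1); 'X_1 ^+ 2].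

Definition zmon a b : {mpoly K[2]} := 'X_[[multinom [tuple a; b]]].

Lemma zmon_mul a b c e : zmon a b * zmon c e = zmon (a + c) (b + e).
Proof. by rewrite /zmon !monomial2E !exprD mulrACA. Qed.

Lemma zmon_exp a b k : zmon a b ^+ k = zmon (a * k) (b * k).
Proof. by rewrite /zmon !monomial2E exprMn !exprM. Qed.

Lemma comp_veronese a b c :
  'X_[mon a b c] \mPo veronese = (2 ^ b)%:R *: zmon (2 * a + b) (b + 2 * c).
Proof.
have v0 : tnth veronese 0 = zmon 2 0 by rewrite /zmon monomial2E mulr1.
have v1 : tnth veronese 1 = 2%:R *: zmon 1 1 by rewrite /zmon monomial2E.
have v2 : tnth veronese 2 = zmon 0 2 by rewrite /zmon monomial2E mul1r.
rewrite comp_mpolyX prod3.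
rewrite v0 v1 v2 !mnm_tnth !(tnth_nth 0%N) /= exprZn !zmon_exp -scalerAr -scalerAl.
by rewrite !zmon_mul natrX; congr (_ *: zmon _ _); lia.
Qed.

Lemma conic_op_mon a b c : conic_op 'X_[mon a b c] =
  (b * b.-1)%:R *: 'X_[K, mon a (b - 2) c] - (a * c)%:R *: 'X_[mon a.-1 b c.-1].
Proof.
rewrite conic_opE !mderivX !mderivZ !mderivX !scalerA -!natrM.
rewrite !mnmBE !mnm1E /= !mnm_tnth !(tnth_nth 0%N) /= subn1 subn0.
by congr (_ *: 'X_[_] - _ *: 'X_[_]); apply/mnmP => i;
  rewrite !mnmBE !mnm1E !mnm_tnth !(tnth_nth 0%N); case: i => [[|[|[|//]]]] ? /=; lia.
Qed.

Lemma conic_opD F G : conic_op (F + G) = conic_op F + conic_op G.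
Proof. exact: diffopDr. Qed.
Lemma conic_opZ c F : conic_op (c *: F) = c *: conic_op F.
Proof. exact: diffopZr. Qed.

Lemma conic_op_comp a b c : conic_op 'X_[mon a b c] \mPo veronese =
  ((b * b.-1 * 2 ^ (b - 2))%:R - (a * c * 2 ^ b)%:R)
    *: zmon (2 * a + b - 2) (b + 2 * c - 2).
Proof.
rewrite conic_op_mon comp_mpolyB !comp_mpolyZ !comp_veronese !scalerA -!natrM scalerBl.
congr (_ - _).
  have [b2|] := leqP 2 b; first by congr (_ *: zmon _ _); lia.
  by case: b => [|[|//]] _; rewrite !scale0r.
case: a => [|a]; first by rewrite !scale0r.
case: c => [|c]; first by rewrite muln0 !scale0r.
by congr (_ *: zmon _ _); lia.
Qed.

Lemma conic_op2_comp a b c : conic_op (conic_op 'X_[mon a b c]) \mPo veronese =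
  ((b * b.-1)%:R * (((b - 2) * (b - 2).-1 * 2 ^ (b - 2 - 2))%:R - (a * c * 2 ^ (b - 2))%:R)
  - (a * c)%:R * ((b * b.-1 * 2 ^ (b - 2))%:R - (a.-1 * c.-1 * 2 ^ b)%:R))
    *: zmon (2 * a + b - 4) (b + 2 * c - 4).
Proof.
rewrite conic_op_mon -scaleN1r conic_opD !conic_opZ comp_mpolyD !comp_mpolyZ.
rewrite !conic_op_comp scaleN1r [in RHS]scalerBl !scalerA; congr (_ - _).
  have [b2|] := leqP 2 b; first by congr (_ *: zmon _ _); lia.
  by case: b => [|[|//]] _; rewrite !mul0r !scale0r.
case: a => [|a]; first by rewrite !mul0r !scale0r.
case: c => [|c]; first by rewrite muln0 !mul0r !scale0r.
by congr (_ *: zmon _ _); lia.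
Qed.

End Veronese.

(** A sum over the monomials of degree 4, kept in this explicit form so that
    [ellstar] is an instance of it by definition. *)
Definition sum15 (V : nmodType) (f : nat -> nat -> nat -> V) : V :=
  f 4%N 0%N 0%N + f 3%N 1%N 0%N + f 3%N 0%N 1%N
  + f 2%N 2%N 0%N + f 2%N 1%N 1%N + f 2%N 0%N 2%N
  + f 1%N 3%N 0%N + f 1%N 2%N 1%N + f 1%N 1%N 2%N
  + f 1%N 0%N 3%N + f 0%N 4%N 0%N + f 0%N 3%N 1%N
  + f 0%N 2%N 2%N + f 0%N 1%N 3%N + f 0%N 0%N 4%N.

Lemma sum_quartic_monomials (V : nmodType) (f : 'X_{1..3} -> V) :
  \sum_(m <- quartic_monomials) f m = sum15 (fun a b c => f (mon a b c)).
Proof. by rewrite /quartic_monomials !big_cons big_nil addr0 !addrA. Qed.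

Lemma eq_sum15 (R : nzRingType) (V : lmodType R) (x : nat -> nat -> nat -> R)
    (f g : nat -> nat -> nat -> V) :
  [/\ f 4%N 0%N 0%N = g 4%N 0%N 0%N, f 3%N 1%N 0%N = g 3%N 1%N 0%N,
      f 3%N 0%N 1%N = g 3%N 0%N 1%N, f 2%N 2%N 0%N = g 2%N 2%N 0%N
    & f 2%N 1%N 1%N = g 2%N 1%N 1%N] ->
  [/\ f 2%N 0%N 2%N = g 2%N 0%N 2%N, f 1%N 3%N 0%N = g 1%N 3%N 0%N,
      f 1%N 2%N 1%N = g 1%N 2%N 1%N, f 1%N 1%N 2%N = g 1%N 1%N 2%N
    & f 1%N 0%N 3%N = g 1%N 0%N 3%N] ->
  [/\ f 0%N 4%N 0%N = g 0%N 4%N 0%N, f 0%N 3%N 1%N = g 0%N 3%N 1%N,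
      f 0%N 2%N 2%N = g 0%N 2%N 2%N, f 0%N 1%N 3%N = g 0%N 1%N 3%N
    & f 0%N 0%N 4%N = g 0%N 0%N 4%N] ->
  sum15 (fun a b c => x a b c *: f a b c) = sum15 (fun a b c => x a b c *: g a b c).
Proof.
rewrite /sum15.
by move=> [-> -> -> -> ->] [-> -> -> -> ->] [-> -> -> -> ->].
Qed.

Section EllStar.
Variables (K : fieldType) (charK : [pchar K] =i pred0).
Local Notation veronese := (veronese K).

Lemma quartic_linear_expand (V : lmodType K) (L : {mpoly K[3]} -> V) (F : quartic K) :
  (forall G H, L (G + H) = L G + L H) -> (forall c G, L (c *: G) = c *: L G) ->
  L F = sum15 (fun a b c => xcoef F a b c *: L 'X_[mon a b c]).
Proof.
move=> LD LZ; have L0 : L 0 = 0 by have := LZ 0 0; rewrite !scale0r.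
rewrite [X in L X](quartic_expand (dhomog_is_dhomog F)) (big_morph L LD L0).
rewrite -(sum_quartic_monomials (fun m => (F : {mpoly K[3]})@_m *: L 'X_[m])).
by apply: eq_bigr => m _; rewrite LZ.
Qed.

Let J (f : dhomog 2 K 8) (g : dhomog 2 K 4) (h : K) : joint K :=
  (f, g, h *: z K 0 0).

(** The images of the monomials under [ellstar], tabulated so that [ellstar]
    becomes a uniform sum. *)
Definition ellstar_mon (a b c : nat) : joint K :=
  match a, b with
  | 4, _ => J (z K 8 0) 0 0
  | 3, 1 => J (2%:R *: z K 7 1) 0 0
  | 3, _ => J (z K 6 2) (- (3%:R / 14%:R) *: z K 4 0) 0
  | 2, 2 => J (4%:R *: z K 6 2) (7%:R^-1 *: z K 4 0) 0
  | 2, 1 => J (2%:R *: z K 5 3) (- (2%:R / 7%:R) *: z K 3 1) 0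
  | 2, _ => J (z K 4 4) (- (2%:R / 7%:R) *: z K 2 2) 30%:R^-1
  | 1, 3 => J (8%:R *: z K 5 3) ((6%:R / 7%:R) *: z K 3 1) 0
  | 1, 2 => J (4%:R *: z K 4 4) (- 7%:R^-1 *: z K 2 2) (- 30%:R^-1)
  | 1, 1 => J (2%:R *: z K 3 5) (- (2%:R / 7%:R) *: z K 1 3) 0
  | 1, _ => J (z K 2 6) (- (3%:R / 14%:R) *: z K 0 4) 0
  | _, 4 => J (16%:R *: z K 4 4) ((24%:R / 7%:R) *: z K 2 2) 5%:R^-1
  | _, 3 => J (8%:R *: z K 3 5) ((6%:R / 7%:R) *: z K 1 3) 0
  | _, 2 => J (4%:R *: z K 2 6) (7%:R^-1 *: z K 0 4) 0
  | _, 1 => J (2%:R *: z K 1 7) 0 0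
  | _, _ => J (z K 0 8) 0 0
  end.

Lemma ellstar_sum15 F :
  ellstar F = sum15 (fun a b c => xcoef F a b c *: ellstar_mon a b c).
Proof. by []. Qed.

Lemma linear_sum15 (U V : lmodType K) (L : U -> V) x (f : nat -> nat -> nat -> U) :
  (forall u v, L (u + v) = L u + L v) -> (forall a u, L (a *: u) = a *: L u) ->
  L (sum15 (fun a b c => x a b c *: f a b c)) =
  sum15 (fun a b c => x a b c *: L (f a b c)).
Proof. by move=> LD LZ; rewrite /sum15 !LD !LZ. Qed.

Let p1 (w : joint K) : {mpoly K[2]} := w.1.1.
Let p2 (w : joint K) : {mpoly K[2]} := w.1.2.
Let p3 (w : joint K) : {mpoly K[2]} := w.2.

(** The three components of [ellstar] are iterates of the operator of the conic
    followed by the restriction to the dual conic; as both commute with the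
    orthogonal group, this explains where the equivariance of [ellstar]
    comes from. *)
Lemma ellstar1 (F : quartic K) :
  (ellstar F).1.1 = (F : {mpoly K[3]}) \mPo veronese :> {mpoly K[2]}.
Proof.
rewrite -[LHS]/(p1 (ellstar F)) ellstar_sum15 (linear_sum15 (L := p1)) //.
rewrite (quartic_linear_expand (L := fun F => F \mPo veronese)); last first.
- by move=> c G; rewrite comp_mpolyZ.
- by move=> G H; rewrite comp_mpolyD.
by apply: eq_sum15; split; rewrite comp_veronese /p1 /= ?scale1r.
Qed.

Lemma ellstar2 (F : quartic K) :
  (ellstar F).1.2 = 14%:R^-1 *: (conic_op F \mPo veronese) :> {mpoly K[2]}.
Proof.
rewrite -[LHS]/(p2 (ellstar F)) ellstar_sum15 (linear_sum15 (L := p2)) //.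
rewrite (quartic_linear_expand (L := fun F => 14%:R^-1 *: (conic_op F \mPo veronese))); last first.
- by move=> c G; rewrite conic_opZ comp_mpolyZ !scalerA mulrC.
- by move=> G H; rewrite conic_opD comp_mpolyD scalerDr.
have n0 k : (k.+1%:R : K) != 0 by rewrite (natf_eq0 charK).
have coefP (x y : K) (p q : {mpoly K[2]}) : x = y -> p = q -> x *: p = y *: q.
  by move=> -> ->.
have coef0 (x : K) (p : {mpoly K[2]}) : x = 0 -> 0 = x *: p.
  by move=> ->; rewrite scale0r.
apply: eq_sum15; split; rewrite conic_op_comp scalerA /p2 /=.
all: first [apply: coef0; by ring | apply: coefP; [by field; rewrite ?n0|by []]].
Qed.

Lemma ellstar3 (F : quartic K) :
  (ellstar F).2 = 120%:R^-1 *: (conic_op (conic_op F) \mPo veronese) :> {mpoly K[2]}.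
Proof.
rewrite -[LHS]/(p3 (ellstar F)) ellstar_sum15 (linear_sum15 (L := p3)) //.
rewrite (quartic_linear_expand
  (L := fun F => 120%:R^-1 *: (conic_op (conic_op F) \mPo veronese))); last first.
- by move=> c G; rewrite !conic_opZ comp_mpolyZ !scalerA mulrC.
- by move=> G H; rewrite !conic_opD comp_mpolyD scalerDr.
have n0 k : (k.+1%:R : K) != 0 by rewrite (natf_eq0 charK).
have coefP (x y : K) (p q : {mpoly K[2]}) : x = y -> p = q -> x *: p = y *: q.
  by move=> -> ->.
have coef0 (x : K) (p q : {mpoly K[2]}) : x = 0 -> 0 *: q = x *: p.
  by move=> ->; rewrite !scale0r.
apply: eq_sum15; split; rewrite conic_op2_comp scalerA /p3 /= -?[(4 - 2)%N]/2%N;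
  rewrite ?(subnn, sub0n);
  first [apply: coef0; by ring | apply: coefP; [by field; rewrite ?n0 | by []]].
Qed.

Lemma b0_ellstar (F : quartic K) :
  b0 (ellstar F) = 120%:R^-1 * (conic_op (conic_op F))@_0%MM.
Proof.
rewrite /b0 ellstar3 mcoeffZ; congr (_ * _); elim/mpoly_alg_ind: (conic_op _).
- by move=> c; rewrite comp_mpolyC !mcoeffC !eqxx.
- move=> i; rewrite comp_mpolyXU mcoeffX mnm1_eq0.
  by case: i => [[|[|[|//]]]] ? /=;
    rewrite ?mcoeffZ ?rmorphM ?rmorphXn /= !mcoeffX !mnm1_eq0 ?mulr0 // expr0n.
- by move=> p q IHp IHq; rewrite comp_mpolyD !mcoeffD IHp IHq.
- by move=> p q IHp IHq; rewrite !rmorphM /= IHp IHq.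
Qed.

(** Both sides are multiples of the contraction of [F] with the square of the
    conic. *)
Lemma I9_b0_onZ (F : quartic K) u : rho F = u *: conic K ->
  I9 F = 5%:R * u ^+ 2 * b0 (ellstar F).
Proof.
move=> rhoF; rewrite (I9_onZ charK rhoF) b0_ellstar.
have n0 k : (k.+1%:R : K) != 0 by rewrite (natf_eq0 charK).
by field; rewrite !n0.
Qed.

End EllStar.

(** * Equivariance under symmetric squares *)

Section Sym2.
Variables (K : fieldType).
Implicit Types (A : 'M[K]_2) (F : {mpoly K[3]}).

(** The action of [A] by substitution on [z_1^2], [2 z_1 z_2], [z_2^2], the
    coordinates of the dual conic. *)
Definition sym2 A : 'M[K]_3 := \matrix_(i, j) (nth [::] [::
  [:: A 0 0 ^+ 2; A 0 0 * A 0 1; A 0 1 ^+ 2];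
  [:: 2%:R * A 0 0 * A 1 0; A 0 0 * A 1 1 + A 0 1 * A 1 0; 2%:R * A 0 1 * A 1 1];
  [:: A 1 0 ^+ 2; A 1 0 * A 1 1; A 1 1 ^+ 2]] i)`_j.

(** The adjugate, tabulated so that its entries are available by computation. *)
Definition adj2 A : 'M[K]_2 := \matrix_(i, j)
  (nth [::] [:: [:: A 1 1; - A 0 1]; [:: - A 1 0; A 0 0]] i)`_j.

Lemma sum2 (V : nmodType) (f : 'I_2 -> V) : \sum_i f i = f 0 + f 1.
Proof.
by rewrite big_ord_recl big_ord1; congr (f _ + f _); apply: val_inj.
Qed.

Lemma substmx_veronese A F :
  substmx A (F \mPo veronese K) = substmx (sym2 A) F \mPo veronese K.
Proof.
elim/mpoly_alg_ind: F => [c|i|p q IHp IHq|p q IHp IHq].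
- by rewrite substmxC !comp_mpolyC substmxC.
- have v0 : 'X_0 \mPo veronese K = 'X_0 ^+ 2 by rewrite comp_mpolyXU.
  have v1 : 'X_1 \mPo veronese K = 2%:R *: ('X_0 * 'X_1) by rewrite comp_mpolyXU.
  have v2 : 'X_2 \mPo veronese K = 'X_1 ^+ 2 by rewrite comp_mpolyXU.
  rewrite [in RHS]substmxXU sum3 !comp_mpolyD !comp_mpolyZ v0 v1 v2.
  have s0 : substmx A 'X_0 = A 0 0 *: 'X_0 + A 0 1 *: 'X_1 by rewrite substmxXU sum2.
  have s1 : substmx A 'X_1 = A 1 0 *: 'X_0 + A 1 1 *: 'X_1 by rewrite substmxXU sum2.
  rewrite -!mul_mpolyC in s0 s1 *.
  have [|[|]] : i = 0 \/ i = 1 \/ i = 2.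
    by case: i => [[|[|[|//]]]] ?; [left|right;left|right;right]; apply: val_inj.
  + move->; rewrite v0 expr2 substmxM s0 !mxE /= ?expr2 !mpolyCM ?mpolyC_nat.
    move: 'X_0 'X_1 (A 0 0)%:MP (A 0 1)%:MP => *; ring.
  + move->; rewrite v1 -mul_mpolyC !substmxM substmxC s0 s1 !mxE /= !(mpolyC_nat, mpolyCM, mpolyCD).
    move: 'X_0 'X_1 (A 0 0)%:MP (A 0 1)%:MP (A 1 0)%:MP (A 1 1)%:MP => *; ring.
  + move->; rewrite v2 expr2 substmxM s1 !mxE /= ?expr2 !mpolyCM ?mpolyC_nat.
    move: 'X_0 'X_1 (A 1 0)%:MP (A 1 1)%:MP => *; ring.
- by rewrite !(substmxD, comp_mpolyD) IHp IHq.
- rewrite substmxM.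
  rewrite (rmorphM (comp_mpoly (veronese K))) substmxM IHp IHq.
  by rewrite -(rmorphM (comp_mpoly (veronese K))).
Qed.

Lemma sym2_inv A : A 0 0 * A 1 1 - A 0 1 * A 1 0 = 1 ->
  (sym2 (adj2 A))^T *m (sym2 A)^T = 1%:M.
Proof.
move=> det1; rewrite -trmx_mul; apply: trmx_inj; rewrite trmxK trmx1.
(* Made homogeneous by the square of the determinant, the identity holds for
   all entries and is left to [ring]. *)
have -> : 1%:M = (A 0 0 * A 1 1 - A 0 1 * A 1 0) ^+ 2 *: (1%:M : 'M[K]_3).
  by rewrite det1 expr1n scale1r.
apply/matrixP => i j; rewrite !mxE sum3 !mxE /=.
move: (A 0 0) (A 0 1) (A 1 0) (A 1 1) => a b c e.
by case: i => [[|[|[|//]]]] ?; case: j => [[|[|[|//]]]] ? /=; ring.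
Qed.

Lemma conic_sym2 A : A 0 0 * A 1 1 - A 0 1 * A 1 0 = 1 ->
  substmx (sym2 (adj2 A))^T (conic K) = conic K.
Proof.
move=> det1.
have -> : conic K = (A 0 0 * A 1 1 - A 0 1 * A 1 0)%:MP ^+ 2 * conic K.
  by rewrite det1 mpolyC1 expr1n mul1r.
rewrite substmxM.
have -> : substmx (sym2 (adj2 A))^T ((A 0 0 * A 1 1 - A 0 1 * A 1 0)%:MP ^+ 2) = 1.
  by rewrite det1 mpolyC1 expr1n -mpolyC1 substmxC.
rewrite mul1r /conic -scaleN1r substmxD substmxZ scaleN1r expr2 !substmxM !substmxXU.
rewrite !sum3 !mxE /= -!mul_mpolyC ?expr2 !(mpolyC_nat, mpolyCM, mpolyCB, mpolyCD, mpolyCN).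
move: 'X_0 'X_1 'X_2 (A 0 0)%:MP (A 0 1)%:MP (A 1 0)%:MP (A 1 1)%:MP => *; ring.
Qed.

Lemma conic_op_sym2 A F : A 0 0 * A 1 1 - A 0 1 * A 1 0 = 1 ->
  conic_op (substmx (sym2 A) F) = substmx (sym2 A) (conic_op F).
Proof.
move=> det1; rewrite /conic_op -{1}(conic_sym2 det1).
exact: diffop_substmx (sym2_inv det1).
Qed.

(** The symmetric square of [A] preserves the dual conic together with its
    parametrization, and commutes with the operator of the conic. *)
Lemma ellstar_equivariant (charK : [pchar K] =i pred0) (F : quartic K) A :
  \det A = 1 -> ellstar (form_act F (sym2 A)) = joint_act (ellstar F) A.
Proof.
rewrite det_mx22 => det1.
have pair3 (u v : joint K) : u.1.1 = v.1.1 -> u.1.2 = v.1.2 -> u.2 = v.2 -> u = v.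
  by case: u v => [[u1 u2] u3] [[v1 v2] v3] /= -> -> ->.
apply: pair3; apply: val_inj.
- apply: etrans (ellstar1 _) _; apply: etrans (esym (substmx_veronese _ _)) _.
  by rewrite -(ellstar1 F).
- apply: etrans (ellstar2 charK _) _; rewrite conic_op_sym2 // -substmx_veronese.
  by rewrite -substmxZ -(ellstar2 charK F).
- apply: etrans (ellstar3 charK _) _; rewrite !conic_op_sym2 // -substmx_veronese.
  by rewrite -substmxZ -(ellstar3 charK F).
Qed.

Definition upper2 (t : K) : 'M[K]_2 := 1%:M + t *: delta_mx 0 1.
Definition lower2 (t : K) : 'M[K]_2 := 1%:M + t *: delta_mx 1 0.

Lemma det_upper2 t : \det (upper2 t) = 1.
Proof. by rewrite det_mx22 !mxE /=; ring. Qed.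

Lemma det_lower2 t : \det (lower2 t) = 1.
Proof. by rewrite det_mx22 !mxE /=; ring. Qed.

Lemma sym2_upper2 t : sym2 (upper2 t) = 1%:M + t *: so3_e K + t ^+ 2 *: delta_mx 0 2.
Proof.
apply/matrixP => i j; rewrite !mxE /=.
by case: i => [[|[|[|//]]]] ?; case: j => [[|[|[|//]]]] ? /=; ring.
Qed.

Lemma sym2_lower2 t : sym2 (lower2 t) = 1%:M + t *: so3_f K + t ^+ 2 *: delta_mx 2 0.
Proof.
apply/matrixP => i j; rewrite !mxE /=.
by case: i => [[|[|[|//]]]] ?; case: j => [[|[|[|//]]]] ? /=; ring.
Qed.

End Sym2.

(** * Homogeneous functions and symmetric matrices *)

Section Scaling.
Variables (K : fieldType) (charK : [pchar K] =i pred0).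

Lemma meval_homog n (p : {mpoly K[n]}) e a (x : 'I_n -> K) : p \is e.-homog ->
  p.@[fun i => a * x i] = a ^+ e * p.@[x].
Proof.
move=> /dhomogP pe; rewrite !mevalE mulr_sumr; apply: eq_big_seq => m /pe me.
rewrite mulrCA; congr (_ * _); under eq_bigr do rewrite exprMn.
by rewrite big_split prodrXr -mdegE me.
Qed.

Lemma homog_polyfun_scale (U : vectType K) e (f : U -> K) a v :
  homog_polyfun e f -> f (a *: v) = a ^+ e * f v.
Proof.
move=> [p pe fp]; rewrite !fp -meval_homog //; apply: meval_eq => i.
by rewrite linearZ.
Qed.

(** On the line through [v] a representing polynomial becomes a polynomial in
    the scalar [a]; comparing the coefficients of [a^e] shows that its
    component of degree [e] represents the same function. *)
Lemma polyfun_homog (U : vectType K) e (f : U -> K) :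
  polyfun f -> (forall a v, f (a *: v) = a ^+ e * f v) -> homog_polyfun e f.
Proof.
move=> [p fp] fe; exists (pihomog mdeg e p); first exact: pihomogP.
move=> v; pose x i := coord (vbasis {: U}) i v.
pose k := maxn (msize p) e.+1.
have pE : p = \sum_(i < k) pihomog mdeg i p.
  by apply: pihomog_partitionE; rewrite leq_maxl.
pose c i := (pihomog mdeg i p).@[x].
have : \poly_(i < k) c i = f v *: 'X^e.
  apply: (poly_eq_fun charK) => a; rewrite hornerZ hornerXn mulrC -fe fp.
  rewrite horner_poly [in RHS]pE raddf_sum /=; apply: eq_bigr => i _.
  rewrite mulrC -meval_homog; last exact: pihomogP.
  by apply: meval_eq => l; rewrite linearZ.
move/(congr1 (fun q : {poly K} => q`_e)).
by rewrite coef_poly leq_maxr coefZ coefXn eqxx mulr1.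
Qed.

End Scaling.

Section SymmetricFactor.
Variables (K : closedFieldType) (charK : [pchar K] =i pred0).

Lemma sqrt_exists (a : K) : exists b, b ^+ 2 = a.
Proof.
have [b] := @solve_monicpoly K 2 (fun i => if i == 0 then a else 0) isT.
by rewrite !big_ord_recl big_ord0 /= mulr1 mul0r !addr0 => ba; exists b.
Qed.

(** Elimination by congruences.  A nonzero diagonal entry is moved to the corner
    by a transposition; if the diagonal is zero, adding row [j] to row [i],
    and likewise for columns, creates the entry [2 S_ij].  The corner is
    split off with a square root of its entry. *)
Lemma sym_factor n (S : 'M[K]_n) : S^T = S -> exists T : 'M[K]_n, S = T *m T^T.
Proof.
elim: n S => [|n IHn] S symS.
  by exists 0; rewrite [LHS]flatmx0 [RHS]flatmx0.
have congr_factor (U : 'M[K]_n.+1) : U \in unitmx ->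
    (exists T : 'M_n.+1, U *m S *m U^T = T *m T^T) ->
    exists T : 'M_n.+1, S = T *m T^T.
  move=> uU [T eqT]; exists (invmx U *m T); rewrite trmx_mul mulmxA.
  rewrite -(mulmxA (invmx U) T) -eqT !mulmxA mulVmx // mul1mx -mulmxA.
  by rewrite -trmx_mul mulVmx // trmx1 mulmx1.
have corner (S' : 'M[K]_(1 + n)) : S'^T = S' -> S' 0 0 != 0 ->
    exists T : 'M_(1 + n), S' = T *m T^T.
  have : ulsubmx S' 0 0 = S' 0 0.
    by rewrite !mxE; congr (S' _ _); apply: val_inj.
  move=> <- symS'; rewrite -[S']submxK in symS' *.
  move: (ulsubmx S') (ursubmx S') (dlsubmx S') (drsubmx S') symS' => a b c D.
  rewrite block_mxKul tr_block_mx => /eq_block_mx[_ cb _ DT] a_neq0.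
  have [r ra] := sqrt_exists (a 0 0).
  have aE : a = (r ^+ 2)%:M by rewrite ra; exact: mx11_scalar.
  have r_neq0 : r != 0 by move: a_neq0; rewrite -ra expf_eq0.
  have [|T DE] := IHn (D - (r ^+ 2)^-1 *: (c *m b)).
    by rewrite linearB linearZ /= trmx_mul DT cb -cb trmxK.
  exists (block_mx r%:M 0 (r^-1 *: c) T).
  rewrite tr_block_mx mulmx_block !mul0mx trmx0 !mulmx0 !addr0 tr_scalar_mx.
  rewrite linearZ /= -DE cb; congr block_mx.
  - by rewrite -scalar_mxM aE expr2.
  - by rewrite mul_scalar_mx scalerA mulfV // scale1r.
  - by rewrite mul_mx_scalar scalerA mulfV // scale1r.
  - rewrite -scalemxAl -scalemxAr scalerA -invfM -expr2.
    by rewrite addrC subrK.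
have conj_sym (W : 'M[K]_n.+1) : (W *m S *m W^T)^T = W *m S *m W^T.
  by rewrite 2!trmx_mul trmxK symS mulmxA.
have diagonal i (U : 'M[K]_n.+1) : U \in unitmx -> (U *m S *m U^T) i i != 0 ->
    exists T : 'M_n.+1, S = T *m T^T.
  move=> uU Sii; pose V := tperm_mx 0 i *m U.
  apply: (congr_factor V); first by rewrite unitmx_mul unitmx_perm.
  apply: corner; first exact: conj_sym.
  have -> : V *m S *m V^T = xcol 0 i (xrow 0 i (U *m S *m U^T)).
    by rewrite xcolE xrowE /V trmx_mul tr_tperm_mx !mulmxA.
  by rewrite 2!mxE !tpermL.
have [S0|] := eqVneq S 0; first by exists 0; rewrite mul0mx.
move=> /eqP/matrixP S_neq0.
have [i Sii|diag0] := pickP (fun i => S i i != 0).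
  by apply: (diagonal i 1%:M); rewrite ?unitmx1 // mul1mx trmx1 mulmx1.
have [[i j] /= Sij|all0] := pickP (fun ij => S ij.1 ij.2 != 0); last first.
  by case: S_neq0 => i j; rewrite mxE; have /negbFE/eqP := all0 (i, j).
have nij : i != j by apply: contraFneq (diag0 i) => eij; rewrite {2}eij.
pose E := delta_mx i j : 'M[K]_n.+1.
have EE : E *m E = 0 by rewrite mul_delta_mx_cond eq_sym (negPf nij) mulr0n.
have uU : 1%:M + E \in unitmx.
  have : (1%:M + E) *m (1%:M - E) = 1%:M.
    by rewrite mulmxBr mulmx1 mulmxDl mul1mx EE addr0 addrK.
  by case/mulmx1_unit.
apply: (diagonal i _ uU).
have di k : S k k = 0 by have /negbFE/eqP := diag0 k.
have rowE k : ((1%:M + E) *m S) i k = S i k + S j k.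
  rewrite mulmxDl mul1mx mxE; congr (_ + _).
  by rewrite mxE (bigD1 j) //= mxE !eqxx mul1r big1 ?addr0 // => l nlj;
     rewrite mxE (negPf nlj) andbF mul0r.
rewrite linearD /= trmx1 trmx_delta mulmxDr mulmx1 mxE rowE.
have colE (A : 'M[K]_n.+1) : (A *m delta_mx j i) i i = A i j.
  rewrite mxE (bigD1 j) //= mxE !eqxx mulr1 big1 ?addr0 // => l nlj.
  by rewrite mxE (negPf nlj) mulr0.
rewrite colE rowE !di add0r addr0.
have -> : S j i = S i j by rewrite -{1}symS mxE.
by rewrite -mulr2n -mulr_natr mulf_eq0 negb_or Sij (natf_eq0 charK).
Qed.

End SymmetricFactor.

(** * Polynomial dependence on the quartic *)

Section PolyFunExamples.
Variables (K : fieldType) (charK : [pchar K] =i pred0).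

Lemma polyfunMn (U : vectType K) (f : U -> K) k :
  polyfun f -> polyfun (fun v => f v *+ k).
Proof. by move=> [p fp]; exists (p *+ k) => v; rewrite mevalMn fp. Qed.

Lemma mpolyfun_deriv (U : vectType K) n (G : U -> {mpoly K[n]}) i :
  mpolyfun G -> mpolyfun (fun v => (G v)^`M(i)).
Proof.
move=> pG m; apply: polyfun_ext (polyfunMn (m i).+1 (pG (m + U_(i))%MM)) => v.
by rewrite mcoeff_deriv.
Qed.

Lemma mpolyfun_mderivm (U : vectType K) n (G : U -> {mpoly K[n]}) m :
  mpolyfun G -> mpolyfun (fun v => (G v)^`M[m]).
Proof.
move=> pG m'; apply: polyfun_ext (polyfunMn (\prod_(i < n) ((m + m')%MM i) ^_ (m i))
  (pG (m + m')%MM)) => v.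
by rewrite mcoeff_mderivm.
Qed.

Lemma polyfun_xcoef m : polyfun (fun F : quartic K => (F : {mpoly K[3]})@_m).
Proof.
apply: polyfun_linear => a u v; rewrite -mcoeffZ -mcoeffD.
by congr (mcoeff m).
Qed.

Lemma msize_quartic (F : quartic K) : (msize (F : {mpoly K[3]}) <= 5)%N.
Proof.
rewrite msizeE; apply/bigmax_leqP_seq => m mF _.
by rewrite (dhomog_mf (dhomog_is_dhomog F) mF).
Qed.

Lemma mpolyfun_scale_const n (U : vectType K) (f : U -> K) (p : {mpoly K[n]}) :
  polyfun f -> mpolyfun (fun v => f v *: p).
Proof. by move=> pf; apply: mpolyfunZ pf (mpolyfun_const _ p). Qed.

Lemma mpolyfun_salmon_q k : mpolyfun (fun F : quartic K => salmon_q F k).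
Proof.
pose x := plane_fst (fun i => 'X_i : {mpoly K[3]}).
pose y := plane_snd (fun i => 'X_i : {mpoly K[3]}).
pose mu := [multinom [tuple (4 - k)%N; k]].
have mE (F : quartic K) : salmon_q F k = \sum_(m : 'X_{1..3 < 5})
    ((F : {mpoly K[3]})@_m *: (('C(4, k)%:R : K)^-1 *: (mmap1 (lineform x y) m)@_mu)).
  rewrite /salmon_q salmon_restrE /restrict (mmapE _ (msize_quartic F)).
  rewrite raddf_sum scaler_sumr; apply: eq_bigr => m _ /=.
  by rewrite mcoeffCM mul_mpolyC !scalerA mulrC.
apply: mpolyfun_ext (fun F => esym (mE F)) _.
by apply: mpolyfun_sum => m; apply: mpolyfun_scale_const; exact: polyfun_xcoef.
Qed.

Lemma mpolyfun_salmon_num : mpolyfun (fun F : quartic K => salmon_num F).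
Proof.
have q := mpolyfun_salmon_q; rewrite /salmon_num.
do ![apply: mpolyfunD | apply: mpolyfunN | apply: mpolyfunM | apply: mpolyfunX
  | exact: mpolyfun_const | exact: q].
Qed.

(** The coefficients of [psi F] are among those of the numerator, because the
    division by [v_3^6] is exact. *)
Lemma mpolyfun_psi : mpolyfun (fun F : quartic K => psi F).
Proof.
move=> m; apply: polyfun_ext (mpolyfun_salmon_num (U_(2%R) *+ 6 + m)%MM) => F.
by rewrite -(psiP charK (dhomog_is_dhomog F)) mulrC mpolyXn mcoeffMX.
Qed.

Lemma mpolyfun_rho : mpolyfun (fun F : quartic K => rho F).
Proof.
apply: (@mpolyfun_ext _ _ _ (fun F : quartic K => 144%:R^-1 *:
  \sum_(m : 'X_{1..3 < 5}) (F : {mpoly K[3]})@_m *: (psi F)^`M[m])).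
  by move=> F; rewrite /rho (diffopwE _ (msize_quartic F)).
apply: mpolyfunZ; first exact: polyfun_const.
apply: mpolyfun_sum => m; apply: mpolyfunZ; first exact: polyfun_xcoef.
exact: mpolyfun_mderivm mpolyfun_psi.
Qed.

Lemma polyfun_half_hessian_rho i j :
  polyfun (fun F : quartic K => half_hessian (rho F) i j).
Proof.
apply: polyfun_ext (polyfunM (polyfun_const _ 2%:R^-1)
  (mpolyfun_deriv j (mpolyfun_deriv i mpolyfun_rho) 0%MM)) => F.
by rewrite mxE.
Qed.

Local Notation FT := (quartic K * 'M[K]_3)%type.

Lemma mpolyfun_form_act : mpolyfun (fun w : FT => substmx w.2 w.1).
Proof.
apply: (@mpolyfun_ext _ _ _ (fun w : FT => \sum_(m : 'X_{1..3 < 5})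
   (w.1 : {mpoly K[3]})@_m *: \prod_(i < 3) (\sum_j w.2 i j *: 'X_j) ^+ m i)).
  move=> w; rewrite substmxE (comp_mpolywE _ (msize_quartic w.1)).
  apply: eq_bigr => m _; congr (_ *: _); apply: eq_bigr => i _.
  by rewrite tnth_mktuple.
apply: mpolyfun_sum => m; apply: mpolyfunZ.
  apply: polyfun_linear => a u v; rewrite -mcoeffZ -mcoeffD.
  by congr (mcoeff m).
apply: mpolyfun_prod => i; apply: mpolyfunX; apply: mpolyfun_sum => j.
apply: mpolyfun_scale_const.
by apply: polyfun_linear => a u v; rewrite /= !mxE.
Qed.

Lemma polyfun_joint_ellstar (j : joint K -> K) : polyfun j ->
  polyfun (fun w : FT => j (ellstar (form_act w.1 w.2))).
Proof.
move=> [p jp].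
apply: (@polyfun_ext _ _ (fun w : FT =>
   p.@[fun i => coord (vbasis {: joint K}) i (ellstar (form_act w.1 w.2))])).
  by move=> w; rewrite -jp.
apply: polyfun_meval => i.
pose c a b e := coord (vbasis {: joint K}) i (ellstar_mon K a b e).
apply: (@polyfun_ext _ _ (fun w : FT =>
  sum15 (fun a b e => xcoef (form_act w.1 w.2) a b e * c a b e))).
  move=> w; rewrite ellstar_sum15; symmetry.
  apply: (linear_sum15 (V := K^o) (L := coord (vbasis {: joint K}) i)).
    by move=> u v; rewrite linearD.
  by move=> a u; rewrite linearZ.
have px a b e : polyfun (fun w : FT => xcoef (form_act w.1 w.2) a b e * c a b e).
  by apply: polyfunM (polyfun_const _ _); exact: mpolyfun_form_act.
by rewrite /sum15; do 14![apply: polyfunD => //].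
Qed.

End PolyFunExamples.

(** * From functions of matrices to generic polynomials *)

Section MatrixFunctions.
Variables (K : fieldType) (charK : [pchar K] =i pred0).
Implicit Types (f : {mpoly K[3 * 3]}) (T N M : 'M[K]_3).

(** The ring [P] consists of the polynomials in the entries of a generic 3 x 3
    matrix [T], numbered by [mxvec_index]. *)
Definition entries (R : Type) (T : 'M[R]_3) (k : 'I_(3 * 3)) : R := mxvec T 0 k.

Lemma meval_ent T i a : (ent K i a).@[entries T] = T i a.
Proof. by rewrite /ent mevalXU /entries mxvecE. Qed.

Lemma meval_gram T i j : (gram K i j).@[entries T] =
  2%:R * T i 1 * T j 1 - T i 0 * T j 2 - T i 2 * T j 0.
Proof.
rewrite /gram 2!mevalB mevalMn 3!mevalM !meval_ent.
by rewrite -mulrA mulr_natl.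
Qed.

Lemma meval_lie N T f :
  (lie N f).@[entries T] = \sum_k f^`M(k).@[entries T] * entries (T *m N) k.
Proof.
rewrite [RHS](reindex _ (curry_mxvec_bij 3 3)) /lie (raddf_sum (meval _)).
under [LHS]eq_bigr do rewrite (raddf_sum (meval _)).
rewrite pair_big; apply: eq_bigr => -[i b] _ /=.
rewrite mevalM mulrC; congr (_ * _).
rewrite /entmx raddf_sum /entries mxvecE mxE; apply: eq_bigr => a _ /=.
by rewrite mevalZ meval_ent mulrC.
Qed.

(** Compare the derivatives at [t = 0].  The term [t^2 M] leaves them unchanged;
    it is there because the unipotent elements of SO3 are quadratic in their
    parameter. *)
Lemma lie_of_curve N M f (c : {poly K}) :
  (forall T t, f.@[entries (T *m (1%:M + t *: N + t ^+ 2 *: M))]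
     = c.[t] * f.@[entries T]) ->
  lie N f = c^`().[0] *: f.
Proof.
move=> fc; apply: (mpoly_eq_fun charK) => x; rewrite mevalZ.
pose T := vec_mx (\row_k x k).
have Tx p : p.@[x] = p.@[entries T].
  by apply: meval_eq => k; rewrite /entries vec_mxK mxE.
rewrite !Tx meval_lie.
pose h k : {poly K} := (entries T k)%:P + entries (T *m N) k *: 'X
  + entries (T *m M) k *: 'X^2.
have hE t k : (h k).[t] = entries (T *m (1%:M + t *: N + t ^+ 2 *: M)) k.
  rewrite /h !hornerE /entries !mulmxDr mulmx1 -!scalemxAr !linearD !linearZ /=.
  by rewrite !mxE; ring.
have := @deriv_along_curve _ charK _ h (f.@[entries T] *: c) f.
have h0 k : (h k).[0] = entries T k by rewrite /h !hornerE /=; ring.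
have dh k : (h k)^`().[0] = entries (T *m N) k.
  rewrite /h !derivD derivC !derivZ derivX derivXn !hornerE /=; ring.
move=> /(_ _ 0); rewrite derivZ hornerZ mulrC => <-.
  by apply: eq_bigr => k _; rewrite dh; congr (_ * _); apply: meval_eq.
move=> t; rewrite hornerZ mulrC -fc; apply: meval_eq => k; exact: hE.
Qed.

End MatrixFunctions.

Section BaseChange.
Variables (R S : comUnitRingType) (g : {rmorphism R -> S}).

Lemma map_mpoly_deriv n (f : {mpoly R[n]}) k :
  (map_mpoly g f)^`M(k) = map_mpoly g f^`M(k).
Proof.
apply/mpolyP => m; rewrite mcoeff_deriv !mcoeff_map_mpoly /= mcoeff_deriv.
exact: esym (rmorphMn g _ _).
Qed.

Lemma map_mpoly_lie (N : 'M[R]_3) f :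
  map_mpoly g (lie N f) = lie (map_mx g N) (map_mpoly g f).
Proof.
rewrite /lie raddf_sum; apply: eq_bigr => i _ /=.
rewrite raddf_sum; apply: eq_bigr => b _ /=.
rewrite rmorphM /= /dent map_mpoly_deriv; congr (_ * _).
rewrite /entmx raddf_sum; apply: eq_bigr => a _ /=.
by rewrite map_mpolyZ /= map_mpolyX mxE.
Qed.

Lemma map_so3_e : map_mx g (so3_e R) = so3_e S.
Proof. by rewrite /so3_e map_mxD (raddfMn (map_mx g)) /= !map_delta_mx. Qed.

Lemma map_so3_f : map_mx g (so3_f R) = so3_f S.
Proof. by rewrite /so3_f map_mxD (raddfMn (map_mx g)) /= !map_delta_mx. Qed.

Lemma map_mpoly_gram i j : map_mpoly g (gram R i j) = gram S i j.
Proof.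
have map_ent a b : map_mpoly g (ent R a b) = ent S a b by rewrite /ent map_mpolyX.
rewrite /gram 2!(rmorphB (map_mpoly g)) (rmorphMn (map_mpoly g)).
by rewrite 3!(rmorphM (map_mpoly g)) -!map_ent.
Qed.

End BaseChange.

Section Generic.
Variables (K : fieldType) (charK : [pchar K] =i pred0).
Local Notation FT := (quartic K * 'M[K]_3)%type.
Local Notation R := {mpoly K[\dim {: quartic K}]}.

Definition quartic_coord (F : quartic K) i := coord (vbasis {: quartic K}) i F.

Lemma quartic_coord_surj x : exists F, quartic_coord F =1 x.
Proof.
exists (\sum_i x i *: (vbasis {: quartic K})`_i) => i.
by rewrite /quartic_coord coord_sum_free // (basis_free (vbasisP _)).
Qed.

(** A polynomial over [R] in the entries of [T] is a polynomial function of [F]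
    and [T]; this fixes the value of [F]. *)
Definition specialize (F : quartic K) : {mpoly R[3 * 3]} -> {mpoly K[3 * 3]} :=
  map_mpoly (meval (quartic_coord F)).

Lemma specialize_eq0 f : (forall F, specialize F f = 0) -> f = 0.
Proof.
move=> f0; apply/mpolyP => m; rewrite mcoeff0.
apply: (mpoly_eq0_fun charK) => x; have [F Fx] := quartic_coord_surj x.
rewrite -(meval_eq _ Fx) -[RHS](mcoeff0 K m) -(f0 F).
by rewrite /specialize mcoeff_map_mpoly.
Qed.

Lemma mpoly_natr_unit k : (k.+1%:R : R) \is a GRing.unit.
Proof.
apply/unitrP; exists (k.+1%:R^-1)%:MP.
have n0 : (k.+1%:R : K) != 0 by rewrite (natf_eq0 charK).
by rewrite -mpolyC_nat -!mpolyCM mulVf // mulfV.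
Qed.

(** A point of the product space is the sum of its coordinates along [F] and of
    the entries of [T] on the corresponding basis vectors; substituting this
    expansion separates the two groups of variables. *)
Lemma generic_polynomial (h : FT -> K) : polyfun h ->
  exists f : {mpoly R[3 * 3]}, forall F T,
    (specialize F f).@[entries T] = h (F, T).
Proof.
move=> [p hp].
pose phi k (w : FT) := coord (vbasis {: FT}) k w.
pose b (i : 'I_(\dim {: quartic K})) : FT := ((vbasis {: quartic K})`_i, 0).
pose e l : FT := (0, vec_mx (delta_mx 0 l)).
pose x k : {mpoly R[3 * 3]} := (\sum_i phi k (b i) *: 'X_i)%:MP
  + \sum_l (phi k (e l))%:MP%:MP * 'X_l.
exists (mmap (@mpolyC (3 * 3) R \o @mpolyC _ K) x p) => F T; rewrite hp.
have phiE k : phi k (F, T) = \sum_i quartic_coord F i * phi k (b i)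
    + \sum_l entries T l * phi k (e l).
  rewrite /phi; have -> : (F, T) = \sum_i quartic_coord F i *: b i + \sum_l entries T l *: e l.
    have pairE (u v : FT) : u.1 = v.1 -> u.2 = v.2 -> u = v.
      by case: u v => [u1 u2] [v1 v2] /= -> ->.
    apply: pairE.
      rewrite /= (raddf_sum fst) (raddf_sum fst) /=.
      rewrite [X in _ + X]big1 ?addr0 => [|l _]; last by rewrite scaler0.
      by rewrite {1}(coord_vbasis (memvf F)).
    rewrite /= (raddf_sum snd) (raddf_sum snd) /=.
    rewrite [X in X + _]big1 ?add0r => [|l _]; last by rewrite scaler0.
    rewrite -{1}[T]mxvecK {1}(row_sum_delta (mxvec T)) linear_sum /=.
    by apply: eq_bigr => l _; rewrite linearZ.
  rewrite linearD !linear_sum /=.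
  by congr (_ + _); apply: eq_bigr => i _; rewrite linearZ.
rewrite /specialize; elim/mpoly_alg_ind: p {hp} => [c|k|p q IHp IHq|p q IHp IHq].
- by rewrite mmapC /= map_mpolyC /= !mevalC.
- rewrite mmapX mmap1U mevalXU -/(phi k _) phiE /x !rmorphD /=.
  rewrite map_mpolyC /= mevalC; congr (_ + _).
    by rewrite raddf_sum; apply: eq_bigr => i _; rewrite /= mevalZ mevalXU mulrC.
  rewrite (raddf_sum (map_mpoly _)) (raddf_sum (meval _)).
  apply: eq_bigr => l _; rewrite /= rmorphM /= map_mpolyC /= mevalC map_mpolyX.
  by rewrite mevalM mevalC mevalXU mulrC.
- rewrite mmapD (rmorphD (map_mpoly _)) (rmorphD (meval _)).
  by rewrite [RHS]mevalD -IHp -IHq.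
- rewrite rmorphM (rmorphM (map_mpoly _)) (rmorphM (meval _)).
  by rewrite [RHS]mevalM -IHp -IHq.
Qed.

End Generic.

(** * Factorization through Gram matrices *)

Lemma sum15_scale (R : comNzRingType) (V : lmodType R) a (x y : nat -> nat -> nat -> R)
    (f : nat -> nat -> nat -> V) : (forall i j k, y i j k = a * x i j k) ->
  sum15 (fun i j k => y i j k *: f i j k) =
  a *: sum15 (fun i j k => x i j k *: f i j k).
Proof. by move=> yx; rewrite /sum15 !scalerDr !scalerA !yx. Qed.

Section FormActions.
Variable K : fieldType.
Implicit Types (F : quartic K) (S T : 'M[K]_3).

Lemma ellstarZ a F : ellstar (a *: F) = a *: ellstar F.
Proof.
rewrite !ellstar_sum15; apply: sum15_scale => i j k; exact: mcoeffZ.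
Qed.

Lemma form_act_mul F S T : form_act (form_act F S) T = form_act F (S *m T).
Proof. by apply: val_inj; exact: substmx_mul. Qed.

Lemma form_act1 F : form_act F 1%:M = F.
Proof. by apply: val_inj; exact: substmx1. Qed.

Lemma form_actZ F a T : form_act F (a *: T) = a ^+ 4 *: form_act F T.
Proof.
apply: val_inj; rewrite /= !substmxE !comp_mpolyE scaler_sumr.
rewrite big_seq [RHS]big_seq; apply: eq_bigr => m mF.
rewrite scalerA mulrC -scalerA; congr (_ *: _).
have <- : mdeg m = 4%N by exact: (dhomog_mf (dhomog_is_dhomog F) mF).
rewrite mdegE -prodrXr -scaler_prod; apply: eq_bigr => i _.
rewrite !tnth_mktuple -exprZn scaler_sumr; congr (_ ^+ _).
by apply: eq_bigr => k _; rewrite mxE scalerA.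
Qed.

End FormActions.

Section RhoScaling.
Variables (K : fieldType) (charK : [pchar K] =i pred0).
Implicit Types (F : {mpoly K[3]}).

Lemma salmon_qZ a F k : salmon_q (a *: F) k = a *: salmon_q F k.
Proof.
rewrite /salmon_q !salmon_restrE /restrict mmapZ mcoeffCM.
by rewrite mul_mpolyC !scalerA mulrC.
Qed.

Lemma salmon_numZ a F : salmon_num (a *: F) = a ^+ 3 *: salmon_num F.
Proof.
have scaled (q : nat -> {mpoly K[3]}) (c : {mpoly K[3]}) :
    binary_cubic (fun k => c * q k) = c ^+ 3 * binary_cubic q.
  by rewrite /binary_cubic; ring.
rewrite -[LHS]/(binary_cubic (salmon_q (a *: F))).
rewrite (@eq_binary_cubic _ _ (fun k => a%:MP * salmon_q F k)) => [|k _].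
  by rewrite scaled -(rmorphXn (@mpolyC 3 K)) mul_mpolyC.
by rewrite salmon_qZ mul_mpolyC.
Qed.

Lemma psiZ a F : F \is 4.-homog -> psi (a *: F) = a ^+ 3 *: psi F.
Proof.
move=> F4; have X6 : ('X_2 : {mpoly K[3]}) ^+ 6 != 0 by rewrite expf_neq0 ?mpolyX_neq0.
have aF4 : a *: F \is 4.-homog by exact: dhomogZ.
apply: (mulfI X6); apply: etrans (psiP charK aF4) _.
rewrite salmon_numZ -(psiP charK F4); exact: scalerAr.
Qed.

Lemma rhoZ a F : F \is 4.-homog -> rho (a *: F) = a ^+ 4 *: rho F.
Proof.
move=> F4; rewrite /rho (psiZ a F4) diffopZl diffopZr !scalerA; congr (_ *: _).
by move: (144%:R^-1) => c; ring.
Qed.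

End RhoScaling.

Section ConicMatrix.
Variables (K : closedFieldType) (charK : [pchar K] =i pred0).
Local Notation H0 := (half_hessian (conic K)).

(** [H0] itself is [C C^t] with [C] invertible. *)
Lemma conic_congruence_entry (T : 'M[K]_3) i j :
  2%:R * (T *m H0 *m T^T) i j =
    2%:R * T i 1 * T j 1 - T i 0 * T j 2 - T i 2 * T j 0.
Proof.
have two_neq0 : (2%:R : K) != 0 by rewrite (natf_eq0 charK).
rewrite mxE sum3 !mxE !sum3 !(half_hessian_conic charK) /=.
by field.
Qed.

Lemma half_hessian_conic_factor : exists2 C : 'M[K]_3, C \in unitmx & H0 = C *m C^T.
Proof.
have [C CE] := sym_factor charK (half_hessian_sym (conic K)).
exists C => //.
pose Hinv : 'M[K]_3 := delta_mx 1 1 - 2%:R *: (delta_mx 0 2 + delta_mx 2 0).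
have two_neq0 : (2%:R : K) != 0 by rewrite (natf_eq0 charK).
have : C *m (C^T *m Hinv) = 1%:M.
  rewrite mulmxA -CE; apply/matrixP => i j; rewrite mxE sum3 !(half_hessian_conic charK).
  rewrite !mxE.
  by case: i => [[|[|[|//]]]] ?; case: j => [[|[|[|//]]]] ? /=; field.
by case/mulmx1_unit.
Qed.

(** [H0] itself is [C C^t] with [C] invertible. *)
Lemma conic_congruence (S : 'M[K]_3) : S^T = S -> exists T, T *m H0 *m T^T = S.
Proof.
move=> /(sym_factor charK)[T' ->]; have [C uC ->] := half_hessian_conic_factor.
exists (T' *m invmx C); rewrite trmx_mul !mulmxA mulmxKV // -!mulmxA.
by rewrite [C^T *m _]mulmxA -trmx_mul mulVmx // trmx1 mul1mx.
Qed.

End ConicMatrix.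

Section Evaluations.
Variables (K : closedFieldType) (charK : [pchar K] =i pred0).
Local Notation R := {mpoly K[\dim {: quartic K}]}.
Local Notation H0 := (half_hessian (conic K)).

Lemma polyfun_specialize n (q : {mpoly R[n]}) (x : 'I_n -> quartic K -> K) :
  (forall k, polyfun (x k)) ->
  polyfun (fun F => (map_mpoly (meval (quartic_coord F)) q).@[fun k => x k F]).
Proof.
move=> px; elim/mpoly_alg_ind: q => [c|i|p q IHp IHq|p q IHp IHq].
- have coordP i : polyfun (fun F : quartic K => quartic_coord F i).
    by apply: polyfun_linear => a u v; exact: linearP.
  by apply: polyfun_ext (polyfun_meval c coordP) => F; rewrite map_mpolyC /= mevalC.
- by apply: polyfun_ext (px i) => F; rewrite map_mpolyX mevalXU.
- apply: polyfun_ext (polyfunD IHp IHq) => F.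
  by rewrite (rmorphD (map_mpoly _)) mevalD.
- apply: polyfun_ext (polyfunM IHp IHq) => F.
  by rewrite (rmorphM (map_mpoly _)) mevalM.
Qed.

Lemma meval_grams (F : quartic K) (T : 'M[K]_3) (q : {mpoly R[3 * 3]}) :
  (specialize F (q \mPo grams R)).@[entries T] =
  (map_mpoly (meval (quartic_coord F)) q).@[
    fun k => mxvec (2%:R *: (T *m H0 *m T^T)) 0 k].
Proof.
have evM := rmorphM (map_mpoly (n := 3 * 3) (meval (quartic_coord F))).
have evD := rmorphD (map_mpoly (n := 3 * 3) (meval (quartic_coord F))).
rewrite /specialize; elim/mpoly_alg_ind: q => [c|k|p q IHp IHq|p q IHp IHq].
- by rewrite comp_mpolyC !map_mpolyC /= !mevalC.
- rewrite comp_mpolyXU -tnth_nth map_mpolyX mevalXU tnth_mktuple.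
  case/mxvec_indexP: k => i l; rewrite !mxvecE mxE [in RHS]mxE.
  by rewrite (conic_congruence_entry charK) map_mpoly_gram meval_gram.
- by rewrite comp_mpolyD 2!evD 2!mevalD -IHp -IHq.
- by rewrite (rmorphM (comp_mpoly _)) 2!evM 2!mevalM -IHp -IHq.
Qed.

End Evaluations.

Section Main.
Variables (K : closedFieldType) (charK : [pchar K] =i pred0).
Variables (d : nat) (j : joint K -> K) (hj : joint_invariant d j).
Local Notation H0 := (half_hessian (conic K)).
Implicit Types (F : quartic K) (T : 'M[K]_3).

Lemma joint_scale a w : j (a *: w) = a ^+ d * j w.
Proof.
case: hj => _ [d1 [d2 [d3 [-> h1 h2 h3]]]] _; case: w => [[f g] h].
rewrite (homog_polyfun_scale a f (h1 (a *: g) (a *: h))).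
rewrite (homog_polyfun_scale a g (h2 f (a *: h))).
rewrite (homog_polyfun_scale a h (h3 f g)).
by rewrite !exprD !mulrA.
Qed.

Definition joint_value F T := j (ellstar (form_act F T)).

Lemma joint_valueZ F a T : joint_value F (a *: T) = a ^+ (4 * d) * joint_value F T.
Proof. by rewrite /joint_value form_actZ ellstarZ joint_scale exprM. Qed.

Lemma joint_value_sym2 F T (A : 'M[K]_2) : \det A = 1 ->
  joint_value F (T *m sym2 A) = joint_value F T.
Proof.
move=> detA; rewrite /joint_value -form_act_mul ellstar_equivariant //.
by case: hj => _ _ jA; rewrite jA.
Qed.

(** As a function of [T], the joint value is invariant under the symmetric
    squares of unipotent matrices, hence killed by so3, and it is
    homogeneous of the even degree [4 d].  The first fundamental theorem
    over the polynomials in the coordinates of [F] makes it a polynomial in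
    [F] and in the entries of [T H0 T^t], for which one can substitute those
    of the half Hessian of [rho F]. *)
Lemma gram_factorization : exists2 P : quartic K -> K, polyfun P &
  forall F T, T *m H0 *m T^T = half_hessian (rho F) -> P F = joint_value F T.
Proof.
have [polyj _ _] := hj.
have [f fE] := generic_polynomial (polyfun_joint_ellstar polyj).
have spec_lie N F : specialize F (lie N f) =
    lie (map_mx (meval (quartic_coord F)) N) (specialize F f).
  exact: map_mpoly_lie.
have inv_e : lie (so3_e _) f = 0.
  apply: (specialize_eq0 charK) => F; rewrite spec_lie map_so3_e.
  rewrite (lie_of_curve charK (M := delta_mx 0 2) (c := 1%:P)).
    by rewrite derivC horner0 scale0r.
  move=> T t; rewrite hornerC mul1r !fE -sym2_upper2.
  exact: joint_value_sym2 (det_upper2 t).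
have inv_f : lie (so3_f _) f = 0.
  apply: (specialize_eq0 charK) => F; rewrite spec_lie map_so3_f.
  rewrite (lie_of_curve charK (M := delta_mx 2 0) (c := 1%:P)).
    by rewrite derivC horner0 scale0r.
  move=> T t; rewrite hornerC mul1r !fE -sym2_lower2.
  exact: joint_value_sym2 (det_lower2 t).
have euler : lie 1%:M f = f *+ (2 * (2 * d)).
  apply/eqP; rewrite -subr_eq0; apply/eqP/(specialize_eq0 charK) => F.
  rewrite /specialize raddfB raddfMn /= -!/(specialize F _) spec_lie map_mx1.
  (* Along [T (1 + t)] the joint value is multiplied by [(1 + t)^(4 d)]. *)
  rewrite (lie_of_curve charK (M := 0) (c := (1 + 'X) ^+ (4 * d))).
    rewrite deriv_exp derivD derivC derivX add0r mul1r hornerMn horner_exp.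
    rewrite hornerD hornerC hornerX addr0 expr1n mulnA.
    by rewrite scaler_nat subrr.
  move=> T t; rewrite scaler0 addr0 !fE horner_exp hornerD hornerC hornerX.
  have -> : T *m (1%:M + t *: 1%:M) = (1 + t) *: T.
    by rewrite mulmxDr mulmx1 -scalemxAr mulmx1 scalerDl scale1r.
  exact: joint_valueZ.
have [q fq] := SO3_first_fundamental_theorem (mpoly_natr_unit charK) (conj inv_e inv_f) euler.
exists (fun F => (map_mpoly (meval (quartic_coord F)) q).@[
   fun k => mxvec (2%:R *: half_hessian (rho F)) 0 k]).
  apply: polyfun_specialize => k; case/mxvec_indexP: k => i l.
  apply: polyfun_ext (polyfunM (polyfun_const _ 2%:R)
    (polyfun_half_hessian_rho charK i l)) => F.
  by rewrite mxvecE [RHS]mxE.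
by move=> F T TE; rewrite /joint_value -(fE F T) fq -TE meval_grams.
Qed.

(** Since the half Hessian of [rho F] always has the form [T H0 T^t], every
    identity for [P] is one for joint values: [a^2 T] serves for [a F]
    because [rho] has degree 4, and [det(g)^3 g^-1 T] serves for [F.g]
    because [rho (F.g)] is [det(g)^6] times the transform of [rho F]. *)
Lemma invariant_polynomial : exists P : quartic K -> K,
  [/\ homog_polyfun (9 * d)%N P,
      forall F T, T *m H0 *m T^T = half_hessian (rho F) -> P F = joint_value F T &
      forall F (g : 'M[K]_3), g \in unitmx ->
        P (form_act F g) = \det g ^+ (12 * d) * P F].
Proof.
have [P polyP PE] := gram_factorization; exists P.
have factor F := conic_congruence charK (half_hessian_sym (rho F)).
have scaled c T : (c *: T) *m H0 *m (c *: T)^T = c ^+ 2 *: (T *m H0 *m T^T).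
  by rewrite linearZ /= -!scalemxAl -scalemxAr scalerA expr2.
split=> // [|F g ug].
  apply: (polyfun_homog charK polyP) => a F; have [T TE] := factor F.
  have aTE : (a ^+ 2 *: T) *m H0 *m (a ^+ 2 *: T)^T = half_hessian (rho (a *: F)).
    apply: etrans (scaled _ _) _; rewrite TE -exprM -half_hessianZ.
    by congr half_hessian; exact: esym (rhoZ charK _ (dhomog_is_dhomog F)).
  rewrite (PE _ _ TE) (PE _ _ aTE) joint_valueZ /joint_value.
  have -> : form_act (a *: F) T = a *: form_act F T.
    by apply: val_inj; exact: substmxZ.
  rewrite ellstarZ joint_scale mulrA -exprM -exprD; congr (_ ^+ _ * _); lia.
have [T TE] := factor F.
have gTE : (\det g ^+ 3 *: (invmx g *m T)) *m H0 *m (\det g ^+ 3 *: (invmx g *m T))^T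
    = half_hessian (rho (form_act F g)).
  apply: etrans (scaled _ _) _; rewrite -exprM.
  apply: etrans (esym (half_hessian_rho_substmx charK ug (dhomog_is_dhomog F))).
  by congr (_ *: _); rewrite -TE trmx_mul !mulmxA.
rewrite (PE F T TE); apply: etrans (PE _ _ gTE) _; apply: etrans (joint_valueZ _ _ _) _.
rewrite -exprM mulnA /joint_value form_act_mul; congr (_ * j (ellstar (form_act F _))).
by rewrite mulmxA mulmxV // mul1mx.
Qed.

End Main.

Theorem theorem2p16 (K : closedFieldType) (charK : [pchar K] =i pred0)
    (d : nat) (j : joint K -> K) (hj : joint_invariant d j) :
  exists P : quartic K -> K,
    [/\ homog_polyfun (9 * d)%N P,
        SL_invariant P,
        (forall (F : quartic K) (u : K), onZ F u ->
           j (ellstar F) = P F / u ^+ (2 * d)) &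
        (forall (F : quartic K) (T : 'M[K]_3),
           I12 F != 0 -> I9 F != 0 -> T \in unitmx ->
           (exists2 c : K, c != 0 & vec_act (rho F) T = c *: conic K) ->
           b0 (ellstar (form_act F T)) != 0 /\
           j (ellstar (form_act F T)) / b0 (ellstar (form_act F T)) ^+ d
             = 5%:R ^+ d * P F / I9 F ^+ d)].
Proof.
have [P [homP PE semiP]] := invariant_polynomial charK hj; exists P.
have onZP (F : quartic K) u : onZ F u -> P F = u ^+ (2 * d) * j (ellstar F).
  move=> [u_neq0 rhoF]; have [r ru] := sqrt_exists u.
  (* [r] is a square root of [u], so [r] times the identity has Gram matrix [u H0]. *)
  rewrite (PE F (r *: 1%:M)).
    rewrite (joint_valueZ hj) /joint_value form_act1; congr (_ * _).
    by rewrite -ru -exprM; congr (_ ^+ _); lia.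
  rewrite rhoF half_hessianZ -ru expr2 linearZ /= trmx1 -!scalemxAl -scalemxAr.
  by rewrite mul1mx mulmx1 scalerA.
split=> // [T F detT|F u Zu|F T _ I9F uT [c c_neq0 rhoT]].
- by rewrite semiP ?detT ?expr1n ?mul1r // unitmxE detT unitr1.
- by rewrite (onZP F u Zu) mulrC mulKf // expf_neq0 //; case: Zu.
have detT : \det T != 0 by rewrite -unitfE -unitmxE.
(* The point [F.T] lies on [Z], where everything is known, and [I9] and [P] are
   multiplied by [det T ^ 12] and [det T ^ (12 d)] on the way from [F]. *)
pose F' := form_act F T; pose u := \det T ^+ 6 * c.
have F4 := dhomog_is_dhomog F.
have Zu : onZ F' u.
  split; first by rewrite mulf_neq0 ?expf_neq0.
  by apply: etrans (rho_substmx charK uT F4) _; rewrite -vec_actE rhoT scalerA.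
have [u_neq0 rhoF'] := Zu.
have I9F' : \det T ^+ 12 * I9 F = 5%:R * u ^+ 2 * b0 (ellstar F').
  by rewrite -(I9_b0_onZ charK rhoF'); exact: esym (I9_substmx charK uT F4).
have five_neq0 : (5%:R : K) != 0 by rewrite (natf_eq0 charK).
have b0_neq0 : b0 (ellstar F') != 0.
  have : \det T ^+ 12 * I9 F != 0 by rewrite mulf_neq0 ?expf_neq0.
  by rewrite I9F' mulf_eq0 => /norP[].
split=> //; rewrite -/F'.
have PF' := etrans (esym (semiP F T uT)) (onZP F' u Zu).
clearbody u; clear rhoF' Zu.
apply: (mulfI (expf_neq0 (2 * d) u_neq0)); rewrite mulrA -PF'.
have -> : I9 F ^+ d = (5%:R * u ^+ 2 * b0 (ellstar F')) ^+ d / \det T ^+ (12 * d).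
  by rewrite -I9F' exprMn exprM mulrC mulKf // -exprM expf_neq0.
rewrite exprMn [(5%:R * _) ^+ d]exprMn -exprM; field.
by rewrite !expf_neq0.
Qed.
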